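(* Let $\Omega=(a,b)$, $\alpha\in\Omega$, $\beta^\pm>0$, and $p\ge 2$. Let $\mathcal T_h=\{\tau_i\}_{i=1}^N$ be a mesh of $\Omega$ with mesh size $h$ such that the interface $\alpha\in\tau_k$. Let $u\in\tilde W^{p+2,\infty}_\beta(\Omega)$ be the exact solution of the diffusion interface problem $$-(\beta u')'=f\ \text{ in }\Omega^-\cup\Omega^+,\qquad u(a)=u(b)=0,\qquad [\![u(\alpha)]\!]=0,\quad [\![\beta u'(\alpha)]\!]=0,$$ and let $u_h\in S_p(\mathcal T_h)$ be the immersed finite element solution, i.e. $(\beta u_h',v_h')=(f,v_h)$ for all $v_h\in S_p(\mathcal T_h)$. Then: (i) $u_h$ is exact at the mesh points: $(u-u_h)(x_i)=0$ for all $i=0,1,\dots,N$. (ii) On every noninterface element $\tau_i$, $i\ne k$, $u_h$ is superconvergent at the roots $l_{im}$ of the Lobatto polynomial $\psi_{i,p+1}$, and $u_h'$ is superconvergent at the roots $g_{in}$ of the Legendre polynomial $P_{i,p}$. That is, there exists a constant $C$ depending only on $p$ such that $$|(u-u_h)(l_{im})|\le C h^{p+2}|u|_{p+2,\infty},\qquad |(u'-u_h')(g_{in})|\le C h^{p+1}|u|_{p+2,\infty}.$$ (iii) On the interface element $\tau_k$, $u_h$ is superconvergent at the roots $l_{km}$ of the generalized Lobatto polynomial $\phi_{k,p+1}$, and the flux $\beta u_h'$ is superconvergent at the roots $g_{kn}$ of the generalized Legendre polynomial $L_{k,p}$. That is, there exists a constant $C$ depending only on $p$ and the ratio $\rho=\max\{\beta^+,\beta^-\}/\min\{\beta^+,\beta^-\}$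 such that $$|(u-u_h)(l_{km})|\le C h^{p+2}|u|_{p+2,\infty},\qquad |(\beta u'-\beta u_h')(g_{kn})|\le C h^{p+1}|u|_{p+2,\infty}.$$
   Context: Setting: $\Omega^-=(a,\alpha)$, $\Omega^+=(\alpha,b)$; $\beta=\beta^-$ on $\Omega^-$, $\beta=\beta^+$ on $\Omega^+$. $[\![v(\alpha)]\!]=v(\alpha^+)-v(\alpha^-)$. $(\cdot,\cdot)$ is the $L^2(a,b)$ inner product. Spaces: $\tilde W^{m,q}_\beta(\Omega)$ is the set of $v\in C(\Omega)$ with $v|_{\Omega^\pm}\in W^{m,q}(\Omega^\pm)$, $v|_{\partial\Omega}=0$, and $[\![\beta v^{(j)}(\alpha)]\!]=0$ for $j=1,2,\dots,m$. Seminorms are piecewise: $|v|_{m,\infty}=\max\{|v|_{m,\infty,\Omega^-},|v|_{m,\infty,\Omega^+}\}$. Mesh: $a=x_0<x_1<\dots<x_{k-1}\le\alpha\le x_k<\dots<x_N=b$, $\tau_i=(x_{i-1},x_i)$, $h_i=x_i-x_{i-1}$, $h=\max_i h_i$. $\tau_k$ is the interface element, the others are noninterface elements. Standard polynomials on $[-1,1]$: $P_n$ is the Legendre polynomial of degree $n$; Lobatto polynomials $\psi_0=\frac{1-\xi}2$, $\psi_1=\frac{1+\xi}2$, $\psi_n(\xi)=\int_{-1}^\xi P_{n-1}(t)\,dt$ for $n\ge2$. Generalized polynomials on $[-1,1]$: let $\hat\alpha$ be the image of $\alpha$ under the affine map $\tau_k\to[-1,1]$, $\hat\beta=\beta^-$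 on $(-1,\hat\alpha)$, $\hat\beta=\beta^+$ on $(\hat\alpha,1)$, $w=1/\hat\beta$. The generalized Legendre polynomials $\{L_n\}_{n\ge 0}$ are the monic polynomials, $\deg L_n=n$, orthogonal for $\int_{-1}^1 w\,fg\,d\xi$. The generalized Lobatto polynomials are: $\phi_0,\phi_1$, the unique continuous functions that are affine on each of $(-1,\hat\alpha)$ and $(\hat\alpha,1)$, satisfy $[\![\hat\beta\phi'(\hat\alpha)]\!]=0$, and $\phi_0(-1)=1,\phi_0(1)=0$, $\phi_1(-1)=0,\phi_1(1)=1$; and $\phi_n(\xi)=\int_{-1}^\xi w(t)L_{n-1}(t)\,dt$ for $n\ge2$. The roots of $\phi_{p+1}$ are $\pm1$ and the $p-1$ points of $(-1,1)$ where it crosses the axis. Physical elements: with $\xi=(2x-x_{i-1}-x_i)/h_i$, put $\psi_{i,n}(x)=\psi_n(\xi)$, $P_{i,n}(x)=P_n(\xi)$ on $\tau_i$, and $\phi_{k,n}(x)=\phi_n(\xi)$, $L_{k,n}(x)=L_n(\xi)$ on $\tau_k$ (with $i=k$). Discrete space: $\mathbb P_p(\tau_i)$ is the space of polynomials of degree $\le p$ on $\tau_i$; $\tilde{\mathbb P}_p(\tau_k)=\mathrm{span}\{\phi_{k,n}:0\le n\le p\}$; $S_p(\mathcal T_h)=\{v\in H^1_0(\Omega): v|_{\tau_i}\in\mathbb P_p(\tau_i)\ (i\ne k),\ v|_{\tau_k}\in\tilde{\mathbb P}_p(\tau_k)\}$.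
   Formalization: In (iii) the flux bound is proved as C max{β⁺,β⁻} h^{p+1}|u|_{p+2,∞}: without the factor max{β⁺,β⁻} a constant depending only on p and ρ is impossible, since scaling β and f by λ fixes u, u_h and ρ but multiplies the flux error by λ. *)

(* Defs.v *)
From HB Require Import structures.
From mathcomp Require Import all_boot all_order all_algebra.
From mathcomp Require Import all_classical all_reals all_analysis.

Set Implicit Arguments.
Unset Strict Implicit.
Unset Printing Implicit Defensive.

Import Order.TTheory GRing.Theory Num.Theory.
Import numFieldNormedType.Exports.

Local Open Scope classical_set_scope.
Local Open Scope ring_scope.

Section Sobolev.
Variable R : realType.
Implicit Types (I : set R) (q : \bar R) (v g : R -> R).

Definition inner (a b : R) (v w : R -> R) : R :=
  \int[@lebesgue_measure R]_(t in `]a, b[) (v t * w t).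

Definition LnormOn I q v : \bar R :=
  Lnorm (@lebesgue_measure R) q (EFin \o (v \_ I)).

Definition in_Lq I q v : Prop :=
  measurable_fun I v /\ (LnormOn I q v < +oo)%E.

(* Weak derivatives are tested against C^1_c(I), and W^{m,q}(I) is iterated
   from the first-order notion, as is usual in one dimension (e.g. Brezis,
   Functional Analysis, Sobolev Spaces and PDEs, Chapter 8). *)
Definition test_fun I (chi : R -> R) : Prop :=
  [/\ forall x, derivable chi x 1,
      continuous (derive1 chi),
      compact (closure [set x | chi x != 0]) &
      closure [set x | chi x != 0] `<=` I].

Definition weak_deriv I v g : Prop :=
  [/\ locally_integrable I v,
      locally_integrable I g &
      forall chi, test_fun I chi ->
        \int[@lebesgue_measure R]_(t in I) (v t * derive1 chi t) =
        - \int[@lebesgue_measure R]_(t in I) (g t * chi t)].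

Fixpoint weak_derivn I (n : nat) v : set (R -> R) :=
  if n is n'.+1 then
    [set g | exists2 v', weak_deriv I v v' & weak_derivn I n' v' g]
  else [set v].

Fixpoint sobolev I q (m : nat) v : Prop :=
  in_Lq I q v /\
  (if m is m'.+1 then exists2 v', weak_deriv I v v' & sobolev I q m' v'
   else True).

(* |v|_{m,q,I}.  All representatives of the m-th weak derivative have the same
   norm; the infimum selects this common value, and is +oo when there is no
   m-th weak derivative. *)
Definition seminorm I q (m : nat) v : \bar R :=
  ereal_inf [set LnormOn I q g | g in weak_derivn I m v].

(* Elements of H^1_0(a, b) are identified with their continuous
   representative on [a, b]. *)
Definition H10 (a b : R) v : Prop :=
  [/\ sobolev `]a, b[ 2%:E 1 v,
      {within `[a, b], continuous v}, v a = 0 & v b = 0].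

End Sobolev.

Section Interface.
Variable R : realType.
Implicit Types (a b alpha bm bp x : R) (q : \bar R) (v f : R -> R).

(* The value at alpha itself is immaterial. *)
Definition pw alpha bm bp : R -> R := fun x => if x < alpha then bm else bp.

Definition jump v alpha : R := lim (v @ alpha^'+) - lim (v @ alpha^'-).

Definition beta_ratio bm bp : R := Num.max bp bm / Num.min bp bm.

(* For j < m the one-sided limits of v^(j) exist by the Sobolev embedding.
   For j = m the derivative is only an L^q function: the jump condition is then
   required only if it makes sense, i.e. if both one-sided limits exist. *)
Definition Wtilde a b alpha bm bp (m : nat) q v : Prop :=
  [/\ {within `[a, b], continuous v},
      sobolev `]a, alpha[ q m v /\ sobolev `]alpha, b[ q m v,
      v a = 0 /\ v b = 0 &
      forall j, (1 <= j <= m)%N ->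
        let w := fun x => pw alpha bm bp x * derive1n j v x in
        cvg (w x @[x --> alpha^'-]) -> cvg (w x @[x --> alpha^'+]) ->
        jump w alpha = 0].

Definition pw_seminorm a b alpha (m : nat) v : \bar R :=
  maxe (seminorm `]a, alpha[ +oo%E m v) (seminorm `]alpha, b[ +oo%E m v).

Definition interface_solution a b alpha bm bp f u : Prop :=
  let flux := fun x => pw alpha bm bp x * derive1 u x in
  [/\ forall x, a < x < alpha \/ alpha < x < b ->
        - derive1 flux x = f x,
      u a = 0 /\ u b = 0,
      jump u alpha = 0 &
      jump flux alpha = 0].

(* q is the value at x of the flux beta v', by continuous extension: the flux
   is continuous across the interface although beta and v' are not, and v' need
   not exist at alpha. *)
Definition has_flux alpha bm bp v x (q : R) : Prop :=
  (fun y => pw alpha bm bp y * derive1 v y) @ x^' --> q.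

End Interface.

Section Polynomials.
Variable R : realType.
Implicit Types (n p : nat) (xi c ah bm bp : R).

(* Rodrigues' formula. *)
Definition legendre n : {poly R} :=
  (2 ^+ n * n`!%:R)^-1 *: derivn n (('X^2 - 1) ^+ n).

Definition lobatto n xi : R :=
  match n with
  | 0 => (1 - xi) / 2
  | 1 => (1 + xi) / 2
  | n'.+1 => \int[@lebesgue_measure R]_(t in `[-1, xi]) (legendre n').[t]
  end.

Definition gen_weight ah bm bp : R -> R := fun t => (pw ah bm bp t)^-1.

Definition gen_legendre ah bm bp (L : nat -> {poly R}) : Prop :=
  (forall n, L n \is monic /\ size (L n) = n.+1) /\
  (forall m n, m != n ->
    \int[@lebesgue_measure R]_(t in `[-1, 1])
      (gen_weight ah bm bp t * (L m).[t] * (L n).[t]) = 0).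

(* Continuous, affine on both sides of ah, with no jump of beta phi' at ah.
   If ah is 1 or -1, one side is empty and the last condition is void. *)
Definition gen_affine ah bm bp (phi : R -> R) : Prop :=
  {within `[-1, 1], continuous phi} /\
  exists cm dm cp dp : R,
    [/\ forall xi, -1 < xi < ah -> phi xi = cm + dm * xi,
        forall xi, ah < xi < 1 -> phi xi = cp + dp * xi &
        bp * dp - bm * dm = 0].

Definition gen_lobatto ah bm bp (L : nat -> {poly R})
    (phi : nat -> R -> R) : Prop :=
  [/\ [/\ gen_affine ah bm bp (phi 0%N), phi 0%N (-1) = 1 & phi 0%N 1 = 0],
      [/\ gen_affine ah bm bp (phi 1%N), phi 1%N (-1) = 0 & phi 1%N 1 = 1] &
      forall n xi, (2 <= n)%N -> -1 <= xi <= 1 ->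
        phi n xi = \int[@lebesgue_measure R]_(t in `[-1, xi])
                     (gen_weight ah bm bp t * (L n.-1).[t])].

End Polynomials.

Section Discretization.
Variable R : realType.
Implicit Types (a b alpha bm bp : R) (N k i p : nat) (x : nat -> R).

(* Elements are numbered from 1 to N. *)
Definition is_mesh a b alpha N k x : Prop :=
  [/\ x 0%N = a, x N = b, forall i, (i < N)%N -> x i < x i.+1,
      (1 <= k <= N)%N & x k.-1 <= alpha <= x k].

Definition mesh_step x i : R := x i - x i.-1.

Definition mesh_size N x : R := \big[Num.max/0]_(1 <= i < N.+1) mesh_step x i.

Definition to_ref x i (y : R) : R := (2 * y - x i.-1 - x i) / mesh_step x i.

Definition ife_space a b N k x p (phi : nat -> R -> R) (v : R -> R) : Prop :=
  [/\ H10 a b v,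
      forall i, (1 <= i <= N)%N -> i != k ->
        exists2 r : {poly R}, (size r <= p.+1)%N &
          forall y, x i.-1 < y < x i -> v y = r.[y] &
      exists c : nat -> R, forall y, x k.-1 < y < x k ->
        v y = \sum_(0 <= n < p.+1) c n * phi n (to_ref x k y)].

Definition ife_solution a b alpha bm bp N k x p (phi : nat -> R -> R)
    (f uh : R -> R) : Prop :=
  ife_space a b N k x p phi uh /\
  forall vh, ife_space a b N k x p phi vh ->
    inner a b (fun y => pw alpha bm bp y * derive1 uh y) (derive1 vh) =
    inner a b f vh.

End Discretization.

(* Main.v *)
Require Import Defs.
From HB Require Import structures.
From mathcomp Require Import all_boot all_order all_algebra.
From mathcomp Require Import all_classical all_reals all_analysis.
From mathcomp Require Import measurable_realfun ess_sup_inf ring lra.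
Set Implicit Arguments.
Unset Strict Implicit.
Unset Printing Implicit Defensive.
Import Order.TTheory GRing.Theory Num.Theory.
Import numFieldNormedType.Exports.
Local Open Scope classical_set_scope.
Local Open Scope ring_scope.

(* By the jump conditions the flux beta u' is smooth across the interface, so
   beta (u - u_h)' is, on each element, a C^p function minus a polynomial of
   degree < p.  Let W P be the continuous primitive of P' / beta.  For Q of degree
   <= p, clamp W Q to one element, so that it is constant outside, and subtract
   the multiple of the global function W X that restores the boundary
   condition; the result is an admissible test function, and W X contributes
   nothing because u and u_h vanish at both ends.  Hence the flux error is
   orthogonal, element by element and for the weight 1 / beta, to all
   polynomials of degree < p.  The constants give exactness at the mesh points.
   Taylor's formula and the sup-norm stability of the weighted projection show
   that the flux error is t L_p + O(h^(p+1)), where L_p is the (generalized)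
   Legendre polynomial; so it is O(h^(p+1)) at the roots of L_p, and dividing by
   beta and integrating gives t phi_(p+1) + O(h^(p+2)) for u - u_h. *)

(** The seminorm is an infimum over weak derivatives, whereas the equation and the error bounds use
    the pointwise [derive1]. A du Bois-Reymond argument bridges the two: for each real [M] above the
    seminorm, the weak derivatives of [u] up to order [p + 1] on either side of [alpha] become
    classical, the last one Lipschitz with constant [M]. The estimates are proved for every such
    [M], which is then lowered to the seminorm. Once established, orthogonality is no longer an
    integral: it says that a primitive, passed through [wprim], takes equal values at the two ends
    of an element. Legendre, generalized Legendre and Galerkin orthogonality thus share one form,
    and a single estimate serves all elements. Its two coefficients are equal on noninterface
    elements, so the constant there depends on [p] alone. On the interface element one factor [rho]
    comes from comparing weighted and unweighted energies and, for [u - u_h], another from dividing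
    the flux error by [beta]. *)

Section Calculus.
Variable R : realType.
Implicit Types (F G P f g : R -> R) (a b c d m x y : R).
Local Notation mu := (@lebesgue_measure R).

(** * Calculus on intervals: derivatives, integrals, primitives *)

Lemma near_itvoo c d y (Q : R -> Prop) : c < y < d ->
  (forall z, c < z < d -> Q z) -> \forall z \near y, Q z.
Proof.
move=> cyd H; have : y \in `]c, d[ by rewrite in_itv.
by move=> /near_in_itvoo; apply: filterS => z; rewrite in_itv; exact: H.
Qed.

Lemma is_derive_itvoo c d y f g l : c < y < d ->
  (forall z, c < z < d -> f z = g z) -> is_derive y 1 g l -> is_derive y 1 f l.
Proof.
move=> cyd fg; apply: near_eq_is_derive.
by apply: (near_itvoo cyd) => z ?; rewrite fg.
Qed.

Lemma derive1_is_derive f y l : is_derive y 1 f l -> derive1 f y = l.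
Proof. by move=> h; rewrite derive1E derive_val. Qed.

Lemma is_derive_continuous f (y : R) l : is_derive y 1 f l -> {for y, continuous f}.
Proof. by move=> h; apply/differentiable_continuous/derivable1_diffP. Qed.

Lemma derivable_continuous f g : (forall y, is_derive y 1 f (g y)) -> continuous f.
Proof. by move=> h y; exact: is_derive_continuous (h y). Qed.

Lemma mean_value F G c d : c <= d -> continuous F ->
  (forall y, c < y < d -> is_derive y 1 F (G y)) ->
  exists2 z, c <= z <= d & F d - F c = G z * (d - c).
Proof.
move=> cd cF dF; have dF' y : y \in `]c, d[ -> is_derive y 1 F (G y).
  by rewrite in_itv; exact: dF.
have [z] := MVT_segment cd dF' (continuous_subspaceT cF).
by rewrite in_itv/= => cz e; exists z.
Qed.

(** Integrability is carried along because the value of [Rintegral] means nothing without it and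
    could not be added over adjacent intervals. The interval is open since [derive1] is uncontrolled
    at mesh points and at [alpha]. *)
Definition integral_on G c d (v : R) :=
  mu.-integrable `]c, d[ (EFin \o G) /\ \int[mu]_(t in `]c, d[) G t = v.

Lemma integrable_disjU (A B : set R) G :
  measurable A -> measurable B -> [disjoint A & B] ->
  mu.-integrable A (EFin \o G) -> mu.-integrable B (EFin \o G) ->
  mu.-integrable (A `|` B) (EFin \o G).
Proof.
move=> mA mB AB /integrableP[/measurable_EFinP mfA iA] /integrableP[/measurable_EFinP mfB iB].
have mU : measurable_fun (A `|` B) G by apply/measurable_funU.
have mE : measurable_fun (A `|` B) (EFin \o G) by exact/measurable_EFinP.
apply/integrableP; split => //.
rewrite ge0_integral_setU//; first exact: lte_add_pinfty.
exact: measurableT_comp.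
Qed.

Lemma integrable_itv_cc G (b0 b1 : bool) c d :
  mu.-integrable [set` Interval (BSide b0 c) (BSide b1 d)] (EFin \o G) ->
  mu.-integrable `[c, d] (EFin \o G).
Proof.
move=> ih; have ioo : mu.-integrable `]c, d[ (EFin \o G).
  by apply: integrableS ih => //; apply: subset_itv; rewrite bnd_simp; case: b0 b1 => -[].
have /integrableP[/measurable_EFinP mh fh] := ioo; apply/integrableP.
have mcc : measurable_fun `[c, d] G.
  by apply/measurable_fun_itv_bndo_bndcP/measurable_fun_itv_obnd_cbndP.
split; first exact/measurable_EFinP.
rewrite integral_itv_bndoo//; apply: measurableT_comp => //.
exact/measurable_EFinP.
Qed.

Lemma integral_on_empty G c v : v = 0 -> integral_on G c c v.
Proof.
by move=> ->; split; rewrite set_itvoo0 ?Rintegral_set0//; exact: integrable_set0.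
Qed.

Lemma integral_on_cat G c m d v w : c <= m <= d ->
  integral_on G c m v -> integral_on G m d w -> integral_on G c d (v + w).
Proof.
move=> /andP[]; rewrite le_eqVlt => /predU1P[->|cm].
  rewrite /integral_on set_itvoo0 Rintegral_set0 => _ [_ <-].
  by rewrite add0r.
rewrite le_eqVlt => /predU1P[->|md].
  rewrite /integral_on set_itvoo0 Rintegral_set0 => -[? ?] [_ <-].
  by rewrite addr0.
move=> [iG <-] [iG' <-].
have iG1 : mu.-integrable `]c, m] (EFin \o G).
  apply: integrableS (integrable_itv_cc iG) => //.
  by apply: subset_itvr; rewrite bnd_simp.
have ed : `]c, d[%classic = `]c, m] `|` `]m, d[ :> set R.
  by rewrite -itv_bndbnd_setU// bnd_simp; exact: ltW.
have dj : [disjoint `]c, m]%classic & `]m, d[%classic].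
  apply/disj_setPS => y [/=]; rewrite !in_itv/= => /andP[_ ym] /andP[].
  by rewrite ltNge ym.
have iGd : mu.-integrable `]c, d[ (EFin \o G).
  by rewrite ed; apply: integrable_disjU.
split=> //; rewrite ed Rintegral_setU//; last by rewrite -ed.
by rewrite -Rintegral_itv_bndo_bndc.
Qed.

Lemma integral_on_ext G G' c d v : (forall y, c < y < d -> G y = G' y) ->
  integral_on G' c d v -> integral_on G c d v.
Proof.
move=> e [iG <-]; split.
  apply: eq_integrable iG => //= y; rewrite inE/= in_itv/= => /e.
  by move=> ->.
by apply: eq_Rintegral => y; rewrite inE/= in_itv/= => /e.
Qed.

Lemma integral_on_deriv F G Gc c d : c <= d -> continuous F -> continuous Gc ->
  (forall y, c < y < d -> is_derive y 1 F (Gc y)) ->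
  (forall y, c < y < d -> G y = Gc y) ->
  integral_on G c d (F d - F c).
Proof.
rewrite le_eqVlt => /predU1P[->|cd] cF cG dF GE.
  by apply: integral_on_empty; rewrite subrr.
apply: integral_on_ext GE _.
have iG : mu.-integrable `[c, d] (EFin \o Gc).
  apply: continuous_compact_integrable; first exact: segment_compact.
  exact: continuous_subspaceT.
have iG' : mu.-integrable `]c, d[ (EFin \o Gc).
  by apply: integrableS iG => //; exact: subset_itv_oo_cc.
have iG'' : mu.-integrable `[c, d[ (EFin \o Gc).
  by apply: integrableS iG => //; apply: subset_itvl; rewrite bnd_simp.
split => //.
rewrite Rintegral_itv_obnd_cbnd// Rintegral_itv_bndo_bndc//.
rewrite /Rintegral (@continuous_FTC2 _ _ F)//.
- exact: continuous_subspaceT.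
- split.
  + by move=> y; rewrite in_itv/= => /dF h; exact: ex_derive.
  + exact/cvg_at_right_filter/cF.
  + exact/cvg_at_left_filter/cF.
- by move=> y; rewrite in_itv/= => /dF h; exact: derive1_is_derive.
Qed.

(** The breakpoint may coincide with an end, so the rule also covers elements without [alpha]
    inside, whose clamped breakpoint lies at an end. *)
Lemma integral_on_deriv2 F G G1 G2 c m d : c <= m <= d -> continuous F ->
  continuous G1 -> continuous G2 ->
  (forall y, c < y < m -> is_derive y 1 F (G1 y) /\ G y = G1 y) ->
  (forall y, m < y < d -> is_derive y 1 F (G2 y) /\ G y = G2 y) ->
  integral_on G c d (F d - F c).
Proof.
move=> cmd cF cG1 cG2 h1 h2; have /andP[cm md] := cmd.
rewrite -(subrKA (F m)) addrC.
apply: (integral_on_cat cmd).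
  by apply: (integral_on_deriv cm cF cG1) => y /h1[].
by apply: (integral_on_deriv md cF cG2) => y /h2[].
Qed.

Lemma integral_on_mesh (N : nat) (x : nat -> R) G (F : nat -> R) :
  (forall i, (i < N)%N -> x i < x i.+1) ->
  (forall i, (i < N)%N -> integral_on G (x i) (x i.+1) (F i.+1 - F i)) ->
  forall n, (n <= N)%N -> x 0%N <= x n /\ integral_on G (x 0%N) (x n) (F n - F 0%N).
Proof.
move=> xm h; elim=> [|n ih] nN.
  by split => //; apply: integral_on_empty; rewrite subrr.
have [x0n i0n] := ih (ltnW nN); have xn := ltW (xm _ nN).
split; first exact: le_trans xn.
rewrite -(subrKA (F n)) addrC.
by apply: (@integral_on_cat _ _ (x n)); rewrite ?x0n//; exact: h.
Qed.

(* The value at 0 is irrelevant; the two integrals make the primitive global. *)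
Definition primitive G x := \int[mu]_(t in `[0, x]) G t - \int[mu]_(t in `[x, 0]) G t.

Lemma Rintegral_cc_cat G x y z : x <= y <= z -> mu.-integrable `[x, z] (EFin \o G) ->
  \int[mu]_(t in `[x, z]) G t = \int[mu]_(t in `[x, y]) G t + \int[mu]_(t in `[y, z]) G t.
Proof.
move=> /andP[xy yz] iG.
have := @Rintegral_itvB R G (BLeft x) (BRight z) y iG.
rewrite !bnd_simp => /(_ xy yz) e; rewrite -[LHS](subrK (\int[mu]_(t in `[x, y]) G t)) e.
rewrite addrC; congr (_ + _); apply: Rintegral_itv_obnd_cbnd.
apply: integrableS iG => //; apply: (@subset_trans _ `[y, z]).
  by apply: subset_itvr; rewrite bnd_simp.
by apply: subset_itvr; rewrite bnd_simp.
Qed.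

Lemma Rintegral_cc_bound G B x y : x <= y -> mu.-integrable `[x, y] (EFin \o G) ->
  (forall t, x <= t <= y -> `|G t| <= B) ->
  `|\int[mu]_(t in `[x, y]) G t| <= B * (y - x).
Proof.
move=> xy iG GB; apply: (le_trans (le_normr_Rintegral _ iG)) => //.
have -> : B * (y - x) = \int[mu]_(t in `[x, y]) B.
  rewrite Rintegral_cst//= lebesgue_measure_itv/= lte_fin.
  move: xy; rewrite le_eqVlt => /predU1P[->|xy]; first by rewrite ltxx subrr.
  by rewrite xy -EFinB.
apply: le_Rintegral => //.
- by have := integrable_norm iG.
- apply: measurable_bounded_integrable => //.
    by rewrite /= lebesgue_measure_itv/=; case: ifPn => _; rewrite ?ltry.
  exact/bounded_cst.
Qed.

Lemma primitive_itv G : (forall c d, mu.-integrable `[c, d] (EFin \o G)) ->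
  forall x y, x <= y -> primitive G y - primitive G x = \int[mu]_(t in `[x, y]) G t.
Proof.
move=> iG.
have cut x y z : x <= y <= z ->
    \int[mu]_(t in `[x, z]) G t = \int[mu]_(t in `[x, y]) G t + \int[mu]_(t in `[y, z]) G t.
  by move=> xyz; exact: Rintegral_cc_cat.
have e0 x y : y <= x -> \int[mu]_(t in `[x, y]) G t = 0.
  rewrite le_eqVlt => /predU1P[->|yx]; first by rewrite set_itv1 Rintegral_set1.
  by rewrite set_itv_ge ?Rintegral_set0// bnd_simp -ltNge.
move=> x y xy; rewrite /primitive.
have [x0|x0] := leP 0 x.
  have y0 := le_trans x0 xy.
  by rewrite (e0 x 0)// (e0 y 0)// (cut 0 x y) ?x0//; ring.
have [y0|y0] := leP 0 y.
  by rewrite (e0 0 x) ?(ltW x0)// (e0 y 0)// (cut x 0 y) ?(ltW x0)//; ring.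
by rewrite (e0 0 x) ?(ltW x0)// (e0 0 y) ?(ltW y0)// (cut x y 0) ?xy ?(ltW y0)//; ring.
Qed.

Lemma primitive_is_derive G : continuous G ->
  forall y, is_derive y 1 (primitive G) (G y).
Proof.
move=> cG y.
have iG c d : mu.-integrable `[c, d] (EFin \o G).
  apply: continuous_compact_integrable; first exact: segment_compact.
  exact: continuous_subspaceT.
(* The fundamental theorem wants a fixed lower end to the left of [y]; near [y], the integral from
   [y - 1] differs from [primitive G] by a constant. *)
pose F x := primitive G (y - 1) + \int[mu]_(t in `[y - 1, x]) G t.
apply: (@is_derive_itvoo (y - 1) (y + 1) y _ F); first by lra.
  move=> z /andP[z1 z2]; by rewrite /F -(primitive_itv iG) ?(ltW z1)// addrC subrK.
have y1 : y < y + 1 by lra.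
have y2 : y - 1 < y by lra.
have [h1 h2] := continuous_FTC1_closed y1 (iG _ _) y2 (cG y).
have hF : is_derive y 1 (fun x => \int[mu]_(t in `[y - 1, x]) G t) (G y).
  by apply: (DeriveDef h1); rewrite -derive1E; exact: h2.
have := is_deriveD (is_derive_cst (primitive G (y - 1)) y 1) hF.
by rewrite add0r.
Qed.

Lemma primitive_lipschitz G (B : R) :
  (forall c d, mu.-integrable `[c, d] (EFin \o G)) ->
  (forall x, `|G x| <= B) ->
  forall x y, x <= y -> `|primitive G y - primitive G x| <= B * (y - x).
Proof.
move=> iG GB x y xy; rewrite primitive_itv//.
by apply: Rintegral_cc_bound => // t _; exact: GB.
Qed.

Lemma is_deriveP f y l :
  is_derive y 1 f l <-> h^-1 * (f (h + y) - f y) @[h --> 0^'] --> l.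
Proof.
have e : (fun h : R => h^-1 *: (f (h *: (1:R) + y) - f y)) = (fun h => h^-1 * (f (h + y) - f y)).
  by apply/funext => h; rewrite /GRing.scale/= mulr1.
split => [[d <-]|hl].
  by rewrite -e; exact: d.
have d : derivable f y 1 by rewrite /derivable e; apply: cvgP hl.
by apply: (DeriveDef d); rewrite /derive e; exact: cvg_lim hl.
Qed.

Lemma is_derive_glue f g y l : f y = g y ->
  is_derive y 1 f l -> is_derive y 1 g l ->
  is_derive y 1 (fun s => if s < y then f s else g s) l.
Proof.
move=> fgy /is_deriveP hf /is_deriveP hg; apply/is_deriveP.
rewrite ltxx.
apply/cvgrPdist_le => e e0.
have /cvgrPdist_le/(_ e e0) hf' := hf.
have /cvgrPdist_le/(_ e e0) hg' := hg.
near=> h; case: ifPn => _.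
  by rewrite -fgy; near: h.
by near: h.
Unshelve. all: by end_near. Qed.

End Calculus.

(** * Piecewise quadratic cutoff functions *)

Section Cutoff.
Variable R : realType.
Implicit Types (t x y e a b : R).

Definition pos_part t : R := Num.max 0 t.

Lemma continuous_pos_part : continuous pos_part.
Proof. by move=> t; apply: continuous_max; [exact: cvg_cst|exact: cvg_id]. Qed.

Lemma pos_partE t : pos_part t = if t < 0 then 0 else t.
Proof. by rewrite /pos_part; case: ltgtP. Qed.

Lemma is_derive_pos_part2 t : is_derive t 1 (fun s => pos_part s ^+ 2) (2 * pos_part t).
Proof.
have sq (s : R) : is_derive s (1 : R) (fun s : R => s ^+ 2) (2 * s).
  have := is_derive_poly ('X^2 : {poly R}) s.
  rewrite derivXn -mulr_natl !hornerE => h.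
  have -> : 2 * s = s + s by ring.
  move: h; congr (is_derive _ _ _ _); last by ring.
  by apply/funext => z; rewrite !hornerE.
have [t0|t0|->] := ltgtP t 0.
- have tI : t - 1 < t < 0 by lra.
  apply: (is_derive_itvoo tI (g := cst 0)) => [z /andP[_ z0]|].
    by rewrite pos_partE z0 expr0n.
  by rewrite pos_partE t0 mulr0; exact: is_derive_cst.
- have tI : 0 < t < t + 1 by lra.
  apply: (is_derive_itvoo tI (g := fun s => s ^+ 2)) => [z /andP[z0 _]|].
    by rewrite pos_partE ltNge (ltW z0).
  by rewrite pos_partE ltNge (ltW t0)/=.
- rewrite pos_partE ltxx mulr0.
  have -> : (fun s => pos_part s ^+ 2) = (fun s => if s < 0 then cst 0 s else s ^+ 2).
    by apply/funext => s; rewrite pos_partE; case: ifP; rewrite ?expr0n.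
  apply: is_derive_glue; first by rewrite expr0n.
  by rewrite -[X in is_derive _ _ _ X](mulr0 2).
Qed.

(** A second difference of the positive part: the hat function of height 1 supported on [-1, 1],
    hence of mass 1. *)
Definition tent t : R := pos_part (t + 1) - 2 * pos_part t + pos_part (t - 1).

(* The primitive of [tent] growing from 0 to 1 on [-1, 1]. *)
Definition ramp t : R :=
  2^-1 * (pos_part (t + 1) ^+ 2 - 2 * pos_part t ^+ 2 + pos_part (t - 1) ^+ 2).

Lemma continuous_tent : continuous tent.
Proof.
move=> t; apply: cvgD; first apply: cvgB.
- by apply: (@cvg_comp _ _ _ _ pos_part _ (nbhs (t + 1))); [apply: cvgD; [exact: cvg_id|exact: cvg_cst]|exact: continuous_pos_part].
- by apply: cvgM; [exact: cvg_cst|exact: continuous_pos_part].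
- by apply: (@cvg_comp _ _ _ _ pos_part _ (nbhs (t - 1))); [apply: cvgB; [exact: cvg_id|exact: cvg_cst]|exact: continuous_pos_part].
Qed.

Lemma is_derive_affine_comp (f g : R -> R) a b t :
  (forall s, is_derive s (1 : R) f (g s)) ->
  is_derive t (1 : R) (fun s : R => f (a * s + b)) (a * g (a * t + b)).
Proof.
move=> df.
have h : is_derive t (1 : R) (fun s : R => a * s + b) a.
  have := is_derive_poly (a *: 'X + b%:P) t.
  rewrite derivD derivZ derivX derivC !hornerE; congr (is_derive _ _ _ _).
  by apply/funext => z; rewrite !hornerE.
by have := @is_derive1_comp _ f _ t _ _ (df _) h; rewrite mulrC.
Qed.

Lemma is_derive_ramp t : is_derive t 1 ramp (tent t).
Proof.
have h b : is_derive t (1 : R) (fun s => pos_part (s + b) ^+ 2) (2 * pos_part (t + b)).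
  have := @is_derive_affine_comp _ _ 1 b t is_derive_pos_part2.
  rewrite !mul1r; apply: is_derive_itvoo (_ : t - 1 < t < t + 1) _; first by lra.
  by move=> z _; rewrite mul1r.
have -> : tent t = 2^-1 * (2 * pos_part (t + 1) - 2 * (2 * pos_part t) + 2 * pos_part (t - 1)).
  by rewrite /tent; field.
rewrite /ramp.
apply: (@is_deriveZ _ _ _ _ _ t).
apply: is_deriveD; apply: is_deriveB.
by apply: (@is_deriveZ _ _ _ _ _ t); exact: is_derive_pos_part2.
Qed.

Lemma tent_eq0 t : 1 <= `|t| -> tent t = 0.
Proof.
rewrite /tent !pos_partE ler_normr => /orP[h|h].
  by do 3 case: ltP => ?; lra.
by do 3 case: ltP => ?; lra.
Qed.

Lemma tent_bound t : 0 <= tent t <= 1.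
Proof. by rewrite /tent !pos_partE; do 3 case: ltP => ?; lra. Qed.

Lemma ramp_eq0 t : t <= -1 -> ramp t = 0.
Proof. by rewrite /ramp !pos_partE => h; do 3 case: ltP => ?; nra. Qed.

Lemma ramp_eq1 t : 1 <= t -> ramp t = 1.
Proof. by rewrite /ramp !pos_partE => h; do 3 case: ltP => ?; nra. Qed.

Lemma ramp_bound t : 0 <= ramp t <= 1.
Proof. by rewrite /ramp !pos_partE; do 3 case: ltP => ?; nra. Qed.

End Cutoff.

(** * Weak derivatives at Lebesgue points *)

Section DuBoisReymond.
Variable R : realType.
Implicit Types (a b c d m x y e p q t eta B : R) (v g G k : R -> R).
Local Notation mu := (@lebesgue_measure R).

Lemma integrable_mul_continuous c d v k : mu.-integrable `[c, d] (EFin \o v) ->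
  continuous k -> mu.-integrable `[c, d] (EFin \o (fun t => v t * k t)).
Proof.
move=> iv ck.
have mk : measurable_fun `[c, d] k.
  by apply: measurable_funTS; exact: continuous_measurable_fun.
have bk : [bounded k x | x in `[c, d]%classic].
  have [M [_ hM]] : bounded_set (k @` `[c, d]).
    apply: compact_bounded; apply: continuous_compact; last exact: segment_compact.
    exact: continuous_subspaceT.
  exists M; split; first exact: num_real.
  by move=> B MB t tcd; apply: (hM B MB); exists t.
by have := integrableMl _ iv mk bk; apply.
Qed.

Lemma integrable_locally_cc c d p q v : locally_integrable `]c, d[ v ->
  c < p -> q < d -> mu.-integrable `[p, q] (EFin \o v).
Proof.
move=> [mv _ iv] cp qd.
have sub : `[p, q] `<=` `]c, d[.
  by apply: subset_itv; rewrite bnd_simp.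
apply/integrableP; split.
  by apply/measurable_EFinP; apply: measurable_funS mv.
by apply: iv => //; exact: segment_compact.
Qed.

(** Off the support of [k] the product vanishes, so local integrability is enough even if [v] blows
    up at the ends of the interval. *)
Lemma integral_compact_support c d p q v k : locally_integrable `]c, d[ v ->
  c < p -> q < d -> continuous k -> (forall t, ~~ (p <= t <= q) -> k t = 0) ->
  mu.-integrable `]c, d[ (EFin \o (fun t => v t * k t)) /\
  \int[mu]_(t in `]c, d[) (v t * k t) = \int[mu]_(t in `[p, q]) (v t * k t).
Proof.
move=> lv cp qd ck k0.
have sub : `[p, q] `<=` `]c, d[.
  by apply: subset_itv; rewrite bnd_simp.
have ivk := integrable_mul_continuous (integrable_locally_cc lv cp qd) ck.
have e : (fun t => v t * k t) \_ `]c, d[ = (fun t => v t * k t) \_ `[p, q].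
  apply/funext => t; rewrite !patchE.
  have [tpq|tpq] := boolP (t \in `[p, q]%classic).
    by rewrite mem_set//; apply: sub; exact: set_mem.
  case: ifP => // _; rewrite k0 ?mulr0//.
  by apply: contra tpq => h; rewrite inE/= in_itv.
split; last by rewrite Rintegral_mkcond e -Rintegral_mkcond.
apply/integrable_mkcond => //.
by move: ivk => /integrable_mkcond; rewrite !restrict_EFin e; apply.
Qed.

Lemma continuous_affine_comp k a b : continuous k -> continuous (fun t => k (a * t + b)).
Proof.
move=> ck t; apply: (@cvg_comp _ _ _ _ k _ (nbhs (a * t + b))); last exact: ck.
by apply: cvgD; [apply: cvgM; [exact: cvg_cst|exact: cvg_id]|exact: cvg_cst].
Qed.

(* Lebesgue points are taken for compact restrictions, since v is only locally
   integrable on the open interval. *)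
Definition lebesgue_pt_in c d v x :=
  exists p q, [/\ c < p, p < x, x < q, q < d & lebesgue_pt (v \_ `[p, q]) x].

(** Countably many compact intervals exhaust the open one; Lebesgue differentiation applies to each
    restriction, and a countable union of null sets is null. *)
Lemma ae_lebesgue_pt_in c d v : locally_integrable `]c, d[ v ->
  \forall x \ae mu, c < x < d -> lebesgue_pt_in c d v x.
Proof.
move=> lv.
pose p n := c + n.+1%:R^-1; pose q n := d - n.+1%:R^-1.
have h n : \forall x \ae mu, lebesgue_pt (v \_ `[p n, q n]) x.
  apply: lebesgue_differentiation; apply: integrable_locally => //.
  by apply: (integrable_locally_cc lv); rewrite /p /q ?ltrDl ?gtrDl ?oppr_lt0 invr_gt0.
have := ae_foralln h; apply: filterS => x hx /andP[cx xd].
have e0 : 0 < Num.min (x - c) (d - x) by rewrite lt_min !subr_gt0 cx.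
have [n _ /(_ n (leqnn n)) hn] := near_infty_natSinv_lt (PosNum e0).
move: hn; rewrite /= lt_min => /andP[h1 h2].
exists (p n), (q n); rewrite /p /q; split => //; last exact: hx.
- by rewrite ltrDl invr_gt0.
- by rewrite addrC -ltrBrDr.
- by rewrite ltrBrDr addrC -ltrBrDr.
- by rewrite gtrDl oppr_lt0 invr_gt0.
Qed.

(** This turns identities at Lebesgue points into identities everywhere for a continuous
    function. *)
Lemma lebesgue_pt_in_continuous c d v x : measurable_fun `]c, d[ v ->
  {in `]c, d[, continuous v} -> c < x < d -> lebesgue_pt_in c d v x.
Proof.
move=> mv cv /andP[cx xd].
exists ((c + x) / 2), ((x + d) / 2); split; [lra|lra|lra|lra|].
set K := `[_, _]%classic.
apply: (@continuous_lebesgue_pt _ _ _ `](c + x) / 2, (x + d) / 2[%classic).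
- split; first exact: interval_open.
  by rewrite /= in_itv/=; lra.
- by [].
- apply/measurable_restrict => //.
    exact: measurable_itv.
  apply: measurable_funS mv => //.
  move=> t [+ _] /=; rewrite !in_itv/= => /andP[].
  rewrite !bnd_simp => h1 h2.
    lra.
- have xI : (c + x) / 2 < x < (x + d) / 2 by lra.
  rewrite /prop_for /continuous_at patchE mem_set; last by rewrite /K /= in_itv/=; lra.
  have vx : v y @[y --> x] --> v x by apply: cv; rewrite in_itv/= cx.
  apply: cvg_trans vx; apply: near_eq_cvg.
  apply: (near_itvoo xI) => z zI; rewrite patchE mem_set//.
  by rewrite /K /= in_itv/=; lra.
Qed.

(** Tents form an approximate identity of mass 1, support [[x - e, x + e]] and height [1 / e]. The
    deviation from [v x] is at most [1 / e] times the integral of [|v - v x|] over that ball of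
    length [2e], that is twice [davg]; hence the threshold [eta / 2]. *)
Lemma tent_average c d v x : locally_integrable `]c, d[ v ->
  lebesgue_pt_in c d v x -> forall eta : R, 0 < eta ->
  \forall e \near 0^'+, 
   `|\int[mu]_(t in `]c, d[) (v t * (e^-1 * tent (e^-1 * t + - (e^-1 * x)))) - v x| <= eta.
Proof.
move=> lv [p [q [cp px xq qd]]] lx eta eta0.
have eta20 : 0 < eta / 2 by rewrite divr_gt0.
have lx' : \forall e \near (0:R)^'+, (davg (v \_ `[p, q]) x e < (eta / 2)%:E)%E.
  move/fine_cvgP: lx => [lf /cvgrPdist_lt/(_ _ eta20) lt].
  near=> e; rewrite -(@fineK _ (davg _ _ _)); last by near: e.
  rewrite lte_fin; apply: le_lt_trans (ler_norm _) _.
  by rewrite -normrN -sub0r; near: e.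
near=> e.
have e0 : 0 < e by [].
have dav : (davg (v \_ `[p, q]) x e < (eta / 2)%:E)%E by near: e.
have pe : p < x - e by rewrite ltrBrDr addrC -ltrBrDr; near: e; apply: nbhs_right_lt; rewrite subr_gt0.
have qe : x + e < q by rewrite addrC -ltrBrDr; near: e; apply: nbhs_right_lt; rewrite subr_gt0.
pose k t := e^-1 * tent (e^-1 * t + - (e^-1 * x)).
have ck : continuous k.
  move=> t; apply: cvgM; first exact: cvg_cst.
  by apply: (@continuous_affine_comp (@tent R)); exact: continuous_tent.
have kE t : k t = e^-1 * tent ((t - x) / e) by rewrite /k; congr (_ * tent _); rewrite mulrC; ring.
have k0 t : ~~ (x - e <= t <= x + e) -> k t = 0.
  move=> h; rewrite kE tent_eq0 ?mulr0// normrM normfV (gtr0_norm e0) ler_pdivlMr// mul1r.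
  by rewrite ler_normr; move: h; rewrite negb_and -!ltNge => /orP[]; lra.
have kb t : 0 <= k t <= e^-1.
  rewrite kE; have /andP[h1 h2] := tent_bound ((t - x) / e).
  by rewrite mulr_ge0 ?invr_ge0 ?(ltW e0)//= ger_pMr ?invr_gt0.
have cx : c < x - e by lra.
have xd : x + e < d by lra.
have [_ ->] := integral_compact_support lv cx xd ck k0.
have iv := integrable_locally_cc lv cx xd.
have ivk := integrable_mul_continuous iv ck.
have i1 : mu.-integrable `[x - e, x + e] (EFin \o (fun=> v x)).
  apply: continuous_compact_integrable; first exact: segment_compact.
  exact/continuous_subspaceT/cst_continuous.
have ivxk := integrable_mul_continuous i1 ck.
have kint : \int[mu]_(t in `[x - e, x + e]) (v x * k t) = v x.
  have xee : x - e <= x + e by lra.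
  pose F t := v x * ramp (e^-1 * t + - (e^-1 * x)).
  have [_] : integral_on (fun t => v x * k t) (x - e) (x + e) (F (x + e) - F (x - e)).
  apply: (integral_on_deriv xee (Gc := fun t => v x * k t)).
  - apply: (@derivable_continuous R _ (fun t => v x * k t)) => t.
    by apply: (@is_deriveZ _ _ _ _ _ t); exact/is_derive_affine_comp/is_derive_ramp.
  - by move=> t; apply: cvgM; [exact: cvg_cst|exact: ck].
  - move=> t _; apply: (@is_deriveZ _ _ _ _ _ t).
    exact/is_derive_affine_comp/is_derive_ramp.
  - by [].
  have ivxk' : mu.-integrable `]x - e, x + e[ (EFin \o (fun t => v x * k t)).
    by apply: integrableS ivxk => //; exact: subset_itv_oo_cc.
  have ivxk'' : mu.-integrable `[x - e, x + e[ (EFin \o (fun t => v x * k t)).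
    by apply: integrableS ivxk => //; apply: subset_itvl; rewrite bnd_simp.
  rewrite Rintegral_itv_obnd_cbnd// Rintegral_itv_bndo_bndc// => ->.
  rewrite /F ramp_eq1; last by rewrite mulrDr addrAC subrr add0r mulVf ?gt_eqF.
  rewrite ramp_eq0; last by rewrite mulrBr addrAC subrr add0r mulVf ?gt_eqF.
  by rewrite mulr1 mulr0 subr0.
rewrite -[X in _ - X]kint -RintegralB//.
have iB : mu.-integrable `[x - e, x + e] (EFin \o (fun t => v t * k t - v x * k t)).
  by have := integrableB _ ivk ivxk; apply.
apply: (le_trans (le_normr_Rintegral _ iB)) => //.
have xK : x \in `[p, q]%classic by rewrite inE/= in_itv/= !ltW.
have iS : mu.-integrable `[x - e, x + e] (EFin \o (fun t => v t - v x)).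
  by have := integrableB _ iv i1; apply.
have iN : mu.-integrable `[x - e, x + e] (EFin \o (fun t => `|v t - v x|)).
  by have := integrable_norm iS; apply.
have iD : mu.-integrable `[x - e, x + e] (EFin \o (fun t => e^-1 * `|v t - v x|)).
  by have := integrableZl _ e^-1 iN; apply.
have : \int[mu]_(t in `[x - e, x + e]) `|v t * k t - v x * k t| <=
       \int[mu]_(t in `[x - e, x + e]) (e^-1 * `|v t - v x|).
  apply: le_Rintegral => //.
    by have := integrable_norm iB.
  move=> t _; rewrite -mulrBl normrM mulrC ler_wpM2r//.
  by have /andP[h1 h2] := kb t; rewrite ger0_norm.
move=> /le_trans; apply.
rewrite RintegralZl//.
rewrite ler_pdivrMl//.
pose J := `[x - e, x + e]%classic.
have : (\int[mu]_(t in J) (`|(v t - v x)%R|%R)%:E < (e * eta)%:E)%E.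
  move: dav; rewrite /davg /iavg lebesgue_measure_ball ?(ltW e0)//.
  rewrite inver mulrn_eq0/= gt_eqF// lte_pdivrMl ?mulrn_wgt0// -EFinM.
  have -> : e *+ 2 * (eta / 2) = e * eta by rewrite mulr2n; field.
  apply: le_lt_trans; rewrite /J (@integral_itv_bndoo _ _ _ _ true false).
    rewrite ball_itv le_eqVlt; apply/orP; left; apply/eqP; apply: eq_integral => t.
    rewrite inE/= in_itv/= => tI.
    by rewrite !patchE xK mem_set//= in_itv/=; lra.
  have := measurable_int mu iN; apply: measurable_funS => //.
  exact: subset_itv_oo_cc.
move=> h; rewrite /Rintegral -lee_fin fineK ?(ltW h)//.
by rewrite ge0_fin_numE ?(lt_trans h) ?ltry//; apply: integral_ge0 => t _; rewrite lee_fin.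
Unshelve. all: by end_near. Qed.

Lemma eq_of_norm_le (A B : R) : (forall eta : R, 0 < eta -> `|A - B| <= eta) -> A = B.
Proof.
move=> h; apply/eqP; rewrite -subr_eq0 -normr_le0; apply/ler_addgt0Pl => eta eta0.
by rewrite addr0; exact: h.
Qed.

(* Test with the primitive of the difference of two tents of width [e]
   centred at [x] and [y], then let [e] tend to 0. *)
Lemma weak_deriv_lebesgue_pt c d v g G B : weak_deriv `]c, d[ v g ->
  (\forall t \ae mu, c < t < d -> g t = G t) ->
  (forall p q, mu.-integrable `[p, q] (EFin \o G)) ->
  (forall t, c < t < d -> `|G t| <= B) ->
  forall x y, x < y -> c < x -> y < d -> lebesgue_pt_in c d v x -> lebesgue_pt_in c d v y ->
  v y - v x = \int[mu]_(t in `[x, y]) G t.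
Proof.
move=> [lv lg wd] gG iG GB x y xy cx yd lx ly.
have B0 : 0 <= B by apply: le_trans (GB x _); rewrite ?normr_ge0// cx (lt_trans xy).
apply: eq_of_norm_le => eta eta0.
have eta30 : 0 < eta / 3 by lra.
near (0:R)^'+ => e.
have e0 : 0 < e by [].
have ce : c < x - e.
  by rewrite ltrBrDr addrC -ltrBrDr; near: e; apply: nbhs_right_lt; rewrite subr_gt0.
have ed : y + e < d.
  by rewrite addrC -ltrBrDr; near: e; apply: nbhs_right_lt; rewrite subr_gt0.
have xye : e < (y - x) / 2.
  by near: e; apply: nbhs_right_lt; lra.
(* One third of [eta] is spent on each tent average. The last third pays for the strips around [x]
   and [y], of lengths [2e], [2e], [e] and [e], on which the integrands are bounded by [B]. *)
have Be : B * 6 * e <= eta / 3.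
  have /andP[] : (0 < B * 6 + 1) && (e < eta / 3 / (B * 6 + 1)).
    apply/andP; split; first by lra.
    by near: e; apply: nbhs_right_lt; apply: divr_gt0 => //; lra.
  move=> h1; rewrite ltr_pdivlMr// => h2; nra.
pose chi t := ramp (e^-1 * t + - (e^-1 * x)) - ramp (e^-1 * t + - (e^-1 * y)).
pose tx t := e^-1 * tent (e^-1 * t + - (e^-1 * x)).
pose ty t := e^-1 * tent (e^-1 * t + - (e^-1 * y)).
have dchi t : is_derive t (1:R) chi (tx t - ty t).
  by apply: is_deriveB; exact/is_derive_affine_comp/is_derive_ramp.
have argE z t : e^-1 * t + - (e^-1 * z) = (t - z) / e by rewrite mulrC; ring.
have chiE t : chi t = ramp ((t - x) / e) - ramp ((t - y) / e) by rewrite /chi !argE.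
have ctent z : continuous (fun t => e^-1 * tent (e^-1 * t + - (e^-1 * z))).
  move=> t; apply: cvgM; first exact: cvg_cst.
  by apply: (@continuous_affine_comp (@tent R)); exact: continuous_tent.
have tent0 z t : ~~ (z - e <= t <= z + e) -> e^-1 * tent (e^-1 * t + - (e^-1 * z)) = 0.
  move=> h; rewrite argE tent_eq0 ?mulr0// normrM normfV (gtr0_norm e0) ler_pdivlMr// mul1r.
  by rewrite ler_normr; move: h; rewrite negb_and -!ltNge => /orP[]; lra.
have dchiE : derive1 chi = (fun t => tx t - ty t).
  by apply/funext => t; exact: derive1_is_derive.
have chi0 t : ~~ (x - e <= t <= y + e) -> chi t = 0.
  rewrite chiE negb_and -!ltNge => /orP[h|h].
    by rewrite !ramp_eq0 ?subrr// ler_pdivrMr//; lra.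
  by rewrite !ramp_eq1 ?subrr// ler_pdivlMr//; lra.
have chi1 t : x + e <= t <= y - e -> chi t = 1.
  move=> /andP[h1 h2]; rewrite chiE ramp_eq1; last by rewrite ler_pdivlMr//; lra.
  by rewrite ramp_eq0 ?subr0// ler_pdivrMr//; lra.
have chib t : `|chi t| <= 1.
  rewrite chiE; have /andP[? ?] := ramp_bound ((t - x) / e).
  by have /andP[? ?] := ramp_bound ((t - y) / e); rewrite ler_norml; lra.
have cchi : continuous chi by exact: (derivable_continuous dchi).
have supp : closure [set t | chi t != 0] `<=` `[x - e, y + e].
  rewrite [X in _ `<=` X](closure_id _).1; last exact: interval_closed.
  apply: closureS => t /= ct; rewrite in_itv/=; apply: contraNT ct => h.
  by rewrite chi0.
have tst : test_fun `]c, d[ chi.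
  split.
  - by move=> t; exact: ex_derive.
  - by rewrite dchiE => t; apply: cvgB; exact: ctent.
  - apply: subclosed_compact supp; first exact: closed_closure.
    exact: segment_compact.
  - by apply: subset_trans supp _; apply: subset_itv; rewrite bnd_simp.
have xed : x + e < d by lra.
have cye : c < y - e by lra.
have [ix _] := integral_compact_support lv ce xed (ctent x) (tent0 x).
have [iy _] := integral_compact_support lv cye ed (ctent y) (tent0 y).
have := wd _ tst.
have -> : \int[mu]_(t in `]c, d[) (v t * derive1 chi t) =
    \int[mu]_(t in `]c, d[) (v t * tx t) - \int[mu]_(t in `]c, d[) (v t * ty t).
  by rewrite -RintegralB//; apply: eq_Rintegral => t _; rewrite dchiE mulrBr.
have [ig _] := integral_compact_support lg ce ed cchi chi0.
have lG : locally_integrable `]c, d[ G.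
  apply: open_integrable_locally; first exact: interval_open.
  by apply: integrableS (iG c d) => //; exact: subset_itv_oo_cc.
have [iGc eG] := integral_compact_support lG ce ed cchi chi0.
have -> : \int[mu]_(t in `]c, d[) (g t * chi t) = \int[mu]_(t in `]c, d[) (G t * chi t).
  rewrite /Rintegral; congr fine; apply: ae_eq_integral => //.
  - exact: measurable_int ig.
  - exact: measurable_int iGc.
  - apply: (@filterS _ _ (ae_filter_ringOfSetsType mu) _ _ _ gG) => t h.
    by rewrite /= in_itv/= => /h ->.
have iGchi p q := integrable_mul_continuous (iG p q) cchi.
(* Between [x + e] and [y - e] the function [chi] is 1, so the integral of [G] there is common to
   both sides and only the strips remain. *)
rewrite eG (@Rintegral_cc_cat R _ _ (x + e) (y + e))//; last by lra.
rewrite (@Rintegral_cc_cat R _ (x + e) (y - e) (y + e))//; last by lra.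
rewrite (@Rintegral_cc_cat R G x (x + e) y)//; last by lra.
rewrite (@Rintegral_cc_cat R G (x + e) (y - e) y)//; last by lra.
have -> : \int[mu]_(t in `[x + e, y - e]) (G t * chi t) = \int[mu]_(t in `[x + e, y - e]) G t.
  by apply: eq_Rintegral => t; rewrite inE/= in_itv/= => h; rewrite chi1 ?mulr1.
have GBc t : c < t < d -> `|G t * chi t| <= B.
  by move=> h; rewrite normrM -[leRHS]mulr1 ler_pM// GB.
have b1 : `|\int[mu]_(t in `[x - e, x + e]) (G t * chi t)| <= B * (x + e - (x - e)).
  by apply: Rintegral_cc_bound => // [|t /andP[? ?]]; [lra|apply: GBc; lra].
have b2 : `|\int[mu]_(t in `[y - e, y + e]) (G t * chi t)| <= B * (y + e - (y - e)).
  by apply: Rintegral_cc_bound => // [|t /andP[? ?]]; [lra|apply: GBc; lra].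
have b3 : `|\int[mu]_(t in `[x, x + e]) G t| <= B * (x + e - x).
  by apply: Rintegral_cc_bound => // [|t /andP[? ?]]; [lra|apply: GB; lra].
have b4 : `|\int[mu]_(t in `[y - e, y]) G t| <= B * (y - (y - e)).
  by apply: Rintegral_cc_bound => // [|t /andP[? ?]]; [lra|apply: GB; lra].
have hx : `|\int[mu]_(t in `]c, d[) (v t * (e^-1 * tent (e^-1 * t + - (e^-1 * x)))) - v x| <= eta / 3.
  by near: e; exact: tent_average.
have hy : `|\int[mu]_(t in `]c, d[) (v t * (e^-1 * tent (e^-1 * t + - (e^-1 * y)))) - v y| <= eta / 3.
  by near: e; exact: tent_average.
move: b1 b2 b3 b4 hx hy; rewrite -/(tx _) -/(ty _).
move: (\int[mu]_(t in `[x - e, x + e]) (G t * chi t)) => I1.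
move: (\int[mu]_(t in `[y - e, y + e]) (G t * chi t)) => I2.
move: (\int[mu]_(t in `[x, x + e]) G t) => I3.
move: (\int[mu]_(t in `[y - e, y]) G t) => I4.
move: (\int[mu]_(t in `[x + e, y - e]) G t) => I5.
move: (\int[mu]_(t in `]c, d[) (v t * tx t)) => X.
move: (\int[mu]_(t in `]c, d[) (v t * ty t)) => Y.
rewrite !ler_norml => /andP[? ?] /andP[? ?] /andP[? ?] /andP[? ?] /andP[? ?] /andP[? ?] ?.
lra.
Unshelve. all: by end_near. Qed.

End DuBoisReymond.

(** * Classical regularity of the flux *)

Section Regularity.
Variable R : realType.
Implicit Types (a b c d x y t B M alpha bm bp : R) (u f v g G : R -> R).
Local Notation mu := (@lebesgue_measure R).

Lemma weak_deriv_primitive c d v g G B : weak_deriv `]c, d[ v g ->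
  (\forall t \ae mu, c < t < d -> g t = G t) ->
  (forall p q, mu.-integrable `[p, q] (EFin \o G)) ->
  (forall t, c < t < d -> `|G t| <= B) ->
  exists C, forall x, c < x < d -> lebesgue_pt_in c d v x -> v x = C + primitive G x.
Proof.
move=> wd gG iG GB.
have H := weak_deriv_lebesgue_pt wd gG iG GB.
have [[x0 [/andP[cx0 x0d] l0]]|no] := pselect (exists x0, c < x0 < d /\ lebesgue_pt_in c d v x0).
  exists (v x0 - primitive G x0) => x /andP[cx xd] lx.
  have [xx0|x0x|->] := ltgtP x x0; last by rewrite subrK.
    have := H _ _ xx0 cx x0d lx l0; rewrite -(primitive_itv iG (ltW xx0)).
    by move: (primitive G x) (primitive G x0) => P Q ?; lra.
  have := H _ _ x0x cx0 xd l0 lx; rewrite -(primitive_itv iG (ltW x0x)).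
  by move: (primitive G x) (primitive G x0) => P Q ?; lra.
by exists 0 => x cxd lx; exfalso; apply: no; exists x.
Qed.

Lemma lipschitz_continuous (F : R -> R) M :
  (forall x y, x <= y -> `|F y - F x| <= M * (y - x)) -> continuous F.
Proof.
move=> H x; apply/cvgrPdist_le => e e0.
have M0 : 0 <= M.
  have := H 0 1 ler01; rewrite subr0 mulr1; exact: le_trans.
near=> y.
have hy : `|x - y| <= e / (M + 1).
  near: y; apply: cvgr_dist_le; first exact: cvg_id.
  by rewrite divr_gt0// ltr_wpDl.
have hM : M * `|x - y| <= e.
  apply: (@le_trans _ _ ((M + 1) * (e / (M + 1)))).
    by apply: ler_pM => //; rewrite lerDl.
  by rewrite mulrCA divff ?mulr1// gt_eqF// ltr_wpDl.
have [xy|yx] := leP x y.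
  rewrite distrC; apply: le_trans (H _ _ xy) _.
  by rewrite distrC ger0_norm ?subr_ge0 in hM.
apply: le_trans (H _ _ (ltW yx)) _.
by rewrite ger0_norm ?subr_ge0 ?(ltW yx) in hM.
Unshelve. all: by end_near. Qed.

Lemma continuous_bounded_cc (F : R -> R) c d : continuous F ->
  exists B, forall t, c <= t <= d -> `|F t| <= B.
Proof.
move=> cF; have [M [_ hM]] : bounded_set (F @` `[c, d]).
  apply: compact_bounded; apply: continuous_compact; last exact: segment_compact.
  exact: continuous_subspaceT.
exists (M + 1) => t tcd; apply: (hM (M + 1)); first by rewrite ltrDl.
by exists t => //; rewrite /= in_itv.
Qed.

(* The truncation G of the last weak derivative is bounded everywhere, which
   yields an exact Lipschitz constant. *)
Lemma weak_derivn_regular c d M n v g : 0 <= M ->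
  weak_derivn `]c, d[ n.+1 v g ->
  (\forall t \ae mu, c < t < d -> `|g t| <= M) ->
  exists U : nat -> R -> R,
    [/\ forall j, (j < n)%N -> forall x, is_derive x (1:R) (U j) (U j.+1 x),
        forall x y, x <= y -> `|U n y - U n x| <= M * (y - x) &
        forall x, c < x < d -> lebesgue_pt_in c d v x -> v x = U 0%N x].
Proof.
move=> M0; elim: n v => [|n ih] v [v' wd h] gM.
  move: h => /= ge; rewrite {}ge in gM.
  pose G t := Num.max (- M) (Num.min M ((v' \_ `]c, d[) t)).
  have MM : - M <= M by lra.
  have GM t : `|G t| <= M.
    by rewrite ler_norml /G le_max lexx/= ge_max MM ge_min lexx.
  have mG : measurable_fun setT G.
    apply: measurable_maxr => //; apply: measurable_minr => //.
    by case: wd => _ [mv' _ _] _; exact/(measurable_restrictT _ _).1.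
  have iG p q : mu.-integrable `[p, q] (EFin \o G).
    apply: measurable_bounded_integrable => //.
    - by rewrite /= lebesgue_measure_itv/=; case: ifPn => _; rewrite ?ltry.
    - exact: measurable_funTS.
    - exists M; split; first exact: num_real.
      by move=> B MB t _; apply: le_trans (GM t) _; exact: ltW.
  have vG : \forall t \ae mu, c < t < d -> v' t = G t.
    apply: (@filterS _ _ (ae_filter_ringOfSetsType mu) _ _ _ gM) => t h cd.
    have := h cd; rewrite ler_norml => /andP[h1 h2].
    rewrite /G patchE mem_set/=; last by rewrite in_itv.
    by rewrite min_r// max_r.
  have [C hC] := weak_deriv_primitive wd vG iG (fun t _ => GM t).
  exists (fun _ x => C + primitive G x); split => // x y xy.
  have := primitive_lipschitz iG GM xy.
  by congr (`|_| <= _); move: (primitive G x) (primitive G y) => P Q; ring.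
have [U [dU lU vU]] := ih v' h gM.
have cU : continuous (U 0%N).
  case: n dU lU {ih h} => [|n] dU lU; first exact: (lipschitz_continuous lU).
  by apply: (@derivable_continuous R _ (U 1%N)); exact: dU.
have [B hB] := continuous_bounded_cc c d cU.
have iG p q : mu.-integrable `[p, q] (EFin \o U 0%N).
  apply: continuous_compact_integrable; first exact: segment_compact.
  exact: continuous_subspaceT.
(* The induction hypothesis describes [v'] only at its Lebesgue points, that is almost everywhere,
   which is all that [weak_deriv_primitive] asks for. *)
have vG : \forall t \ae mu, c < t < d -> v' t = U 0%N t.
  case: wd => _ lv' _.
  apply: (@filterS _ _ (ae_filter_ringOfSetsType mu) _ _ _ (ae_lebesgue_pt_in lv')) => t h' cd.
  by apply: vU => //; exact: h'.
have hB' t : c < t < d -> `|U 0%N t| <= B by move=> /andP[h1 h2]; apply: hB; rewrite !ltW.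
have [C hC] := weak_deriv_primitive wd vG iG hB'.
(* Prepending a primitive shifts the indices by one; the Lipschitz function stays the last. *)
exists (fun j => if j is j'.+1 then U j' else fun x => C + primitive (U 0%N) x).
split => // -[_ x|j jn x]; last exact: dU.
have := is_deriveD (is_derive_cst C x 1) (primitive_is_derive cU x).
by rewrite add0r.
Qed.

(** [Lnorm] with exponent [+oo] unfolds to the essential supremum only on a space of positive
    measure. *)
Lemma lebesgue_measureT_gt0 : (0 < mu setT)%E.
Proof.
apply: (@lt_le_trans _ _ (mu `]0, 1[)).
  by rewrite /= lebesgue_measure_itv/= lte_fin ltr01 oppr0 adde0 lte_fin.
by apply: le_measure; rewrite ?inE.
Qed.

Lemma LnormOn_lt_ae c d g M : (LnormOn `]c, d[ +oo g < M%:E)%E ->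
  \forall t \ae mu, c < t < d -> `|g t| <= M.
Proof.
rewrite /LnormOn unlock lebesgue_measureT_gt0 => /ltW /ess_supP h.
apply: (@filterS _ _ (ae_filter_ringOfSetsType mu) _ _ _ h) => t + cd.
by rewrite /= patchE mem_set ?lee_fin//= in_itv.
Qed.

Lemma sobolev_weak_derivn (I : set R) q m v : sobolev I q m v ->
  exists2 g, weak_derivn I m v g & (LnormOn I q g < +oo)%E.
Proof.
elim: m v => [|m ih] v [[mv nv]]; first by exists v.
by move=> [v' wd /ih[g hg ng]]; exists g => //; exists v'.
Qed.

Lemma sobolev_seminorm_lty (I : set R) q m v : sobolev I q m v -> (seminorm I q m v < +oo)%E.
Proof.
move=> /sobolev_weak_derivn[g hg ng]; apply: le_lt_trans ng.
by apply: ereal_inf_lbound; exists g.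
Qed.

(** The strict bound extracts from the infimum an actual weak derivative of norm below [M];
    continuity makes every point of the interval a Lebesgue point. *)
Lemma sobolev_regular c d M n v : {in `]c, d[, continuous v} ->
  (seminorm `]c, d[ +oo n.+1 v < M%:E)%E ->
  exists U : nat -> R -> R,
    [/\ forall j, (j < n)%N -> forall x, is_derive x (1:R) (U j) (U j.+1 x),
        forall x y, x <= y -> `|U n y - U n x| <= M * (y - x) &
        forall x, c < x < d -> v x = U 0%N x].
Proof.
move=> cv /ereal_inf_lt[_ [g hg <-] gM].
have M0 : 0 <= M.
  by rewrite -lee_fin (le_trans _ (ltW gM))//; exact: Lnorm_ge0.
have [U [h1 h2 h3]] := weak_derivn_regular M0 hg (LnormOn_lt_ae gM).
exists U; split => // x cxd; apply: h3 => //.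
by case: hg => v' [[mv _ _] _ _] _; exact: lebesgue_pt_in_continuous.
Qed.

Lemma derive1n_itvoo c d n v (U : nat -> R -> R) :
  (forall j, (j < n)%N -> forall x, is_derive x (1:R) (U j) (U j.+1 x)) ->
  (forall x, c < x < d -> v x = U 0%N x) ->
  forall j, (j <= n)%N -> forall x, c < x < d -> derive1n j v x = U j x.
Proof.
move=> dU vU; elim=> [_|j ih jn] x xcd; first exact: vU.
rewrite derive1nS; apply: derive1_is_derive.
by apply: (is_derive_itvoo xcd (ih (ltnW jn))); exact: dU.
Qed.

(** [S j] is the [j]-th derivative of the flux. The jump conditions of orders 1 to [p + 1] make both
    sides match up to [S p], which is merely Lipschitz. The two one-sided constants are kept apart
    because, on a noninterface element, the coefficient cancels when the flux error is divided by
    [beta]. *)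
Lemma flux_regular a b alpha bm bp p f u M : (0 < p)%N ->
  a < alpha < b -> 0 < bm -> 0 < bp ->
  Wtilde a b alpha bm bp (p + 2) +oo%E u ->
  interface_solution a b alpha bm bp f u ->
  (pw_seminorm a b alpha (p + 2) u < M%:E)%E ->
  exists S : nat -> R -> R,
    [/\ forall j, (j < p)%N -> forall x, is_derive x (1:R) (S j) (S j.+1 x),
        forall x y, x <= y <= alpha -> `|S p y - S p x| <= bm * M * (y - x),
        forall x y, alpha <= x <= y -> `|S p y - S p x| <= bp * M * (y - x),
        forall x, a < x < b -> x != alpha -> is_derive x (1:R) u (S 0%N x / pw alpha bm bp x) &
        forall x, a < x < b -> x != alpha -> f x = - S 1%N x].
Proof.
move=> p0 /andP[aal alb] bm0 bp0 [cu _ _ hj] [hf _ _ _]; rewrite addn2 /pw_seminorm gt_max in hj *.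
move=> /andP[sm sp].
have cin c d : a <= c -> d <= b -> {in `]c, d[, continuous u}.
  move=> ac db x; rewrite in_itv/= => /andP[cx xd].
  have xab : x \in `]a, b[ by rewrite in_itv/= (le_lt_trans ac)// (lt_le_trans xd).
  apply: (within_continuous_continuous (lt_trans aal alb) cu xab).
have [V [dV lV uV]] := sobolev_regular (cin a alpha (lexx _) (ltW alb)) sm.
have [W [dW lW uW]] := sobolev_regular (cin alpha b (ltW aal) (lexx _)) sp.
have cV j : (j <= p.+1)%N -> continuous (V j).
  rewrite leq_eqVlt => /predU1P[->|jp]; first exact: (lipschitz_continuous lV).
  by apply: (@derivable_continuous R _ (V j.+1)); exact: dV.
have cW j : (j <= p.+1)%N -> continuous (W j).
  rewrite leq_eqVlt => /predU1P[->|jp]; first exact: (lipschitz_continuous lW).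
  by apply: (@derivable_continuous R _ (W j.+1)); exact: dW.
have nV := derive1n_itvoo dV uV.
have nW := derive1n_itvoo dW uW.
(* The jump condition presupposes that one-sided limits exist; the continuous extensions [V] and [W]
   supply them up to order [p + 1]. *)
have match_ j : (j <= p)%N -> bm * V j.+1 alpha = bp * W j.+1 alpha.
  move=> jp; have jp2 : (1 <= j.+1 <= p.+2)%N by rewrite /= ltnW.
  move: (hj _ jp2); set w := fun x => _.
  have wl : w x @[x --> alpha^'-] --> bm * V j.+1 alpha.
    have h : bm * V j.+1 x @[x --> alpha^'-] --> bm * V j.+1 alpha.
      by apply: cvgM; [exact: cvg_cst|exact/cvg_at_left_filter/cV].
    apply: cvg_trans h; apply: near_eq_cvg; near=> x.
    have xal : x < alpha by [].
    have ax : a < x by near: x; exact: nbhs_left_gt.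
    by rewrite /w /pw xal nV ?ax.
  have wr : w x @[x --> alpha^'+] --> bp * W j.+1 alpha.
    have h : bp * W j.+1 x @[x --> alpha^'+] --> bp * W j.+1 alpha.
      by apply: cvgM; [exact: cvg_cst|exact/cvg_at_right_filter/cW].
    apply: cvg_trans h; apply: near_eq_cvg; near=> x.
    have xal : alpha < x by [].
    have xb : x < b by near: x; exact: nbhs_right_lt.
    by rewrite /w /pw nW ?xal// ltNge (ltW xal).
  move=> /(_ (cvgP _ wl) (cvgP _ wr)); rewrite /jump.
  by rewrite (cvg_lim _ wl)// (cvg_lim _ wr)// => /subr0_eq.
pose S j x := if x < alpha then bm * V j.+1 x else bp * W j.+1 x.
have dS j : (j < p)%N -> forall x, is_derive x (1:R) (S j) (S j.+1 x).
  move=> jp x.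
  have hV : is_derive x (1:R) (fun x => bm * V j.+1 x) (bm * V j.+2 x).
    by apply: (@is_deriveZ _ _ _ _ _ x); exact: dV.
  have hW : is_derive x (1:R) (fun x => bp * W j.+1 x) (bp * W j.+2 x).
    by apply: (@is_deriveZ _ _ _ _ _ x); exact: dW.
  have [xal|alx|xal] := ltgtP x alpha.
  - have xI : x - 1 < x < alpha by lra.
    rewrite /S xal; apply: (is_derive_itvoo xI) hV => z /andP[_ zal].
    by rewrite zal.
  - have xI : alpha < x < x + 1 by lra.
    rewrite /S ltNge (ltW alx)/=; apply: (is_derive_itvoo xI) hW => z /andP[zal _].
    by rewrite ltNge (ltW zal).
  - rewrite {2}/S xal ltxx; apply: is_derive_glue.
    + exact/match_/ltnW.
    + by rewrite -match_// -xal.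
    + by rewrite -xal.
have ur x : a < x < b -> x != alpha -> is_derive x (1:R) u (S 0%N x / pw alpha bm bp x).
  move=> /andP[ax xb]; rewrite /S /pw; case: ltgtP => // [xal|alx] _.
    have xI : a < x < alpha by rewrite ax.
    by rewrite mulrC mulKf ?gt_eqF//; apply: (is_derive_itvoo xI uV); exact: dV.
  have xI : alpha < x < b by rewrite alx.
  by rewrite mulrC mulKf ?gt_eqF//; apply: (is_derive_itvoo xI uW); exact: dW.
exists S; split => //.
- move=> x y /andP[xy]; have SE z : z <= alpha -> S p z = bm * V p.+1 z.
    by rewrite le_eqVlt /S => /predU1P[->|->//]; rewrite ltxx match_.
  move=> yal; rewrite !SE ?(le_trans xy)// -mulrBr normrM gtr0_norm// -mulrA ler_pM2l//.
  exact: lV.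
- move=> x y /andP[alx xy]; rewrite /S !ltNge alx (le_trans alx xy)/=.
  by rewrite -mulrBr normrM gtr0_norm// -mulrA ler_pM2l//; exact: lW.
- move=> x /andP[ax xb] xal.
  have xx : a < x < alpha \/ alpha < x < b.
    have [h|h|h] := ltgtP x alpha; [by left; rewrite ax ?h|by right; rewrite ?h xb|].
    by rewrite h eqxx in xal.
  rewrite -(hf _ xx); congr (- _); apply: derive1_is_derive.
  have key c d : a <= c -> d <= b -> (forall z, c < z < d -> z != alpha) -> c < x < d ->
      is_derive x (1:R) (fun x => pw alpha bm bp x * derive1 u x) (S 1%N x).
    move=> ac db nal xcd; apply: (is_derive_itvoo xcd) (dS 0%N p0 x) => z zcd.
    have /andP[cz zd] := zcd.
    have zab : a < z < b by rewrite (le_lt_trans ac)// (lt_le_trans zd).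
    rewrite (derive1_is_derive (ur z zab (nal z zcd))) mulrCA divff ?mulr1//.
    by rewrite /pw; case: ifP; rewrite gt_eqF.
  case: xx => xx.
    apply: (key a alpha) => //; first exact: ltW.
    by move=> z /andP[_ h]; rewrite lt_eqF.
  apply: (key alpha b) => //; first exact: ltW.
  by move=> z /andP[h _]; rewrite gt_eqF.
Unshelve. all: by end_near. Qed.

End Regularity.

(** * Legendre polynomials, sup-norm bounds, Taylor approximation *)

Section Polynomials.
Variable R : realType.
Implicit Types (p q s P Q : {poly R}) (a b c d m x y t : R) (n : nat).

Lemma horner_is_derive p x : is_derive x (1:R) (horner p) (p^`()).[x].
Proof. exact: is_derive_poly. Qed.

Lemma continuous_horner_fun p : continuous (horner p).
Proof. by apply: (@derivable_continuous R _ (horner p^`())) => x; exact: horner_is_derive. Qed.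

Lemma poly_primitive s : exists2 Q, Q^`() = s & (size Q <= (size s).+1)%N.
Proof.
exists (\poly_(i < (size s).+1) (if i is j.+1 then s`_j / j.+1%:R else 0)); last exact: size_poly.
apply/polyP => i; rewrite coef_deriv coef_poly ltnS.
case: ltnP => [ltis|si]; last by rewrite mul0rn nth_default.
by rewrite -[LHS]mulr_natr divfK// pnatr_eq0.
Qed.

Lemma deriv_eq0_horner P : P^`() = 0 -> forall x y, P.[x] = P.[y].
Proof.
move=> dP x y; suff -> : P = (P`_0)%:P by rewrite !hornerC.
apply/polyP => -[|i]; rewrite coefC//=.
have /(congr1 (fun q : {poly R} => q`_i)) := dP; rewrite coef_deriv coef0.
by move=> /eqP; rewrite mulrn_eq0/= => /eqP.
Qed.

Lemma derivn_XsubC_exp c n V j : (j <= n)%N ->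
  exists V', derivn j (('X - c%:P) ^+ n * V) = ('X - c%:P) ^+ (n - j) * V'.
Proof.
elim: j n V => [|j ih] n V; first by rewrite subn0; exists V.
case: n => // n jn.
have e : (('X - c%:P) ^+ n.+1 * V)^`() = ('X - c%:P) ^+ n * (V *+ n.+1 + ('X - c%:P) * V^`()).
  rewrite derivM deriv_exp/= derivB derivX derivC subr0 mul1r mulrDr exprS; ring.
have [V' hV'] := ih n (V *+ n.+1 + ('X - c%:P) * V^`()) jn.
by exists V'; rewrite subSS -hV' -e derivSn.
Qed.

Lemma root_derivn_XsubC_exp c n V j : (j < n)%N ->
  (derivn j (('X - c%:P) ^+ n * V)).[c] = 0.
Proof.
move=> jn; have [V' ->] := derivn_XsubC_exp c V (ltnW jn).
by rewrite hornerM horner_exp !hornerE subrr expr0n subn_eq0 leqNgt jn/= mul0r.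
Qed.

(** Repeated integration by parts without integrals: if [P] is a primitive of [W^(n+1) s], then
    [W^(n) s - P] is one of [W^(n) s']. The boundary terms vanish, and after [n] steps [s] has been
    differentiated to 0. *)
Lemma derivn_orthogonal W n x y :
  (forall j, (j < n)%N -> (derivn j W).[x] = 0 /\ (derivn j W).[y] = 0) ->
  forall s P, (size s <= n)%N -> P^`() = derivn n W * s -> P.[x] = P.[y].
Proof.
elim: n => [|n ih] h s P sn dP.
  apply: deriv_eq0_horner; rewrite dP.
  by move: sn; rewrite leqn0 size_poly_eq0 => /eqP ->; rewrite mulr0.
have hs : (size s^`() <= n)%N.
  have [->|s0] := eqVneq s 0; first by rewrite linear0 size_poly0.
  by rewrite -ltnS (leq_trans (lt_size_deriv s0)).
have := ih _ s^`() (derivn n W * s - P) hs _.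
rewrite derivB derivM dP -derivnS addrAC subrr add0r => /(_ _ erefl).
have [h1 h2] := h n (ltnSn n).
rewrite !hornerE h1 h2 !mul0r !add0r => /(_ _)/oppr_inj; apply => j jn.
by apply: h; rewrite ltnW.
Qed.

Lemma X2sub1E : 'X^2 - 1 = ('X - 1%:P) * ('X - (- 1)%:P) :> {poly R}.
Proof. by rewrite polyCN opprK; ring. Qed.

(** By Rodrigues' formula, since 1 and -1 are zeros of order [n] of [(X^2 - 1)^n]. Equal end values
    of a primitive express orthogonality to [s]. *)
Lemma legendre_orthogonal n s P : (size s <= n)%N ->
  P^`() = legendre R n * s -> P.[1] = P.[-1].
Proof.
rewrite /legendre -scalerAl; set k := (2 ^+ n * n`!%:R)^-1 => sn dP.
have k0 : k != 0.
  by rewrite invr_eq0 mulf_neq0// ?expf_neq0 ?pnatr_eq0// -lt0n fact_gt0.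
have : (k^-1 *: P).[1] = (k^-1 *: P).[-1].
  apply: (@derivn_orthogonal (('X^2 - 1) ^+ n) n _ _ _ s) => //.
    move=> j jn; rewrite X2sub1E exprMn; split; first exact: root_derivn_XsubC_exp.
    by rewrite mulrC; exact: root_derivn_XsubC_exp.
  by rewrite derivZ dP scalerA mulVf// scale1r.
by rewrite !hornerE => /(mulfI _); apply; rewrite invr_eq0.
Qed.

Lemma size_legendre n : size (legendre R n) = n.+1.
Proof.
rewrite /legendre size_scale; last first.
  by rewrite invr_eq0 mulf_neq0// ?expf_neq0 ?pnatr_eq0// -lt0n fact_gt0.
have s2 : size ('X^2 - 1 : {poly R}) = 3%N.
  by rewrite -polyC1 size_XnsubC.
have sW : size (('X^2 - 1 : {poly R}) ^+ n) = (n + n).+1.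
  have n0 : ('X^2 - 1 : {poly R}) ^+ n != 0 by rewrite expf_neq0// -size_poly_eq0 s2.
  have := size_exp ('X^2 - 1 : {poly R}) n; rewrite s2/= mul2n -addnn => <-.
  by rewrite prednK// lt0n size_poly_eq0.
apply/eqP; rewrite eqn_leq; apply/andP; split.
  apply/leq_sizeP => i ni; rewrite coef_derivn nth_default ?mul0rn//.
  by rewrite sW -addnS leq_add2l.
rewrite ltnNge; apply/negP => /leq_sizeP/(_ n (leqnn n))/eqP.
rewrite coef_derivn mulrn_eq0 eqn0Ngt ffact_gt0 leq_addr/=.
have : lead_coef (('X^2 - 1 : {poly R}) ^+ n) != 0.
  by rewrite lead_coef_eq0 expf_neq0// -size_poly_eq0 s2.
by rewrite lead_coefE sW/= => /negPf ->.
Qed.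

Lemma monic_basis (L : nat -> {poly R}) :
  (forall n, L n \is monic /\ size (L n) = n.+1) ->
  forall n s, (size s <= n)%N -> exists e : nat -> R, s = \sum_(i < n) e i *: L i.
Proof.
move=> hL; elim=> [|n ih] s sn.
  exists (fun=> 0); rewrite big_ord0.
  by apply/eqP; rewrite -size_poly_eq0 -leqn0.
have [mL sL] := hL n.
have : (size (s - s`_n *: L n)%R <= n)%N.
  apply/leq_sizeP => j; rewrite leq_eqVlt => /predU1P[<-|nj].
    have Ln : (L n)`_n = 1 by have /monicP := mL; rewrite lead_coefE sL.
    by rewrite coefB coefZ Ln mulr1 subrr.
  rewrite coefB coefZ [s`_j]nth_default ?(leq_trans sn nj)//.
  by rewrite [(L n)`_j]nth_default ?sL// mulr0 subr0.
move=> /ih[e he]; exists (fun i => if i == n then s`_n else e i).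
rewrite big_ord_recr/= eqxx -[LHS](subrK (s`_n *: L n)) he; congr (_ + _).
by apply: eq_bigr => i _; rewrite ltn_eqF.
Qed.

(** Bounds the sum of [n] Lagrange basis polynomials, each a product of fewer than [n] ratios of
    distances: nodes at least [(d - c) / 2n] apart in an interval of length [d - c] keep every ratio
    below or at [2n]. *)
Definition lagrange_const n : R := n%:R * (2 * n%:R) ^+ n.

(* Interpolate at n points t_i picked by the mean value theorem for P in
   every second interval of length (d - c) / 2n: there P' = q^2 is controlled
   by P d - P c, and the t_i are separated. *)
Lemma poly_sup_bound n q P c d : (size q <= n)%N -> c < d -> P^`() = q ^+ 2 ->
  forall y, c <= y <= d ->
  q.[y] ^+ 2 <= lagrange_const n ^+ 2 * (2 * n%:R) / (d - c) * (P.[d] - P.[c]).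
Proof.
case: n => [|n] sq cd dP y /andP[cy yd].
  move: sq; rewrite leqn0 size_poly_eq0 => /eqP ->.
  by rewrite /lagrange_const mul0r expr0n/= !mul0r horner0 expr0n.
set N := n.+1; set de := (d - c) / (2 * N%:R).
have N0 : 0 < N%:R :> R by rewrite ltr0n.
have de0 : 0 < de by rewrite divr_gt0 ?mulr_gt0 ?subr_gt0.
have deE : 2 * N%:R * de = d - c by rewrite /de mulrCA divff ?mulr1// gt_eqF ?mulr_gt0.
have Pmono x z : x <= z -> P.[x] <= P.[z].
  move=> xz; have [t _ e] := mean_value xz (@continuous_horner_fun P) (fun t _ => horner_is_derive P t).
  by rewrite -subr_ge0 e dP horner_exp mulr_ge0 ?sqr_ge0 ?subr_ge0.
have pt i : exists t, c + i.*2%:R * de <= t <= c + i.*2%:R * de + de /\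
    P.[c + i.*2%:R * de + de] - P.[c + i.*2%:R * de] = q.[t] ^+ 2 * de.
  have h : c + i.*2%:R * de <= c + i.*2%:R * de + de by lra.
  have [t tI e] := mean_value h (@continuous_horner_fun P) (fun t _ => horner_is_derive P t).
  by exists t; split => //; rewrite e dP horner_exp; congr (_ * _); lra.
pose t i := projT1 (cid (pt i)).
have [tI tP] : (forall i, c + i.*2%:R * de <= t i <= c + i.*2%:R * de + de) /\
    (forall i, P.[c + i.*2%:R * de + de] - P.[c + i.*2%:R * de] = q.[t i] ^+ 2 * de).
  by split => i; rewrite /t; case: cid => z [].
have tlt i j : (i < j)%N -> de <= t j - t i.
  move=> ij; have /andP[_ h1] := tI i; have /andP[h2 _] := tI j.
  have h3 : i.*2%:R + 2 <= j.*2%:R :> R.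
    by rewrite -natrD ler_nat addn2 -doubleS leq_double.
  have h4 : (i.*2%:R + 2) * de <= j.*2%:R * de by rewrite ler_pM2r.
  lra.
have tsep i j : i != j -> de <= `|t i - t j|.
  rewrite neq_ltn => /orP[ij|ji].
    by rewrite distrC (le_trans (tlt _ _ ij))// ler_norm.
  by rewrite (le_trans (tlt _ _ ji))// ler_norm.
have tinj : injective t.
  move=> i j e; apply/eqP; apply: contraT => /tsep.
  by rewrite e subrr normr0 leNgt de0.
have tcd i : (i < N)%N -> c <= t i <= d.
  move=> iN; have /andP[h1 h2] := tI i; apply/andP; split.
    by apply: le_trans h1; rewrite lerDl mulr_ge0// ltW.
  apply: (le_trans h2).
  have h3 : (i.*2%:R + 1) * de <= 2 * N%:R * de.
    by rewrite ler_pM2r// natr1 -natrM ler_nat mul2n ltn_double.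
  lra.
set E := P.[d] - P.[c].
have E0 : 0 <= E by rewrite subr_ge0 Pmono ?ltW.
(* [P] is nondecreasing, so its increment over a short interval, equal to [q.[t i] ^+ 2 * de], is at
   most [E]. *)
set B := Num.sqrt (E / de).
have qt i : (i < N)%N -> `|q.[t i]| <= B.
  move=> iN; rewrite -sqrtr_sqr ler_wsqrtr// ler_pdivlMr// -tP.
  have h3 : (i.*2%:R + 1) * de <= 2 * N%:R * de.
    by rewrite ler_pM2r// natr1 -natrM ler_nat mul2n ltn_double.
  apply: lerB; apply: Pmono; first by lra.
  by rewrite lerDl mulr_ge0// ltW.
have lag (i : 'I_N) : `|(tnth (lagrange N t) i : {poly R}).[y]| <= (2 * N%:R) ^+ N.
  rewrite lagrangeE// hornerM hornerC !horner_prod normrM normfV.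
  rewrite !normr_prod -prodfV -big_split/=.
  apply: (@le_trans _ _ (\prod_(j < N | j != i) (2 * N%:R))).
    apply: ler_prod => j ji; rewrite mulr_ge0 ?invr_ge0//= !hornerXsubC.
    have h1 : de <= `|t i - t j| by apply: tsep; rewrite eq_sym.
    have h2 : `|y - t j| <= d - c.
      have /andP[? ?] := tcd j (ltn_ord j); rewrite ler_norml; lra.
    rewrite mulrC ler_pdivrMr; last exact: lt_le_trans h1.
    rewrite (le_trans h2)// -deE ler_pM2l// mulr_gt0//.
  rewrite prodr_const; apply: ler_weXn2l.
    by rewrite -natrM ler1n mul2n -addnn addSn.
  by rewrite (leq_trans (max_card _))// card_ord.
have qB : `|q.[y]| <= lagrange_const N * B.
  rewrite (@lagrange_gen _ N t _ tinj q sq)// horner_sum.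
  apply: (le_trans (ler_norm_sum _ _ _)).
  apply: (@le_trans _ _ (\sum_(i < N) (2 * N%:R) ^+ N * B)).
    apply: ler_sum => i _; rewrite hornerM hornerC normrM mulrC.
    by apply: ler_pM => //; exact: qt.
  by rewrite sumr_const card_ord -[X in X <= _]mulr_natl mulrA.
have lc0 : 0 <= lagrange_const N.
  by rewrite mulr_ge0// exprn_ge0// mulr_ge0.
rewrite -real_normK ?num_real//.
apply: (@le_trans _ _ ((lagrange_const N * B) ^+ 2)).
  by rewrite lerXn2r// ?nnegrE ?mulr_ge0// sqrtr_ge0.
have Ede : 0 <= E / de by apply: divr_ge0 => //; exact: ltW.
rewrite exprMn sqr_sqrtr//.
have -> // : lagrange_const N ^+ 2 * (E / de) =
  lagrange_const N ^+ 2 * (2 * N%:R) / (d - c) * E.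
by rewrite /de invf_div; ring.
Qed.

(** Induction on [n]: the approximant of the derivative is integrated and its constant fixed at [c].
    Each integration gains a factor [d - c]; factorials are not tracked. *)
Lemma taylor_poly n (K c d : R) (S : nat -> R -> R) : c <= d ->
  (forall j, (j < n)%N -> forall x, is_derive x (1:R) (S j) (S j.+1 x)) ->
  (forall x y, c <= x -> x <= y -> y <= d -> `|S n y - S n x| <= K * (y - x)) ->
  exists2 T : {poly R}, (size T <= n.+1)%N &
    forall x, c <= x <= d -> `|S 0%N x - T.[x]| <= K * (d - c) ^+ n.+1.
Proof.
move=> cd; elim: n S => [|n ih] S dS lS.
  exists (S 0%N c)%:P; first exact: size_polyC_leq1.
  move=> x /andP[cx xd]; rewrite hornerC expr1.
  apply: (le_trans (lS _ _ (lexx _) cx xd)).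
  have := lS _ _ (lexx _) cd (lexx _).
  (* The Lipschitz bound yields [0 <= K] only when [c < d]. *)
  have [cde|dc] := eqVneq c d.
    have -> : x = c by lra.
    by rewrite cde.
  have dc0 : 0 < d - c by rewrite subr_gt0 lt_neqAle dc.
  move=> /(le_trans (normr_ge0 _)); rewrite pmulr_lge0// => K0.
  by apply: ler_wpM2l => //; lra.
have [T1 sT1 hT1] := ih (fun j => S j.+1) (fun j jn => dS j.+1 jn) lS.
have [Q dQ sQ] := poly_primitive T1.
exists (Q + (S 0%N c - Q.[c])%:P).
  by rewrite (leq_trans (size_polyD _ _))// geq_max (leq_trans sQ)//= (leq_trans (size_polyC_leq1 _)).
move=> x /andP[cx xd].
pose F y := S 0%N y - Q.[y].
have dF y : is_derive y (1:R) F (S 1%N y - T1.[y]).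
  by apply: is_deriveB; [exact: dS|rewrite -dQ; exact: horner_is_derive].
have [z /andP[cz zx] e] := mean_value cx (derivable_continuous dF) (fun y _ => dF y).
rewrite hornerD hornerC.
have -> : S 0%N x - (Q.[x] + (S 0%N c - Q.[c])) = F x - F c by rewrite /F; ring.
have hz : `|S 1%N z - T1.[z]| <= K * (d - c) ^+ n.+1 by apply: hT1; rewrite cz (le_trans zx).
rewrite e normrM (ger0_norm (_ : 0 <= x - c)) ?subr_ge0// [_ ^+ n.+2]exprSr mulrA.
by apply: ler_pM => //; rewrite ?subr_ge0//; lra.
Qed.

End Polynomials.

(** * Sup-norm stability of the weighted projection *)

Section Projection.
Variable R : realType.
Implicit Types (p q s T ell : {poly R}) (a b c d m x y t : R) (n : nat) (P : R -> R).

(* With P' = phi this is the integral of phi / beta over (c, d), where beta is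
   b1 on (c, m) and b2 on (m, d). *)
Definition wincr m b1 b2 P c d : R := (P m - P c) / b1 + (P d - P m) / b2.

Lemma wincr_bound m b1 b2 (bmin E : R) P (phi : R -> R) c d : c <= m <= d -> 0 < bmin ->
  bmin <= b1 -> bmin <= b2 ->
  (forall y, is_derive y (1:R) P (phi y)) -> (forall y, c <= y <= d -> `|phi y| <= E) ->
  `|wincr m b1 b2 P c d| <= E * (d - c) / bmin.
Proof.
move=> /andP[cm md] b0 h1 h2 dP hE.
have E0 : 0 <= E by apply: le_trans (normr_ge0 _) (hE c _); rewrite lexx (le_trans cm).
have key x y bi : c <= x -> x <= y -> y <= d -> bmin <= bi ->
    `|(P y - P x) / bi| <= E * (y - x) / bmin.
  move=> cx xy yd hb; have [z /andP[xz zy] ->] := mean_value xy (derivable_continuous dP) (fun y _ => dP y).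
  have bi0 : 0 < bi by exact: lt_le_trans hb.
  rewrite normrM normfV (gtr0_norm bi0) normrM (ger0_norm (_ : 0 <= y - x)) ?subr_ge0//.
  apply: ler_pM; rewrite ?mulr_ge0 ?invr_ge0 ?subr_ge0 ?(ltW bi0)//.
    by apply: ler_wpM2r; rewrite ?subr_ge0//; apply: hE; rewrite (le_trans cx)//= (le_trans zy).
  by rewrite lef_pV2.
rewrite /wincr; apply: (le_trans (ler_normD _ _)).
have -> : E * (d - c) / bmin = E * (m - c) / bmin + E * (d - m) / bmin by field; rewrite gt_eqF.
by apply: lerD; apply: key.
Qed.

(** For [q] of degree below [n], [q^2] is at most [stab_const n / (d - c)] times its integral over
    [[c, d]]. *)
Definition stab_const n : R := lagrange_const R n ^+ 2 * (2 * n%:R).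

Lemma stab_const_ge0 n : 0 <= stab_const n.
Proof. by rewrite mulr_ge0 ?sqr_ge0// mulr_ge0. Qed.

(* sigma - q is the error of the weighted L^2 projection; modulo ell, which is
   orthogonal to the projection space, only the Taylor remainder sigma - T
   contributes, and the projection is stable in the sup norm. *)
Lemma projection_error n m b1 b2 (bmin bmax E : R) c d (sigma : R -> R) q ell T :
  c < d -> c <= m <= d -> 0 < bmin ->
  bmin <= b1 <= bmax -> bmin <= b2 <= bmax ->
  (size q <= n)%N -> size ell = n.+1 -> (size T <= n.+1)%N ->
  continuous sigma ->
  (forall y, c <= y <= d -> `|sigma y - T.[y]| <= E) ->
  (forall s (P : {poly R}), (size s <= n)%N -> P^`() = ell * s ->
     wincr m b1 b2 (horner P) c d = 0) ->
  (forall s P, (size s <= n)%N ->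
     (forall y, is_derive y (1:R) P ((sigma y - q.[y]) * s.[y])) ->
     wincr m b1 b2 P c d = 0) ->
  exists t, forall y, c <= y <= d ->
    `|sigma y - q.[y] - t * ell.[y]| <= (1 + stab_const n * (bmax / bmin)) * E.
Proof.
move=> cd cmd bmin0 /andP[h1 h1'] /andP[h2 h2'] sq sell sT csig hE oell osig.
have /andP[cm md] := cmd.
have b10 : 0 < b1 by exact: lt_le_trans h1.
have b20 : 0 < b2 by exact: lt_le_trans h2.
have bmax0 : 0 < bmax by exact: lt_le_trans h1'.
have E0 : 0 <= E by apply: le_trans (normr_ge0 _) (hE c _); rewrite lexx ltW.
have ell0 : ell`_n != 0.
  have : lead_coef ell != 0 by rewrite lead_coef_eq0 -size_poly_eq0 sell.
  by rewrite lead_coefE sell.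
(* [t] cancels the coefficient of degree [n], so that [T - t *: ell] has degree below [n] and [q0]
   is an admissible test polynomial. *)
set t := T`_n / ell`_n.
pose q0 : {poly R} := q - (T - t *: ell).
have sq0 : (size q0 <= n)%N.
  rewrite (leq_trans (size_polyD _ _))// geq_max sq size_polyN/=.
  apply/leq_sizeP => j; rewrite leq_eqVlt => /predU1P[<-|nj].
    by rewrite coefB coefZ divfK// subrr.
  rewrite coefB coefZ [T`_j]nth_default ?(leq_trans sT)//.
  by rewrite [ell`_j]nth_default ?sell// mulr0 subr0.
have [P0 dP0 _] := poly_primitive (q0 ^+ 2).
have [Pl dPl _] := poly_primitive (ell * q0).
pose r y := (sigma y - T.[y]) * q0.[y].
have cr : continuous r.
  move=> y; apply: cvgM; last exact: continuous_horner_fun.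
  by apply: cvgB; [exact: csig|exact: continuous_horner_fun].
have dr := primitive_is_derive cr.
(* [(sigma - q) q0 = (sigma - T) q0 + t ell q0 - q0^2]. The left side and the [ell] term have zero
   weighted integral, so the weighted energy of [q0] equals its pairing with the Taylor
   remainder. *)
pose P y := primitive r y + (t *: Pl).[y] - P0.[y].
have dP y : is_derive y (1:R) P ((sigma y - q.[y]) * q0.[y]).
  have -> : (sigma y - q.[y]) * q0.[y] = r y + ((t *: Pl)^`()).[y] - (P0^`()).[y].
    have q0E : q0.[y] = q.[y] - (T.[y] - t * ell.[y]) by rewrite /q0 !hornerE.
    rewrite /r derivZ dPl dP0 hornerZ hornerM horner_exp q0E.
    ring.
  exact: (is_deriveB (is_deriveD (dr y) (horner_is_derive (t *: Pl) y)) (horner_is_derive P0 y)).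
have w0 := osig q0 P sq0 dP.
have wl := oell q0 Pl sq0 dPl.
have wE : wincr m b1 b2 (horner P0) c d = wincr m b1 b2 (primitive r) c d.
  have : wincr m b1 b2 P c d = wincr m b1 b2 (primitive r) c d +
      t * wincr m b1 b2 (horner Pl) c d - wincr m b1 b2 (horner P0) c d.
    by rewrite /wincr /P !hornerE; move: (primitive r _) (primitive r _) (primitive r _) => *; ring.
  rewrite w0 wl mulr0 addr0 => /esym/eqP; rewrite subr_eq0 => /eqP ->//.
have P0mono x z : x <= z -> P0.[x] <= P0.[z].
  move=> xz; have [u _ e] := mean_value xz (@continuous_horner_fun R P0) (fun t _ => horner_is_derive P0 t).
  by rewrite -subr_ge0 e dP0 horner_exp mulr_ge0 ?sqr_ge0 ?subr_ge0.
set X := P0.[d] - P0.[c].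
have X0 : 0 <= X by rewrite subr_ge0 P0mono ?ltW.
(* The weight is at least [1 / bmax] here and at most [1 / bmin] in [upX]; the factor [bmax / bmin]
   arises from these two bounds. *)
have lowX : X / bmax <= wincr m b1 b2 (horner P0) c d.
  have -> : X / bmax = (P0.[m] - P0.[c]) / bmax + (P0.[d] - P0.[m]) / bmax.
    by rewrite /X; field; rewrite gt_eqF.
  by apply: lerD; apply: ler_wpM2l; rewrite ?subr_ge0 ?P0mono// lef_pV2.
have dc0 : 0 < d - c by rewrite subr_gt0.
set K := stab_const n.
have K0 : 0 <= K := stab_const_ge0 n.
have sup y : c <= y <= d -> q0.[y] ^+ 2 <= K / (d - c) * X.
  by move=> ycd; exact: poly_sup_bound.
set Y := Num.sqrt (K / (d - c) * X).
have Y0 : 0 <= Y by exact: sqrtr_ge0.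
have Y2 : Y ^+ 2 = K / (d - c) * X by rewrite sqr_sqrtr// mulr_ge0// divr_ge0// ltW.
have q0Y y : c <= y <= d -> `|q0.[y]| <= Y.
  by move=> ycd; rewrite -sqrtr_sqr ler_wsqrtr// sup.
have rb y : c <= y <= d -> `|r y| <= E * Y.
  by move=> ycd; rewrite normrM ler_pM// ?hE ?q0Y.
have upX := wincr_bound cmd bmin0 h1 h2 dr rb.
have XE : X <= (bmax / bmin) * E * Y * (d - c).
  have : X / bmax <= E * Y * (d - c) / bmin.
    by rewrite (le_trans lowX)// wE (le_trans (ler_norm _)).
  rewrite ler_pdivrMr//; congr (_ <= _); ring.
(* [Y] occurs on both sides, [Y^2 <= K (bmax / bmin) E Y]; dividing by [Y] leaves a linear bound. *)
have YE : Y <= K * (bmax / bmin) * E.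
  have [Ye|Yn] := eqVneq Y 0.
    by rewrite Ye !mulr_ge0// ?invr_ge0 ltW.
  have Yp : 0 < Y by rewrite lt_neqAle eq_sym Yn.
  rewrite -(ler_pM2r Yp) -expr2 Y2 mulrAC ler_pdivrMr//.
  have -> : K * (bmax / bmin) * E * Y * (d - c) = K * (bmax / bmin * E * Y * (d - c)) by ring.
  exact: ler_wpM2l.
exists t => y ycd.
have -> : sigma y - q.[y] - t * ell.[y] = (sigma y - T.[y]) - q0.[y].
  by rewrite /q0 !hornerE; ring.
apply: (le_trans (ler_normB _ _)); rewrite mulrDl mul1r.
by apply: lerD; [exact: hE|apply: le_trans (q0Y _ ycd) YE].
Qed.

End Projection.

(** * Continuous primitives for the weight [1 / beta] *)

Section WeightedPrimitive.
Variable R : realType.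
Implicit Types (a b c d m x y t alpha bm bp : R) (P F G phi : R -> R).
Local Notation mu := (@lebesgue_measure R).

(* The continuous primitive of P' / beta. *)
Definition wprim alpha bm bp P y : R :=
  P (Num.min y alpha) / bm + (P (Num.max y alpha) - P alpha) / bp.

(** Applied to [alpha] it gives the breakpoint of an element, possibly at an end; applied to the
    variable it extends a function on an element by constants. *)
Definition clamp c d y : R := Num.max c (Num.min y d).

Lemma clamp_itv c d y : c <= d -> c <= clamp c d y <= d.
Proof. by move=> cd; rewrite /clamp le_max lexx/= ge_max cd ge_min lexx orbT. Qed.

Lemma clamp_lt c d y z : c < z -> z < clamp c d y -> z < y.
Proof. by move=> cz; rewrite /clamp lt_max ltNge (ltW cz)/= lt_min => /andP[]. Qed.

Lemma clamp_gt c d y z : z < d -> clamp c d y < z -> y < z.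
Proof.
by move=> zd; rewrite /clamp gt_max => /andP[_]; rewrite gt_min => /orP[//|]; rewrite ltNge (ltW zd).
Qed.

Lemma clamp_id c d y : c <= y <= d -> clamp c d y = y.
Proof. by move=> /andP[cy yd]; rewrite /clamp min_l// max_r. Qed.

Lemma clamp_le c d y : c <= d -> y <= c -> clamp c d y = c.
Proof. by move=> cd yc; rewrite /clamp min_l ?(le_trans yc)// max_l. Qed.

Lemma clamp_ge c d y : c <= d -> d <= y -> clamp c d y = d.
Proof. by move=> cd dy; rewrite /clamp min_r// max_r. Qed.

Lemma continuous_minl c : continuous (fun y => Num.min y c).
Proof. by move=> y; apply: continuous_min; [exact: cvg_id|exact: cvg_cst]. Qed.

Lemma continuous_maxl c : continuous (fun y => Num.max y c).
Proof. by move=> y; apply: continuous_max; [exact: cvg_id|exact: cvg_cst]. Qed.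

Lemma continuous_clamp c d : continuous (clamp c d).
Proof.
have -> : clamp c d = fun y => Num.max (Num.min y d) c by apply/funext => y; rewrite /clamp maxC.
move=> y; apply: (@cvg_comp _ _ _ (fun y => Num.min y d) (fun z => Num.max z c)); last exact: continuous_maxl.
exact: continuous_minl.
Qed.

Lemma wprim_left alpha bm bp P y : y <= alpha -> wprim alpha bm bp P y = P y / bm.
Proof. by move=> ya; rewrite /wprim min_l// max_r// subrr mul0r addr0. Qed.

Lemma wprim_right alpha bm bp P y : alpha <= y ->
  wprim alpha bm bp P y = P alpha / bm + (P y - P alpha) / bp.
Proof. by move=> ay; rewrite /wprim min_r// max_l. Qed.

Lemma wprim_incr alpha bm bp P c d : c <= d ->
  wprim alpha bm bp P d - wprim alpha bm bp P c = wincr (clamp c d alpha) bm bp P c d.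
Proof.
move=> cd; rewrite /wincr; have [ac|ca] := leP alpha c.
  rewrite clamp_le// !wprim_right// ?(le_trans ac)//; ring.
have [ad|da] := leP alpha d.
  rewrite clamp_id ?(ltW ca)// wprim_right// wprim_left ?ltW//; ring.
rewrite clamp_ge ?(ltW da)// !wprim_left ?(ltW da)//; last exact: ltW.
ring.
Qed.

Lemma continuous_wprim alpha bm bp P : continuous P -> continuous (wprim alpha bm bp P).
Proof.
move=> cP y; apply: cvgD; apply: cvgM; try exact: cvg_cst.
  by apply: (@cvg_comp _ _ _ _ P _ (nbhs (Num.min y alpha))); [exact: continuous_minl|exact: cP].
apply: cvgB; last exact: cvg_cst.
by apply: (@cvg_comp _ _ _ _ P _ (nbhs (Num.max y alpha))); [exact: continuous_maxl|exact: cP].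
Qed.

Lemma is_derive_wprim alpha bm bp P (l : R) y : y != alpha -> is_derive y (1:R) P l ->
  is_derive y (1:R) (wprim alpha bm bp P) (l / pw alpha bm bp y).
Proof.
move=> ya dP; rewrite /pw; move: ya; case: ltgtP => // [ya|ay] _.
  have yI : y - 1 < y < alpha by lra.
  apply: (is_derive_itvoo yI (g := fun z => bm^-1 * P z)).
    by move=> z /andP[_ za]; rewrite wprim_left ?ltW// mulrC.
  by rewrite mulrC; apply: (@is_deriveZ _ _ _ _ _ y).
have yI : alpha < y < y + 1 by lra.
apply: (is_derive_itvoo yI (g := fun z => (P alpha / bm - P alpha / bp) + bp^-1 * P z)).
  by move=> z /andP[za _]; rewrite wprim_right ?ltW//; ring.
have h : is_derive y (1:R) (fun z => bp^-1 * P z) (bp^-1 * l) by apply: (@is_deriveZ _ _ _ _ _ y).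
have := is_deriveD (is_derive_cst (P alpha / bm - P alpha / bp) y 1) h.
by rewrite add0r [X in is_derive _ _ _ X -> _]mulrC.
Qed.

(** Evaluation rule for integrals with weight [1 / beta]. The integrand is left free at [alpha],
    where [derive1] of a discrete function has no reliable value. *)
Lemma integral_on_wprim alpha bm bp P phi G c d : c <= d -> 
  (forall y, is_derive y (1:R) P (phi y)) -> continuous phi ->
  (forall y, c < y < d -> y != alpha -> G y = phi y / pw alpha bm bp y) ->
  integral_on G c d (wprim alpha bm bp P d - wprim alpha bm bp P c).
Proof.
move=> cd dP cphi GE; have cmd := clamp_itv alpha cd; have /andP[cm md] := cmd.
apply: (integral_on_deriv2 (G1 := fun y => phi y / bm) (G2 := fun y => phi y / bp) cmd).
- by apply: continuous_wprim; exact: derivable_continuous dP.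
- by move=> y; apply: cvgM; [exact: cphi|exact: cvg_cst].
- by move=> y; apply: cvgM; [exact: cphi|exact: cvg_cst].
- move=> y /andP[cy ym]; have ya := clamp_lt cy ym.
  have yna : y != alpha by rewrite lt_eqF.
  have := GE y; have := @is_derive_wprim alpha bm bp P (phi y) y yna (dP y).
  by rewrite /pw ya cy (lt_le_trans ym md) => h1 h2; split; [exact: h1|exact: h2].
- move=> y /andP[my yd]; have ay := clamp_gt yd my.
  have yna : y != alpha by rewrite gt_eqF.
  have := GE y; have := @is_derive_wprim alpha bm bp P (phi y) y yna (dP y).
  by rewrite /pw ltNge (ltW ay)/= yd (le_lt_trans cm my) => h1 h2; split; [exact: h1|exact: h2].
Qed.

Lemma integral_on_cc G c d v : integral_on G c d v -> \int[mu]_(t in `[c, d]) G t = v.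
Proof.
move=> [iG <-].
have icc := integrable_itv_cc iG.
rewrite -Rintegral_itv_bndo_bndc; last first.
  by apply: integrableS icc => //; apply: subset_itvl; rewrite bnd_simp.
by rewrite -Rintegral_itv_obnd_cbnd.
Qed.

(** The discrete space prescribes formulas on open elements only; continuity carries them to the
    mesh points. *)
Lemma eq_within_cc F G c d : c < d -> {within `[c, d], continuous F} ->
  {within `[c, d], continuous G} -> (forall y, c < y < d -> F y = G y) ->
  forall y, c <= y <= d -> F y = G y.
Proof.
move=> cd /(continuous_within_itvP _ cd)[_ Fc Fd] /(continuous_within_itvP _ cd)[_ Gc Gd] e y.
move=> /andP[]; rewrite le_eqVlt => /predU1P[<- _|cy].
  suff h : F x @[x --> c^'+] --> G c by exact: (cvg_unique _ Fc h).
  apply: cvg_trans Gc; apply: near_eq_cvg; near=> x; rewrite e//.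
  by apply/andP; split; [|near: x; exact: nbhs_right_lt].
rewrite le_eqVlt => /predU1P[->|yd]; last by apply: e; rewrite cy.
suff h : F x @[x --> d^'-] --> G d by exact: (cvg_unique _ Fd h).
apply: cvg_trans Gd; apply: near_eq_cvg; near=> x; rewrite e//.
by apply/andP; split; [near: x; exact: nbhs_left_gt|].
Unshelve. all: by end_near. Qed.

Lemma eq_deriv_within_cc F G (g : R -> R) c d : c <= d -> {within `[c, d], continuous F} ->
  {within `[c, d], continuous G} ->
  (forall y, c < y < d -> is_derive y (1:R) F (g y) /\ is_derive y (1:R) G (g y)) ->
  forall y, c <= y <= d -> F y - G y = F c - G c.
Proof.
move=> cd cF cG h y /andP[cy yd].
have sub : `[c, y] `<=` `[c, d] by apply: subset_itvl; rewrite bnd_simp.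
have cFG : {within `[c, y], continuous (fun z => F z - G z)}.
  have cF' := continuous_subspaceW sub cF.
  have cG' := continuous_subspaceW sub cG.
  by move=> z; apply: cvgB; [exact: cF'|exact: cG'].
have dFG z : z \in `]c, y[ -> is_derive z (1:R) (fun z => F z - G z) 0.
  rewrite in_itv/= => /andP[cz zy]; have [|h1 h2] := h z; first by rewrite cz (lt_le_trans zy).
  by have := is_deriveB h1 h2; rewrite subrr.
have [z _] := MVT_segment cy dFG cFG.
by rewrite mul0r => /eqP; rewrite subr_eq0 => /eqP.
Qed.

End WeightedPrimitive.

(** * Generalized Legendre and Lobatto polynomials through [wprim] *)

Section GeneralizedPolynomials.
Variable R : realType.
Implicit Types (a b c d m x y t alpha bm bp ah xi : R) (P F G : R -> R) (p q s Q : {poly R}).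
Local Notation mu := (@lebesgue_measure R).

Lemma wprimD ah bm bp Q1 Q2 y :
  wprim ah bm bp (horner (Q1 + Q2)) y = wprim ah bm bp (horner Q1) y + wprim ah bm bp (horner Q2) y.
Proof. by rewrite /wprim !hornerD; ring. Qed.

Lemma wprimB ah bm bp Q1 Q2 y :
  wprim ah bm bp (horner (Q1 - Q2)) y = wprim ah bm bp (horner Q1) y - wprim ah bm bp (horner Q2) y.
Proof. by rewrite /wprim !hornerD !hornerN; ring. Qed.

Lemma wprimZ ah bm bp k Q y :
  wprim ah bm bp (horner (k *: Q)) y = k * wprim ah bm bp (horner Q) y.
Proof. by rewrite /wprim !hornerZ; ring. Qed.

Lemma wprimC ah bm bp k y : wprim ah bm bp (horner k%:P) y = k / bm.
Proof. by rewrite /wprim !hornerC subrr mul0r addr0. Qed.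

Lemma wprim_sum ah bm bp n (e : nat -> R) (Q : nat -> {poly R}) y :
  wprim ah bm bp (horner (\sum_(0 <= i < n) e i *: Q i)) y =
  \sum_(0 <= i < n) e i * wprim ah bm bp (horner (Q i)) y.
Proof.
elim: n => [|n ih]; first by rewrite !big_nil -polyC0 wprimC mul0r.
by rewrite !big_nat_recr//= wprimD wprimZ ih.
Qed.

Lemma wprim_incr_deriv ah bm bp Q1 Q2 x y : (Q1 - Q2)^`() = 0 ->
  wprim ah bm bp (horner Q1) y - wprim ah bm bp (horner Q1) x =
  wprim ah bm bp (horner Q2) y - wprim ah bm bp (horner Q2) x.
Proof.
move=> d0; have [k E] : exists k, forall z, Q1.[z] = Q2.[z] + k.
  exists (Q1.[0] - Q2.[0]) => z.
  by have := deriv_eq0_horner d0 z 0; rewrite !hornerD !hornerN => h; lra.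
by rewrite /wprim !E; ring.
Qed.

Lemma gen_weight_integral ah bm bp s Q xi : Q^`() = s -> -1 <= xi ->
  \int[mu]_(t in `[-1, xi]) (gen_weight ah bm bp t * s.[t]) =
  wprim ah bm bp (horner Q) xi - wprim ah bm bp (horner Q) (-1).
Proof.
move=> dQ x1; apply: integral_on_cc; apply: (integral_on_wprim x1 (phi := horner s)).
- by move=> y; rewrite -dQ; exact: horner_is_derive.
- exact: continuous_horner_fun.
- by move=> y _ _; rewrite /gen_weight mulrC.
Qed.

(** Continuity and equality of the two fluxes at [ah] leave free a constant and the common flux
    [k = bm * dm = bp * dp]. *)
Lemma gen_affineE ah bm bp phi : 0 < bm -> 0 < bp -> -1 <= ah <= 1 -> gen_affine ah bm bp phi ->
  exists k, forall xi, -1 <= xi <= 1 ->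
    phi xi = phi (-1) + k * (wprim ah bm bp id xi - wprim ah bm bp id (-1)).
Proof.
move=> bm0 bp0 /andP[a1 a2] [cphi [cm [dm [cp [dp [hl hr jmp]]]]]].
have caff (u w : R) : continuous (fun x : R => u + w * x).
  by move=> x; apply: cvgD; [exact: cvg_cst|apply: cvgM; [exact: cvg_cst|exact: cvg_id]].
have left_ xi : -1 <= xi <= ah -> phi xi = phi (-1) + dm * (xi + 1).
  move: a1; rewrite le_eqVlt => /predU1P[<-|a1] xiI.
    have -> : xi = -1 by lra.
    by rewrite addNr mulr0 addr0.
  have sub : `[-1, ah] `<=` `[-1, 1 : R] by apply: subset_itvl; rewrite bnd_simp.
  have H := eq_within_cc a1 (continuous_subspaceW sub cphi) (continuous_subspaceT (caff cm dm)) hl.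
  rewrite !H//; first by ring.
  by rewrite lexx ltW.
have right_ xi : ah <= xi <= 1 -> phi xi = phi ah + dp * (xi - ah).
  move: a2; rewrite le_eqVlt => /predU1P[->|a2] xiI.
    have -> : xi = 1 by lra.
    by rewrite subrr mulr0 addr0.
  have sub : `[ah, 1] `<=` `[-1, 1 : R] by apply: subset_itvr; rewrite bnd_simp.
  have H := eq_within_cc a2 (continuous_subspaceW sub cphi) (continuous_subspaceT (caff cp dp)) hr.
  rewrite !H//; first by ring.
  by rewrite lexx ltW.
have bmn : bm != 0 by rewrite gt_eqF.
have bpn : bp != 0 by rewrite gt_eqF.
exists (bm * dm) => xi /andP[x1 x2]; have [xa|ax] := leP xi ah.
  rewrite left_ ?x1//= !wprim_left//.
  by field.
rewrite right_ ?(ltW ax)// (left_ ah) ?a1//= [wprim _ _ _ _ xi]wprim_right ?(ltW ax)// wprim_left//.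
have -> : dp = bm * dm / bp by apply: (mulfI bpn); rewrite mulrCA divff// mulr1; lra.
by field; rewrite bmn.
Qed.

Section Lobatto.
Variables (ah bm bp : R) (L : nat -> {poly R}) (phi : nat -> R -> R).
Hypotheses (bm0 : 0 < bm) (bp0 : 0 < bp) (ahI : -1 <= ah <= 1).
Hypotheses (hL : gen_legendre ah bm bp L) (hphi : gen_lobatto ah bm bp L phi).
Local Notation W := (wprim ah bm bp).

Lemma wprim_id_gt : 0 < W id 1 - W id (-1).
Proof.
have /andP[a1 a2] := ahI; rewrite /wprim (min_r a2) (max_l a2) (min_l a1) (max_r a1).
have h1 : 0 < bm^-1 by rewrite invr_gt0.
have h2 : 0 < bp^-1 by rewrite invr_gt0.
have [ah1|ah1] := eqVneq ah 1; first by rewrite ah1 !subrr !mul0r; nra.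
have : 0 < 1 - ah by rewrite subr_gt0 lt_neqAle ah1.
nra.
Qed.

Lemma gen_lobatto1E : exists2 k, k != 0 & forall xi, -1 <= xi <= 1 ->
  phi 1%N xi = k * (W id xi - W id (-1)).
Proof.
have [_ [h p0 p1] _] := hphi; have [k hk] := gen_affineE bm0 bp0 ahI h.
exists k; last by move=> xi xiI; rewrite hk// p0 add0r.
have := hk 1; rewrite p0 p1 add0r lexx => /(_ _)H.
apply: contra_eqN (H _) => [/eqP ->|]; last by lra.
by rewrite mul0r oner_eq0.
Qed.

Lemma gen_lobatto0E xi : -1 <= xi <= 1 -> phi 0%N xi = 1 - phi 1%N xi.
Proof.
move=> xiI; have [[h0 p00 p01] [h1 p10 p11] _] := hphi.
have [k0 hk0] := gen_affineE bm0 bp0 ahI h0.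
have [k1 hk1] := gen_affineE bm0 bp0 ahI h1.
have one : -1 <= (1 : R) <= 1 by lra.
have := hk0 1 one; have := hk1 1 one; rewrite p00 p01 p10 p11.
have w := wprim_id_gt.
rewrite hk0// hk1// p00 p10; set w1 := _ - _ in w *; set w2 := _ - _.
rewrite add0r => e1 e0.
suff -> : k0 = - k1 by ring.
have w10 : w1 != 0 by rewrite gt_eqF.
by apply: (mulIf w10); lra.
Qed.

Lemma gen_lobattoE n Q xi : (2 <= n)%N -> Q^`() = L n.-1 -> -1 <= xi <= 1 ->
  phi n xi = W (horner Q) xi - W (horner Q) (-1).
Proof.
move=> n2 dQ xiI; have [_ _ h] := hphi; rewrite h//.
by rewrite (gen_weight_integral _ _ _ dQ)//; case/andP: xiI.
Qed.

(** With its converse below, this identifies the local space on the interface element as the image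
    under [wprim] of the polynomials of degree at most [p]. The [maxn] is due to [phi 0], which is
    piecewise affine and not constant. *)
Lemma gen_lobatto_wprim n : exists2 Q : {poly R}, (size Q <= (maxn n 1).+1)%N &
  forall xi, -1 <= xi <= 1 -> phi n xi = W (horner Q) xi.
Proof.
have wX y : W (horner 'X) y = W id y by rewrite /wprim !hornerX.
have aff k c : exists2 Q : {poly R}, (size Q <= 2)%N & forall y, c + k * (W id y - W id (-1)) = W (horner Q) y.
  (* The factor [bm] offsets the division of constants by [bm] in [wprim]. *)
  exists (k *: 'X + (bm * (c - k * W id (-1)))%:P) => [|y].
    rewrite (leq_trans (size_polyD _ _))// geq_max (leq_trans (size_scale_leq _ _)) ?size_polyX//.
    exact: leq_trans (size_polyC_leq1 _) _.
  rewrite wprimD wprimZ wprimC wX [bm * _ / bm]mulrAC divff ?gt_eqF//; ring.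
have [k _ hk] := gen_lobatto1E.
case: n => [|[|n]].
- have [Q sQ hQ] := aff (- k) 1; exists Q => // xi xiI.
  by rewrite gen_lobatto0E// hk// -hQ; ring.
- have [Q sQ hQ] := aff k 0; exists Q => // xi xiI.
  by rewrite hk// -hQ add0r.
- have [Q dQ sQ] := poly_primitive (L n.+1).
  exists (Q + (- bm * W (horner Q) (-1))%:P) => [|xi xiI].
    rewrite maxnC; have [_ sL] := hL.1 n.+1; rewrite sL in sQ.
    rewrite (leq_trans (size_polyD _ _))// geq_max sQ.
    exact: leq_trans (size_polyC_leq1 _) _.
  rewrite (@gen_lobattoE _ Q)// wprimD wprimC !mulNr mulrAC divff ?gt_eqF//.
  by rewrite mul1r.
Qed.

Lemma gen_lobatto_span_wprim n (e : nat -> R) : (1 <= n)%N ->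
  exists2 Q : {poly R}, (size Q <= n.+1)%N &
  forall xi, -1 <= xi <= 1 -> \sum_(0 <= i < n.+1) e i * phi i xi = W (horner Q) xi.
Proof.
move=> n1; pose Q i := projT1 (cid2 (gen_lobatto_wprim i)).
have sQ i : (size (Q i) <= (maxn i 1).+1)%N by rewrite /Q; case: cid2.
have hQ i xi : -1 <= xi <= 1 -> phi i xi = W (horner (Q i)) xi.
  by rewrite /Q; case: cid2 => ? ? h; exact: h.
exists (\sum_(0 <= i < n.+1) e i *: Q i) => [|xi xiI].
  rewrite big_mkord; apply: (leq_trans (size_sum _ _ _)); apply/bigmax_leqP => i _.
  rewrite (leq_trans (size_scale_leq _ _))// (leq_trans (sQ _))// ltnS geq_max n1 andbT.
  by rewrite -ltnS.
by rewrite wprim_sum; apply: eq_bigr => i _; rewrite hQ.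
Qed.

(** [Q'] is expanded in the monic family: [L 0 = 1] contributes a multiple of [phi 1], and each
    later [L i] contributes [phi i.+1]. The additive constant is carried by [phi 0 + phi 1 = 1]. *)
Lemma wprim_gen_lobatto_span n Q : (size Q <= n.+2)%N ->
  exists e : nat -> R, forall xi, -1 <= xi <= 1 ->
    W (horner Q) xi = \sum_(0 <= i < n.+2) e i * phi i xi.
Proof.
move=> sQ.
have sdQ : (size Q^`() <= n.+1)%N.
  have [->|Q0] := eqVneq Q 0; first by rewrite linear0 size_poly0.
  by rewrite -ltnS (leq_trans (lt_size_deriv Q0)).
have [e he] := monic_basis hL.1 sdQ.
pose La i := projT1 (cid2 (poly_primitive (L i))).
have dLa i : (La i)^`() = L i by rewrite /La; case: cid2.
have L0 : L 0%N = 1.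
  have [mL sL] := hL.1 0%N; have := size1_polyC (eq_leq sL) => e0.
  by move/monicP: mL; rewrite lead_coefE sL/= => e1; rewrite e0 e1.
have [k k0 hk] := gen_lobatto1E.
pose c := W (horner Q) (-1).
exists (fun i => match i with 0 => c | 1 => c + e 0%N / k | i'.+2 => e i'.+1 end) => xi xiI.
rewrite big_nat_recl// big_nat_recl//= gen_lobatto0E//.
have dif (Q1 Q2 : {poly R}) : Q1^`() = Q2^`() ->
    W (horner Q1) xi - W (horner Q1) (-1) = W (horner Q2) xi - W (horner Q2) (-1).
  move=> dd; have d0 : (Q1 - Q2)^`() = 0 by rewrite derivB dd subrr.
  exact: wprim_incr_deriv.
have -> : W (horner Q) xi = c + \sum_(0 <= i < n.+1) e i * (W (horner (La i)) xi - W (horner (La i)) (-1)).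
  rewrite -[LHS](subrK c) addrC; congr (_ + _).
  rewrite /c (dif Q (\sum_(0 <= i < n.+1) e i *: La i)).
    by rewrite !wprim_sum -sumrB; apply: eq_bigr => i _; ring.
  rewrite he big_mkord raddf_sum; apply: eq_bigr => i _.
  by rewrite /= derivZ dLa.
rewrite big_nat_recl//.
have -> : W (horner (La 0%N)) xi - W (horner (La 0%N)) (-1) = phi 1%N xi / k.
  rewrite (dif _ 'X); last by rewrite dLa L0 derivX.
  by rewrite hk// mulrC mulKf// /wprim !hornerX.
have -> : \sum_(0 <= i < n) e i.+1 * (W (horner (La i.+1)) xi - W (horner (La i.+1)) (-1)) =
          \sum_(0 <= i < n) e i.+1 * phi i.+2 xi.
  by apply: eq_bigr => i _; rewrite (@gen_lobattoE _ (La i.+1)).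
by move: (\sum_(0 <= i < n) _) => X; field.
Qed.

Lemma gen_legendre_orthogonal n s Q : (size s <= n)%N -> Q^`() = L n * s ->
  W (horner Q) 1 = W (horner Q) (-1).
Proof.
move=> sn dQ; have [e he] := monic_basis hL.1 sn.
pose La i := projT1 (cid2 (poly_primitive (L n * L i))).
have dLa i : (La i)^`() = L n * L i by rewrite /La; case: cid2.
have z i : (i < n)%N -> W (horner (La i)) 1 - W (horner (La i)) (-1) = 0.
  move=> ni; rewrite -(gen_weight_integral _ _ _ (dLa i)); last by lra.
  have nni : n != i by rewrite gtn_eqF.
  rewrite -(hL.2 n i nni).
  by apply: eq_Rintegral => t _; rewrite hornerM mulrA.
have d0 : (Q - \sum_(0 <= i < n) e i *: La i)^`() = 0.
  rewrite derivB dQ he big_mkord raddf_sum mulr_sumr -sumrB big1// => i _.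
  by rewrite /= derivZ dLa -scalerAr subrr.
apply/eqP; rewrite -subr_eq0; apply/eqP.
have -> : W (horner Q) 1 - W (horner Q) (-1) =
  W (horner (\sum_(0 <= i < n) e i *: La i)) 1 - W (horner (\sum_(0 <= i < n) e i *: La i)) (-1).
  exact: wprim_incr_deriv.
rewrite !wprim_sum -sumrB big_nat big1// => i /andP[_ ni].
by rewrite -mulrBr z// mulr0.
Qed.

End Lobatto.
End GeneralizedPolynomials.

(** * The estimate on one element *)

Section Element.
Variable R : realType.
Implicit Types (a b c d m x y t alpha : R) (P F G : R -> R) (q s Q ell Lam : {poly R}).
Local Notation mu := (@lebesgue_measure R).

(* S 0 and q stand for the exact and the discrete flux, ell for the (generalized)
   Legendre polynomial and Lam for its primitive. *)
Lemma element_estimate n alpha b1 b2 (bmin bmax K : R) c d (S : nat -> R -> R) q ell :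
  c < d -> 0 < bmin -> bmin <= b1 <= bmax -> bmin <= b2 <= bmax ->
  (size q <= n)%N -> size ell = n.+1 -> continuous (S 0%N) ->
  (forall j, (j < n)%N -> forall x, is_derive x (1:R) (S j) (S j.+1 x)) ->
  (forall x y, c <= x -> x <= y -> y <= d -> `|S n y - S n x| <= K * (y - x)) ->
  (forall s Q, (size s <= n)%N -> Q^`() = ell * s ->
     wprim alpha b1 b2 (horner Q) d = wprim alpha b1 b2 (horner Q) c) ->
  (forall s P, (size s <= n)%N ->
     (forall y, is_derive y (1:R) P ((S 0%N y - q.[y]) * s.[y])) ->
     wprim alpha b1 b2 P d = wprim alpha b1 b2 P c) ->
  let C := (1 + stab_const R n * (bmax / bmin)) * K in
  (forall y, c <= y <= d -> root ell y -> `|S 0%N y - q.[y]| <= C * (d - c) ^+ n.+1) /\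
  (forall P Lam y, (forall y, is_derive y (1:R) P (S 0%N y - q.[y])) -> Lam^`() = ell ->
     c <= y <= d -> wprim alpha b1 b2 (horner Lam) y = wprim alpha b1 b2 (horner Lam) c ->
     `|wprim alpha b1 b2 P y - wprim alpha b1 b2 P c| <= C * (d - c) ^+ n.+2 / bmin).
Proof.
move=> cd bmin0 hb1 hb2 sq sell cS dS lS oell oS C.
have cdl := ltW cd; have cmd := clamp_itv alpha cdl.
have [T sT hT] := taylor_poly cdl dS lS.
have oell' s Q : (size s <= n)%N -> Q^`() = ell * s ->
    wincr (clamp c d alpha) b1 b2 (horner Q) c d = 0.
  by move=> ss dQ; rewrite -wprim_incr// (oell s Q)// subrr.
have oS' s P : (size s <= n)%N ->
    (forall y, is_derive y (1:R) P ((S 0%N y - q.[y]) * s.[y])) ->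
    wincr (clamp c d alpha) b1 b2 P c d = 0.
  by move=> ss dP; rewrite -wprim_incr// (oS s P)// subrr.
have [t ht] := projection_error cd cmd bmin0 hb1 hb2 sq sell sT cS hT oell' oS'.
have CE y : c <= y <= d -> `|S 0%N y - q.[y] - t * ell.[y]| <= C * (d - c) ^+ n.+1.
  by move=> ycd; rewrite /C -mulrA; exact: ht.
split=> [y ycd /rootP r0|P Lam y dP dLam ycd e].
  by have := CE y ycd; rewrite r0 mulr0 subr0.
have /andP[cy yd] := ycd.
(* [Lam] has the same weighted value at [y] and at [c], so subtracting [t * Lam] keeps the increment
   and replaces the integrand by the small remainder. *)
pose P' z := P z - t * Lam.[z].
have dP' z : is_derive z (1:R) P' (S 0%N z - q.[z] - t * ell.[z]).
  apply: is_deriveB; apply: (@is_deriveZ _ _ _ _ _ z).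
  by rewrite -dLam; exact: horner_is_derive.
have -> : wprim alpha b1 b2 P y - wprim alpha b1 b2 P c =
    wprim alpha b1 b2 P' y - wprim alpha b1 b2 P' c.
  have W' z : wprim alpha b1 b2 P' z =
      wprim alpha b1 b2 P z - t * wprim alpha b1 b2 (horner Lam) z.
    by rewrite /wprim /P'; ring.
  by rewrite !W' e; ring.
rewrite wprim_incr//.
have /andP[hb11 _] := hb1; have /andP[hb21 _] := hb2.
have C0 : 0 <= C * (d - c) ^+ n.+1.
  by apply: le_trans (normr_ge0 _) (CE c _); rewrite lexx.
apply: (le_trans (wincr_bound (clamp_itv alpha cy) bmin0 hb11 hb21 dP' _)).
  by move=> z /andP[cz zy]; apply: CE; rewrite cz (le_trans zy).
rewrite ler_pM2r ?invr_gt0// [_ ^+ n.+2]exprSr mulrA ler_wpM2l//; lra.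
Qed.

Lemma integrable_oo (v : R -> R) c d : mu.-integrable `[c, d] (EFin \o v) ->
  mu.-integrable `]c, d[ (EFin \o v).
Proof. by move=> iv; apply: integrableS iv => //; exact: subset_itv_oo_cc. Qed.

Lemma in_L2 (I : set R) (v : R -> R) : measurable I -> measurable_fun I v ->
  mu.-integrable I (EFin \o (fun t => v t ^+ 2)) -> in_Lq I 2%:E v.
Proof.
move=> mI mv /integrableP[_ iv2]; split => //.
rewrite /LnormOn unlock; apply: poweR_lty.
rewrite (_ : integral _ _ _ = (\int[mu]_(t in I) `|(EFin \o (fun t => (v t ^+ 2)%R)) t|)%E)//.
rewrite [RHS]integral_mkcond; apply: eq_integral => t _ /=.
rewrite !patchE; case: ifPn => _ /=.
  by rewrite powR_mulrn// normrX.
by rewrite normr0 powR0.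
Qed.

End Element.

(** * Transport from the reference element *)

Section ReferenceMaps.
Variable R : realType.
Implicit Types (c d y : R) (s Q Lam : {poly R}).

(* The affine bijections between the reference element (-1, 1) and (c, d). *)
Definition from_ref c d : {poly R} := ((d - c) / 2) *: 'X + ((c + d) / 2)%:P.
Definition to_refp c d : {poly R} := (2 / (d - c)) *: 'X - ((c + d) / (d - c))%:P.

Section Maps.
Variables (c d : R).
Hypothesis cd : c < d.

Let dc0 : d - c != 0. Proof. by rewrite subr_eq0 gt_eqF. Qed.

Lemma to_refpE_cd y : (to_refp c d).[y] = (2 * y - c - d) / (d - c).
Proof. by rewrite /to_refp hornerD hornerN hornerZ hornerX hornerC; field. Qed.

Lemma from_refK_cd y : (from_ref c d).[(2 * y - c - d) / (d - c)] = y.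
Proof. by rewrite /from_ref hornerD hornerZ hornerX hornerC; field. Qed.

Lemma from_ref1 : (from_ref c d).[1] = d.
Proof. by rewrite /from_ref hornerD hornerZ hornerX hornerC; field. Qed.

Lemma from_refN1 : (from_ref c d).[-1] = c.
Proof. by rewrite /from_ref hornerD hornerZ hornerX hornerC; field. Qed.

Lemma size_from_ref : size (from_ref c d) = 2%N.
Proof.
have n0 : (d - c) / 2 != 0 by rewrite mulf_neq0// invr_eq0 pnatr_eq0.
rewrite /from_ref -mul_polyC size_MXaddC polyC_eq0 (negPf n0)/=.
by rewrite size_polyC n0.
Qed.

Lemma size_to_refp : size (to_refp c d) = 2%N.
Proof.
have n0 : 2 / (d - c) != 0 by rewrite mulf_neq0// ?invr_eq0 ?pnatr_eq0.
rewrite /to_refp -polyCN -mul_polyC size_MXaddC polyC_eq0 (negPf n0)/=.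
by rewrite size_polyC n0.
Qed.

Lemma to_refp_from_ref : to_refp c d \Po from_ref c d = 'X.
Proof.
rewrite /to_refp /from_ref comp_polyB comp_polyZ comp_polyX comp_polyC scalerDr scalerA.
have -> : 2 / (d - c) * ((d - c) / 2) = 1 by field.
rewrite scale1r -mul_polyC -polyCM -addrA -polyCB.
have -> : 2 / (d - c) * ((c + d) / 2) - (c + d) / (d - c) = 0 by field.
by rewrite polyC0 addr0.
Qed.

Lemma deriv_comp_from_ref (p0 s Q : {poly R}) : Q^`() = (p0 \Po to_refp c d) * s ->
  ((2 / (d - c)) *: (Q \Po from_ref c d))^`() = p0 * (s \Po from_ref c d).
Proof.
move=> dQ; rewrite derivZ deriv_comp dQ comp_polyM -comp_polyA to_refp_from_ref comp_polyXr.
have -> : (from_ref c d)^`() = ((d - c) / 2)%:P.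
  by rewrite /from_ref derivD derivZ derivX derivC addr0 alg_polyC.
rewrite [_ * _%:P]mulrC mul_polyC scalerA.
have -> : 2 / (d - c) * ((d - c) / 2) = 1 by field.
by rewrite scale1r.
Qed.

Lemma size_legendre_comp n : size (legendre R n \Po to_refp c d) = n.+1.
Proof. by rewrite size_comp_poly2 ?size_legendre// size_to_refp. Qed.

Lemma legendre_comp_orthogonal n s Q : (size s <= n)%N ->
  Q^`() = (legendre R n \Po to_refp c d) * s -> Q.[d] = Q.[c].
Proof.
move=> sn /deriv_comp_from_ref /legendre_orthogonal.
rewrite size_comp_poly2 ?size_from_ref// => /(_ sn).
rewrite !hornerZ !horner_comp from_ref1 from_refN1 => /(mulfI _); apply.
by rewrite mulf_neq0// ?invr_eq0 ?pnatr_eq0.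
Qed.

(** The Lobatto polynomial is the primitive of a Legendre polynomial vanishing at -1. At its roots
    every primitive returns to its value at the left end, as [element_estimate] requires. *)
Lemma lobatto_comp n Lam y : (0 < n)%N -> Lam^`() = legendre R n \Po to_refp c d ->
  c <= y <= d -> lobatto n.+1 ((2 * y - c - d) / (d - c)) = 0 -> Lam.[y] = Lam.[c].
Proof.
move=> n0 dL /andP[cy yd]; rewrite /lobatto; case: n n0 dL => // n _ dL.
have h1 : -1 <= (2 * y - c - d) / (d - c).
  by rewrite ler_pdivlMr ?subr_gt0//; lra.
set La := (2 / (d - c)) *: (Lam \Po from_ref c d).
have dLa : La^`() = legendre R n.+1.
  by rewrite /La (@deriv_comp_from_ref (legendre R n.+1) 1) ?mulr1// comp_polyC mulr1.
have hor z : is_derive z (1:R) (horner La) (legendre R n.+1).[z].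
  by rewrite -dLa; exact: horner_is_derive.
rewrite (integral_on_cc (integral_on_deriv h1 (@continuous_horner_fun _ La) (@continuous_horner_fun _ (legendre R n.+1)) (fun z _ => hor z) (fun z _ => erefl))).
rewrite /La !hornerZ !horner_comp from_refN1 from_refK_cd -mulrBr => /eqP.
by rewrite !mulf_eq0 invr_eq0 (negPf dc0) pnatr_eq0/= subr_eq0 => /eqP.
Qed.

End Maps.
End ReferenceMaps.

(** * The discrete space and its test functions *)

Section Mesh.
Variable R : realType.
Variables (p N k : nat) (a b alpha bm bp : R) (x : nat -> R).
Variables (L : nat -> {poly R}) (phi : nat -> R -> R).
Hypotheses (p0 : (0 < p)%N) (aab : a < alpha < b) (bm0 : 0 < bm) (bp0 : 0 < bp).
Hypothesis hmesh : is_mesh a b alpha N k x.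
Hypothesis hL : gen_legendre (to_ref x k alpha) bm bp L.
Hypothesis hphi : gen_lobatto (to_ref x k alpha) bm bp L phi.
Implicit Types (y t : R) (v f u uh : R -> R) (q s Q : {poly R}) (i j : nat).
Local Notation mu := (@lebesgue_measure R).
Local Notation W := (wprim alpha bm bp).

Let x0E : x 0%N = a. Proof. by case: hmesh. Qed.
Let xNE : x N = b. Proof. by case: hmesh. Qed.
Let xlt i : (i < N)%N -> x i < x i.+1. Proof. by case: hmesh => _ _ h _ _; exact: h. Qed.
Let kN : (1 <= k <= N)%N. Proof. by case: hmesh. Qed.
Let xk : x k.-1 <= alpha <= x k. Proof. by case: hmesh. Qed.
Let bm_neq0 : bm != 0. Proof. by rewrite gt_eqF. Qed.
Let bp_neq0 : bp != 0. Proof. by rewrite gt_eqF. Qed.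

Lemma mesh_le i j : (i <= j <= N)%N -> x i <= x j.
Proof.
elim: j => [|j ih]; first by rewrite leqn0 => /andP[/eqP -> _].
move=> /andP[]; rewrite leq_eqVlt => /predU1P[->//|ij jN].
by apply: (@le_trans _ _ (x j)); [apply: ih; rewrite -ltnS ij ltnW|exact/ltW/xlt].
Qed.

Lemma mesh_pred_lt i : (1 <= i <= N)%N -> x i.-1 < x i.
Proof. by case: i => // i /= iN; exact: xlt. Qed.

Lemma mesh_sub i y : (1 <= i <= N)%N -> x i.-1 <= y <= x i -> a <= y <= b.
Proof.
move=> /andP[i1 iN] /andP[h1 h2]; rewrite -x0E -xNE; apply/andP; split.
  by apply: le_trans h1; apply: mesh_le; rewrite /= (leq_trans (leq_pred _)).
by apply: (le_trans h2); apply: mesh_le; rewrite iN leqnn.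
Qed.

Lemma mesh_side i : (1 <= i <= N)%N -> i != k -> x i <= alpha \/ alpha <= x i.-1.
Proof.
move=> /andP[i1 iN]; have /andP[k1 kN'] := kN; have /andP[h1 h2] := xk.
rewrite neq_ltn => /orP[ik|ki]; [left|right].
  apply: le_trans h1; apply: mesh_le.
  by rewrite -ltnS prednK// ik (leq_trans (leq_pred _)).
apply: (le_trans h2); apply: mesh_le.
by rewrite -ltnS prednK// ki (leq_trans (leq_pred _)).
Qed.

Let hk : 0 < mesh_step x k.
Proof. by rewrite /mesh_step subr_gt0; exact: mesh_pred_lt. Qed.

Local Notation from_refk := (from_ref (x k.-1) (x k)).
Local Notation to_refk := (to_refp (x k.-1) (x k)).
Let xklt : x k.-1 < x k. Proof. exact: mesh_pred_lt. Qed.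

Lemma to_refpE y : to_refk.[y] = to_ref x k y.
Proof. exact: to_refpE_cd. Qed.

Lemma from_refK y : from_refk.[to_ref x k y] = y.
Proof. exact: from_refK_cd. Qed.

Lemma to_ref_le y z : y <= z -> to_ref x k y <= to_ref x k z.
Proof.
move=> yz; rewrite /to_ref ler_pM2r ?invr_gt0//; lra.
Qed.

Lemma to_ref_itv y : x k.-1 <= y <= x k -> -1 <= to_ref x k y <= 1.
Proof.
move=> /andP[h1 h2]; rewrite /to_ref ler_pdivlMr// ler_pdivrMr// /mesh_step; lra.
Qed.

Let ahI : -1 <= to_ref x k alpha <= 1. Proof. exact: to_ref_itv. Qed.

(** An increasing map commutes with [min] and [max], so the split at [alpha] becomes the split at
    its image. *)
Lemma wprim_to_ref (P : R -> R) y :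
  wprim (to_ref x k alpha) bm bp P (to_ref x k y) = W (fun z => P (to_ref x k z)) y.
Proof.
rewrite /wprim; have [ya|ay] := leP y alpha.
  by rewrite !min_l ?to_ref_le// !max_r// to_ref_le.
by rewrite !min_r ?to_ref_le ?(ltW ay)// !max_l// to_ref_le ?ltW.
Qed.

Lemma wprim_comp_to_ref Q y :
  wprim (to_ref x k alpha) bm bp (horner Q) (to_ref x k y) = W (horner (Q \Po to_refk)) y.
Proof. by rewrite wprim_to_ref /wprim !horner_comp !to_refpE. Qed.

Lemma wprim_comp_from_ref Q y :
  W (horner Q) y = wprim (to_ref x k alpha) bm bp (horner (Q \Po from_refk)) (to_ref x k y).
Proof. by rewrite wprim_to_ref /wprim !horner_comp !from_refK. Qed.

Lemma wprim_left_poly Q y : y <= alpha -> W (horner Q) y = (bm^-1 *: Q).[y].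
Proof. by move=> ya; rewrite wprim_left// hornerZ mulrC. Qed.

Lemma wprim_right_poly Q y : alpha <= y ->
  W (horner Q) y = (bp^-1 *: Q + (Q.[alpha] / bm - Q.[alpha] / bp)%:P).[y].
Proof. by move=> ay; rewrite wprim_right// hornerD hornerZ hornerC; ring. Qed.

(** The constant is forced at [alpha]: there [W] still divides by [bm], so the polynomial must take
    the value [bm * r.[alpha]]. *)
Lemma poly_wprim_right r y : alpha <= y ->
  (r : {poly R}).[y] = W (horner (bp *: r + ((bm - bp) * r.[alpha])%:P)) y.
Proof.
by move=> ay; rewrite wprim_right// !hornerD !hornerZ !hornerC; field; rewrite ?bm_neq0 ?bp_neq0.
Qed.

Lemma size_scaleC_le (c e : R) Q n : (0 < n)%N -> (size Q <= n)%N -> (size (c *: Q + e%:P)%R <= n)%N.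
Proof.
move=> n0 sQ; rewrite (leq_trans (size_polyD _ _))// geq_max (leq_trans (size_scale_leq _ _))//=.
exact: leq_trans (size_polyC_leq1 _) _.
Qed.

(** Uniform description of the discrete space: on each element, interface or not, a discrete
    function is [W] of a polynomial, whose derivative is the discrete flux. *)
Definition local_wprim v (Q : nat -> {poly R}) :=
  forall i, (1 <= i <= N)%N -> (size (Q i) <= p.+1)%N /\
    forall y, x i.-1 <= y <= x i -> v y = W (horner (Q i)) y.

Lemma ife_space_local v : ife_space a b N k x p phi v -> exists Q : nat -> {poly R}, local_wprim v Q.
Proof.
move=> [[_ cv _ _] hni [e he]].
suff h i : exists Q : {poly R}, (1 <= i <= N)%N -> (size Q <= p.+1)%N /\
    forall y, x i.-1 <= y <= x i -> v y = W (horner Q) y.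
  by exists (fun i => projT1 (cid (h i))) => i iN; case: (cid (h i)) => Q /= hQ; exact: hQ.
have [iN|] := boolP (1 <= i <= N)%N; last by exists 0.
have xi := mesh_pred_lt iN.
have ext Q : (forall y, x i.-1 < y < x i -> v y = W (horner Q) y) ->
    forall y, x i.-1 <= y <= x i -> v y = W (horner Q) y.
  apply: (eq_within_cc xi).
    apply: continuous_subspaceW cv => y /=; rewrite !in_itv/=; exact: mesh_sub.
  exact/continuous_subspaceT/continuous_wprim/continuous_horner_fun.
have [ik|ik] := eqVneq i k.
  have [Q sQ hQ] := gen_lobatto_span_wprim bm0 bp0 ahI hL hphi e p0.
  exists (Q \Po to_refk) => _; split; first by rewrite size_comp_poly2// size_to_refp.
  apply: ext => y; rewrite ik => yI; rewrite he//.
  rewrite -wprim_comp_to_ref -hQ//.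
  by apply: to_ref_itv; case/andP: yI => h1 h2; rewrite !ltW.
have [r sr hr] := hni i iN ik.
have [xa|ax] := mesh_side iN ik.
  exists (bm *: r) => _; split; first by rewrite (leq_trans (size_scale_leq _ _)).
  apply: ext => y yI; rewrite hr// wprim_left_poly.
    by rewrite scalerA mulVf// scale1r.
  by case/andP: yI => _ h; rewrite (le_trans (ltW h)).
exists (bp *: r + ((bm - bp) * r.[alpha])%:P) => _; split; first exact: size_scaleC_le.
apply: ext => y yI; rewrite hr// poly_wprim_right//.
by case/andP: yI => h _; rewrite (le_trans ax)// ltW.
Qed.

Lemma local_wprim_ife v (Q : nat -> {poly R}) : H10 a b v -> local_wprim v Q -> ife_space a b N k x p phi v.
Proof.
move=> hv lv; split => //.
  move=> i iN ik; have [sQ hQ] := lv i iN; have [xa|ax] := mesh_side iN ik.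
    exists (bm^-1 *: Q i); first by rewrite (leq_trans (size_scale_leq _ _)).
    move=> y /andP[h1 h2]; rewrite hQ; last by rewrite (ltW h1) ltW.
    by rewrite wprim_left_poly// (le_trans (ltW h2)).
  exists (bp^-1 *: Q i + ((Q i).[alpha] / bm - (Q i).[alpha] / bp)%:P); first exact: size_scaleC_le.
  move=> y /andP[h1 h2]; rewrite hQ; last by rewrite (ltW h1) ltW.
  by rewrite wprim_right_poly// (le_trans ax)// ltW.
have [sQ hQ] := lv k kN.
have sQ' : (size (Q k \Po from_refk) <= p.-1.+2)%N by rewrite size_comp_poly2 ?size_from_ref// prednK.
have [e he] := wprim_gen_lobatto_span bm0 bp0 ahI hL hphi sQ'.
exists e => y /andP[h1 h2].
have yI : x k.-1 <= y <= x k by rewrite !ltW.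
by rewrite hQ// wprim_comp_from_ref he ?to_ref_itv// prednK.
Qed.

Lemma local_wprim_is_derive v (Q : nat -> {poly R}) i y : local_wprim v Q -> (i < N)%N -> x i < y < x i.+1 ->
  y != alpha -> is_derive y (1:R) v (((Q i.+1)^`()).[y] / pw alpha bm bp y).
Proof.
move=> lv iN yI ya; have [_ hQ] := lv i.+1 iN.
apply: (is_derive_itvoo yI (g := W (horner (Q i.+1)))).
  by move=> z /andP[h1 h2]; apply: hQ; rewrite /= !ltW.
by apply: is_derive_wprim => //; exact: horner_is_derive.
Qed.

Lemma integral_on_ab G (F : nat -> R) :
  (forall i, (i < N)%N -> integral_on G (x i) (x i.+1) (F i.+1 - F i)) ->
  integral_on G a b (F N - F 0%N).
Proof.
move=> h; have [_] := integral_on_mesh xlt h (leqnn N).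
by rewrite x0E xNE.
Qed.

(** The classical derivative, known inside elements off [alpha], is the weak one: integrating the
    derivative of [v * chi] element by element telescopes by continuity, and the end terms vanish
    with [v]. *)
Lemma H10_local v (Q : nat -> {poly R}) : continuous v -> v a = 0 -> v b = 0 -> local_wprim v Q -> H10 a b v.
Proof.
move=> cv va vb lv.
have /andP[aal alb] := aab; have ab := lt_trans aal alb.
have dv := local_wprim_is_derive lv.
have [idv _] : integral_on (derive1 v) a b (v (x N) - v (x 0%N)).
  apply: (integral_on_ab (F := fun i => v (x i))) => i iN; have [_ hQ] := lv i.+1 iN.
  have xi := ltW (xlt iN).
  rewrite !hQ /= ?lexx ?xi//.
  apply: (integral_on_wprim xi (phi := horner (Q i.+1)^`())).
  - exact: continuous_horner_fun.
  - by move=> y yI ya; apply: derive1_is_derive; exact: dv.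
have idv2 : mu.-integrable `]a, b[ (EFin \o (fun t => derive1 v t ^+ 2)).
  pose P i := projT1 (cid2 (poly_primitive ((Q i)^`() ^+ 2))).
  have dP i : (P i)^`() = (Q i)^`() ^+ 2 by rewrite /P; case: cid2.
  (* The squared derivative is [(Q')^2 / beta^2], hence the squared coefficients. The [V i] need not
     agree at mesh points, so [F] sums their increments. *)
  pose V i := wprim alpha (bm ^+ 2) (bp ^+ 2) (horner (P i)).
  pose F n := \sum_(0 <= i < n) (V i.+1 (x i.+1) - V i.+1 (x i)).
  have [//] : integral_on (fun t => derive1 v t ^+ 2) a b (F N - F 0%N).
  apply: integral_on_ab => i iN; rewrite /F big_nat_recr//= addrAC subrr add0r.
  apply: (integral_on_wprim (ltW (xlt iN)) (phi := horner ((Q i.+1)^`() ^+ 2))).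
  - by move=> y; rewrite -dP; exact: horner_is_derive.
  - exact: continuous_horner_fun.
  - move=> y yI ya; rewrite (derive1_is_derive (dv _ _ iN yI ya)) horner_exp exprMn exprVn.
    by rewrite /pw; case: ifP.
have iv : mu.-integrable `]a, b[ (EFin \o v).
  apply: integrable_oo.
  apply: continuous_compact_integrable; first exact: segment_compact.
  exact: continuous_subspaceT.
have iv2 : mu.-integrable `]a, b[ (EFin \o (fun t => v t ^+ 2)).
  apply: integrable_oo.
  apply: continuous_compact_integrable; first exact: segment_compact.
  by apply: continuous_subspaceT => t; apply: cvgM; exact: cv.
have mint (g : R -> R) : mu.-integrable `]a, b[ (EFin \o g) -> measurable_fun `]a, b[ g.
  by move=> /integrableP[/measurable_EFinP].
split => //; last exact: continuous_subspaceT.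
split; first by apply: in_L2 => //; exact: mint.
exists (derive1 v); last by split => //; apply: in_L2 => //; exact: mint.
split; [by apply: open_integrable_locally => //; exact: interval_open| |].
  by apply: open_integrable_locally => //; exact: interval_open.
move=> chi [dchi cdchi _ suppchi].
have dchi' y : is_derive y (1:R) chi (derive1 chi y).
  by apply: DeriveDef; [exact: dchi|rewrite derive1E].
have cchi : continuous chi := derivable_continuous dchi'.
have chi0 y : ~ (a < y < b) -> chi y = 0.
  move=> h; apply/eqP; apply: contra_notT h => cy.
  have /suppchi : closure [set x | chi x != 0] y by exact: subset_closure.
  by rewrite /= in_itv.
have i1 : mu.-integrable `]a, b[ (EFin \o (fun t => v t * derive1 chi t)).
  apply: integrable_oo.
  exact: integrable_mul_continuous (integrable_itv_cc iv) cdchi.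
have i2 : mu.-integrable `]a, b[ (EFin \o (fun t => derive1 v t * chi t)).
  apply: integrable_oo.
  exact: integrable_mul_continuous (integrable_itv_cc idv) cchi.
apply/eqP; rewrite -addr_eq0 -RintegralD//.
have [_ ->] : integral_on (fun t => v t * derive1 chi t + derive1 v t * chi t) a b
   (v (x N) * chi (x N) - v (x 0%N) * chi (x 0%N)).
  apply: (integral_on_ab (F := fun i => v (x i) * chi (x i))) => i iN.
  have cvchi : continuous (fun t => v t * chi t) by move=> t; apply: cvgM; [exact: cv|exact: cchi].
  have ci (c : R) : continuous (fun t => v t * derive1 chi t + ((Q i.+1)^`()).[t] / c * chi t).
    move=> t; apply: cvgD; first by apply: cvgM; [exact: cv|exact: cdchi].
    apply: cvgM; last exact: cchi.
    by apply: cvgM; [exact: continuous_horner_fun|exact: cvg_cst].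
  have xi := ltW (xlt iN); have cmd := clamp_itv alpha xi; have /andP[cm md] := cmd.
  have key y : x i < y < x i.+1 -> y != alpha ->
      is_derive y (1:R) (fun t => v t * chi t)
        (v y * derive1 chi y + ((Q i.+1)^`()).[y] / pw alpha bm bp y * chi y) /\
      v y * derive1 chi y + derive1 v y * chi y =
        v y * derive1 chi y + ((Q i.+1)^`()).[y] / pw alpha bm bp y * chi y.
    move=> yI ya; have h := dv _ _ iN yI ya; split; last by rewrite (derive1_is_derive h).
    have := is_deriveM h (dchi' y); rewrite /GRing.scale/=.
    by rewrite [chi y * _]mulrC.
  apply: (integral_on_deriv2 cmd cvchi (ci bm) (ci bp)) => y /andP[h1 h2].
    have ya := clamp_lt h1 h2.
    have := key y; rewrite /pw ya; apply; last by rewrite lt_eqF.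
    by rewrite h1 (lt_le_trans h2).
  have ya := clamp_gt h2 h1.
  have yna : (y < alpha) = false by rewrite ltNge ltW.
  have := key y; rewrite /pw yna; apply; last by rewrite gt_eqF.
  by rewrite h2 (le_lt_trans cm).
by rewrite x0E xNE va vb !mul0r subrr.
Qed.

(* W Q on element j extended by constants, corrected by a multiple of W X so as
   to vanish at b when kap is chosen suitably. *)
Definition bubble j Q (kap : R) y : R :=
  W (horner Q) (clamp (x j.-1) (x j) y) - W (horner Q) (x j.-1) -
  kap * (W (horner 'X) y - W (horner 'X) a).

Lemma continuous_bubble j Q kap : continuous (bubble j Q kap).
Proof.
have cW (P : {poly R}) : continuous (W (horner P)).
  exact/continuous_wprim/continuous_horner_fun.
move=> y; apply: cvgB; first apply: cvgB; last first.
- by apply: cvgM; [exact: cvg_cst|apply: cvgB; [exact: cW|exact: cvg_cst]].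
- exact: cvg_cst.
- by apply: (@cvg_comp _ _ _ _ (W (horner Q)) _ (nbhs (clamp (x j.-1) (x j) y))); [exact: continuous_clamp|exact: cW].
Qed.

Lemma bubble_local j Q kap : (1 <= j <= N)%N -> (size Q <= p.+1)%N ->
  exists2 Q' : nat -> {poly R}, local_wprim (bubble j Q kap) Q' &
    forall i, (Q' i)^`() = (i == j)%:R *: Q^`() - kap%:P.
Proof.
move=> jN sQ; have xj := ltW (mesh_pred_lt jN).
(* On either side of element [j] the clamped term is constant; [K i] collects all constants present
   on element [i]. *)
pose K i := (if (i == j)%N then 0 else W (horner Q) (if (i < j)%N then x j.-1 else x j))
   - W (horner Q) (x j.-1) + kap * W (horner 'X) a.
exists (fun i => (i == j)%:R *: Q - kap *: 'X + (bm * K i)%:P) => [i iN|i]; last first.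
  by rewrite derivD derivB !derivZ derivX derivC addr0 alg_polyC.
split.
  rewrite (leq_trans (size_polyD _ _))// geq_max (leq_trans (size_polyC_leq1 _))// andbT.
  rewrite (leq_trans (size_polyD _ _))// geq_max size_polyN.
  rewrite (leq_trans (size_scale_leq _ _))//=.
  by rewrite (leq_trans (size_scale_leq _ _))// size_polyX ltnS.
move=> y /andP[h1 h2].
have -> : W (horner ((i == j)%:R *: Q - kap *: 'X + (bm * K i)%:P)) y =
    (i == j)%:R * W (horner Q) y - kap * W (horner 'X) y + K i.
  rewrite !wprimD wprimC -scaleNr !wprimZ mulNr [bm * _]mulrC mulfK//.
rewrite /bubble /K; have [ij|ij] := eqVneq i j.
  have -> : (true%:R : R) = 1 by [].
  by rewrite -ij clamp_id ?h1//; ring.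
have -> : (false%:R : R) = 0 by [].
have /andP[j1 jN'] := jN; have /andP[i1 iN'] := iN.
case: ltnP => [lij|lji].
  rewrite clamp_le//; first by ring.
  apply: (le_trans h2); apply: mesh_le.
  by rewrite -ltnS prednK// lij (leq_trans (leq_pred _)).
rewrite clamp_ge//; first by ring.
apply: le_trans h1; apply: mesh_le.
by rewrite -ltnS prednK// ltn_neqAle eq_sym ij lji (leq_trans (leq_pred _)).
Qed.

Let WXab : W (horner 'X) b - W (horner 'X) a != 0.
Proof.
have /andP[aal alb] := aab.
rewrite wprim_right ?(ltW alb)// wprim_left ?(ltW aal)// !hornerX gt_eqF//.
have h1 : 0 < bm^-1 by rewrite invr_gt0.
have h2 : 0 < bp^-1 by rewrite invr_gt0.
nra.
Qed.

Lemma bubble_ife j Q : (1 <= j <= N)%N -> (size Q <= p.+1)%N ->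
  exists kap, exists2 Q' : nat -> {poly R}, local_wprim (bubble j Q kap) Q' &
    [/\ forall i, (Q' i)^`() = (i == j)%:R *: Q^`() - kap%:P,
        ife_space a b N k x p phi (bubble j Q kap),
        bubble j Q kap a = 0 & bubble j Q kap b = 0].
Proof.
move=> jN sQ; have xj := mesh_pred_lt jN.
(* Chosen to make the value at [b] vanish; the denominator is the integral of [1 / beta] over the
   domain. *)
pose kap := (W (horner Q) (x j) - W (horner Q) (x j.-1)) / (W (horner 'X) b - W (horner 'X) a).
have [Q' lQ dQ'] := bubble_local kap jN sQ.
exists kap; exists Q' => //.
have /andP[h1 _] : a <= x j.-1 <= b by apply: (mesh_sub jN); rewrite lexx ltW.
have /andP[_ h2] : a <= x j <= b by apply: (mesh_sub jN); rewrite lexx ltW.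
have va : bubble j Q kap a = 0.
  by rewrite /bubble clamp_le ?(ltW xj)// !subrr mulr0 subr0.
have vb : bubble j Q kap b = 0.
  by rewrite /bubble clamp_ge ?(ltW xj)// /kap divfK ?WXab// subrr.
split => //; apply: (local_wprim_ife _ lQ).
by apply: (H10_local _ va vb lQ); exact: continuous_bubble.
Qed.

Lemma constant_of_derive0 (P G : R -> R) (g : R -> R) :
  (forall y, is_derive y (1:R) P (g y)) -> (forall y, is_derive y (1:R) G (g y)) ->
  exists c, forall y, P y = G y + c.
Proof.
move=> dP dG; exists (P 0 - G 0) => y.
have dPG z : is_derive z (1:R) (fun z => P z - G z) 0.
  by have := is_deriveB (dP z) (dG z); rewrite subrr.
have key (y1 y2 : R) : y1 <= y2 -> P y2 - G y2 = P y1 - G y1.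
  move=> uv; have [z _] := mean_value uv (derivable_continuous dPG) (fun z _ => dPG z).
  by rewrite mul0r => /eqP; rewrite subr_eq0 => /eqP.
have [y0|y0] := leP 0 y; first by rewrite -(key _ _ y0); ring.
by rewrite (key _ _ (ltW y0)); ring.
Qed.

Lemma wprim_shift (P G : R -> R) c y z : (forall y, P y = G y + c) ->
  W P y - W P z = W G y - W G z.
Proof. by move=> h; rewrite /wprim !h; ring. Qed.

(** * Galerkin orthogonality and exactness at the nodes *)

Section Galerkin.
Variables (u f uh S0 S1 : R -> R) (Q : nat -> {poly R}).
Hypotheses (cS1 : continuous S1) (dS0 : forall y, is_derive y (1:R) S0 (S1 y)).
Hypotheses (cu : {within `[a, b], continuous u}) (ua : u a = 0) (ub : u b = 0).
Hypothesis du : forall y, a < y < b -> y != alpha -> is_derive y (1:R) u (S0 y / pw alpha bm bp y).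
Hypothesis fE : forall y, a < y < b -> y != alpha -> f y = - S1 y.
Hypothesis huh : ife_solution a b alpha bm bp N k x p phi f uh.
Hypothesis lQ : local_wprim uh Q.

Let cS0 : continuous S0. Proof. exact: derivable_continuous dS0. Qed.

Lemma solution_wprim (P : R -> R) y : (forall y, is_derive y (1:R) P (S0 y)) ->
  a <= y <= b -> u y = W P y - W P a.
Proof.
move=> dP /andP[ay yb]; have /andP[aal alb] := aab.
have cP : continuous (W P) by apply: continuous_wprim; exact: derivable_continuous dP.
have key c d : a <= c -> c <= d -> d <= b -> (forall z, c < z < d -> z != alpha) ->
    forall z, c <= z <= d -> u z - W P z = u c - W P c.
  move=> ac cd db nal; apply: (eq_deriv_within_cc (g := fun z => S0 z / pw alpha bm bp z) cd).
  - apply: continuous_subspaceW cu; apply: subset_itv; rewrite bnd_simp//.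
  - exact: continuous_subspaceT.
  - move=> z zI; have /andP[cz zd] := zI.
    have zab : a < z < b by rewrite (le_lt_trans ac)// (lt_le_trans zd).
    by split; [apply: du => //; exact: nal|apply: is_derive_wprim => //; exact: nal].
have left_ z : a <= z <= alpha -> u z - W P z = u a - W P a.
  apply: (key a alpha) => //; [exact: ltW|exact: ltW|].
  by move=> w /andP[_ h]; rewrite lt_eqF.
have [yal|aly] := leP y alpha.
  by have := left_ y; rewrite ay yal => /(_ isT); rewrite ua; lra.
have := left_ alpha; rewrite lexx ltW// => /(_ isT).
have : u y - W P y = u alpha - W P alpha.
  apply: (key alpha b) => //; [exact: ltW|exact: ltW| |].
    by move=> w /andP[h _]; rewrite gt_eqF.
  by rewrite (ltW aly).
rewrite ua; lra.
Qed.

(** Tested with the bubble, both sides of the discrete equation reduce to increments of [W] over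
    element [j]. The correction contributes [kap] times the increments of [uh] and of [u] over the
    whole domain, both zero. *)
Lemma galerkin_orthogonality j s P : (1 <= j <= N)%N -> (size s <= p)%N ->
  (forall y, is_derive y (1:R) P ((S0 y - ((Q j)^`()).[y]) * s.[y])) ->
  W P (x j) = W P (x j.-1).
Proof.
move=> jN ss dP.
have [Qs dQs sQs] := poly_primitive s.
have sQs' : (size Qs <= p.+1)%N by rewrite (leq_trans sQs).
have [kap [Q' lQ' [dQ' vife va vb]]] := bubble_ife jN sQs'.
set V := bubble j Qs kap in lQ' vife va vb.
have [[hu _ uha uhb] gal] : H10 a b uh /\ inner a b (fun y => pw alpha bm bp y * derive1 uh y) (derive1 V) = inner a b f V.
  by case: huh => -[h _ _] /(_ _ vife).
have cV : continuous V by exact: continuous_bubble.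
have [Pi dPi _] := poly_primitive ((Q j)^`() * s).
pose Psi := primitive (fun y => S0 y * s.[y]).
have cS0s : continuous (fun y => S0 y * s.[y]).
  by move=> y; apply: cvgM; [exact: cS0|exact: continuous_horner_fun].
have dPsi y : is_derive y (1:R) Psi (S0 y * s.[y]) by exact: primitive_is_derive.
pose Sig := primitive S0.
have dSig y : is_derive y (1:R) Sig (S0 y) by exact: primitive_is_derive.
have /andP[j1 jN'] := jN.
(* A unit step at node [j]: as a summand of the telescoping [F] below it accounts for the
   contribution of element [j] alone. *)
have jstep i (c : R) : (j <= i.+1)%:R * c - (j <= i)%:R * c = (i.+1 == j)%:R * c.
  rewrite leq_eqVlt eq_sym ltnS; case: (ltngtP j i.+1) => [h|h|->].
  - by rewrite -ltnS h/= subrr mul0r.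
  - by rewrite leqNgt (ltn_trans (ltnSn i) h)/= subrr mul0r.
  - by rewrite ltnn/= mul0r subr0.
have Vab i y : (i < N)%N -> x i < y < x i.+1 -> a < y < b.
  move=> iN /andP[h1 h2]; have := @mesh_sub i.+1 (x i) iN; have := @mesh_sub i.+1 (x i.+1) iN.
  rewrite /= !lexx ltW ?xlt// => /(_ isT)/andP[_ k1] /(_ isT)/andP[k2 _].
  by rewrite (le_lt_trans k2)// (lt_le_trans h2).
have lhs : inner a b (fun y => pw alpha bm bp y * derive1 uh y) (derive1 V) =
    W (horner Pi) (x j) - W (horner Pi) (x j.-1).
  pose F i := (j <= i)%:R * (W (horner Pi) (x j) - W (horner Pi) (x j.-1)) - kap * uh (x i).
  have [_] : integral_on (fun y => pw alpha bm bp y * derive1 uh y * derive1 V y) a b (F N - F 0%N).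
    apply: integral_on_ab => i iN; have xi := ltW (xlt iN).
    have [_ hQ] := @lQ i.+1 iN.
    have -> : F i.+1 - F i = W (horner ((i.+1 == j)%:R *: Pi - kap *: Q i.+1)) (x i.+1) -
        W (horner ((i.+1 == j)%:R *: Pi - kap *: Q i.+1)) (x i).
      rewrite /F !hQ/= ?lexx ?xi// !wprimB !wprimZ.
      have e := jstep i (W (horner Pi) (x j) - W (horner Pi) (x j.-1)).
      case: (eqVneq i.+1 j) e => [ij|_].
        have [-> ->] : x j = x i.+1 /\ x j.-1 = x i by rewrite -ij.
        have -> : (true%:R : R) = 1 by [].
        move: ((j <= i.+1)%N%:R) ((j <= i)%N%:R) => u1 u2 e.
        lra.
      have -> : (false%:R : R) = 0 by [].
      by move: ((j <= i.+1)%N%:R) ((j <= i)%N%:R) => u1 u2 e; lra.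
    apply: (integral_on_wprim xi (phi := horner ((Q i.+1)^`() * (Q' i.+1)^`()))).
    - move=> y; have <- : ((i.+1 == j)%:R *: Pi - kap *: Q i.+1)^`() = (Q i.+1)^`() * (Q' i.+1)^`().
        rewrite derivB !derivZ dPi dQ' dQs mulrBr; congr (_ - _); last by rewrite mulrC mul_polyC.
        by case: eqVneq => [->|_]; rewrite ?scale1r// !scale0r mulr0.
      exact: horner_is_derive.
    - exact: continuous_horner_fun.
    - move=> y yI ya.
      rewrite (derive1_is_derive (local_wprim_is_derive lQ iN yI ya)).
      rewrite (derive1_is_derive (local_wprim_is_derive lQ' iN yI ya)) hornerM.
      have pw0 : pw alpha bm bp y != 0 by rewrite /pw; case: ifP.
      by field.
  rewrite /inner => ->; rewrite /F x0E xNE uha uhb jN' leqn0 eqn0Ngt j1/=; ring.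
have rhs : inner a b f V = W Psi (x j) - W Psi (x j.-1).
  (* The term [- S0 * V] comes from integrating [f V = - S1 V] by parts; it vanishes at both ends
     because [V] does. *)
  pose F i := (j <= i)%:R * (W Psi (x j) - W Psi (x j.-1)) - kap * W Sig (x i) - S0 (x i) * V (x i).
  have [_] : integral_on (fun y => f y * V y) a b (F N - F 0%N).
    apply: integral_on_ab => i iN; have xi := ltW (xlt iN).
    pose e : R := (i.+1 == j)%:R.
    pose P2 y := e * Psi y - kap * Sig y.
    pose H y := W P2 y - S0 y * V y.
    have WP2 y : W P2 y = e * W Psi y - kap * W Sig y by rewrite /wprim /P2; ring.
    have -> : F i.+1 - F i = H (x i.+1) - H (x i).
      rewrite /F /H !WP2.
      have ee := jstep i (W Psi (x j) - W Psi (x j.-1)); rewrite /e.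
      case: (eqVneq i.+1 j) ee => [ij|_].
        have [-> ->] : x j = x i.+1 /\ x j.-1 = x i by rewrite -ij.
        have -> : (true%:R : R) = 1 by [].
        by move: ((j <= i.+1)%N%:R) ((j <= i)%N%:R) => u1 u2 ee; lra.
      have -> : (false%:R : R) = 0 by [].
      by move: ((j <= i.+1)%N%:R) ((j <= i)%N%:R) => u1 u2 ee; lra.
    have dP2 y : is_derive y (1:R) P2 (S0 y * ((Q' i.+1)^`()).[y]).
      have -> : S0 y * ((Q' i.+1)^`()).[y] = e * (S0 y * s.[y]) - kap * S0 y.
        by rewrite dQ' dQs hornerD hornerN hornerZ hornerC /e; ring.
      by apply: is_deriveB; apply: (@is_deriveZ _ _ _ _ _ y).
    have cH : continuous H.
      move=> y; apply: cvgB; first by apply: continuous_wprim; exact: derivable_continuous dP2.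
      by apply: cvgM; [exact: cS0|exact: cV].
    have cG : continuous (fun y => - (S1 y * V y)).
      by move=> y; apply: cvgN; apply: cvgM; [exact: cS1|exact: cV].
    have cmd := clamp_itv alpha xi; have /andP[cm md] := cmd.
    have key y : x i < y < x i.+1 -> y != alpha ->
        is_derive y (1:R) H (- (S1 y * V y)) /\ f y * V y = - (S1 y * V y).
      move=> yI ya; split; last by rewrite fE ?mulNr//; exact: Vab yI.
      have h1 := @is_derive_wprim _ alpha bm bp P2 _ y ya (dP2 y).
      have h2 := is_deriveM (dS0 y) (local_wprim_is_derive lQ' iN yI ya).
      have := is_deriveB h1 h2; rewrite /GRing.scale/= => h3.
      have -> : - (S1 y * V y) = S0 y * ((Q' i.+1)^`()).[y] / pw alpha bm bp y -
         (S0 y * (((Q' i.+1)^`()).[y] / pw alpha bm bp y) + V y * S1 y) by ring.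
      exact: h3.
    apply: (integral_on_deriv2 cmd cH cG cG) => y /andP[h1 h2]; apply: key.
    - by rewrite h1 (lt_le_trans h2).
    - by rewrite lt_eqF// (clamp_lt h1 h2).
    - by rewrite h2 (le_lt_trans cm).
    - by rewrite gt_eqF// (clamp_gt h2 h1).
  rewrite /inner => ->; rewrite /F x0E xNE va vb jN' leqn0 eqn0Ngt j1/=.
  have /andP[aal alb] := aab.
  have := solution_wprim dSig (_ : a <= b <= b); rewrite ub lexx (ltW (lt_trans aal alb)) => /(_ isT) e.
  have -> : W Sig b = W Sig a by lra.
  ring.
rewrite lhs rhs in gal.
have dPP y : is_derive y (1:R) (fun y => Psi y - Pi.[y]) ((S0 y - ((Q j)^`()).[y]) * s.[y]).
  have -> : (S0 y - ((Q j)^`()).[y]) * s.[y] = S0 y * s.[y] - (Pi^`()).[y].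
    by rewrite dPi hornerM mulrBl.
  by apply: is_deriveB; exact: horner_is_derive.
have [c hc] := constant_of_derive0 dP dPP.
have := wprim_shift (x j) (x j.-1) hc.
have WB y : W (fun y => Psi y - Pi.[y]) y = W Psi y - W (horner Pi) y by rewrite /wprim; ring.
by rewrite !WB; lra.
Qed.

Lemma error_wprim i y (P : R -> R) : (1 <= i <= N)%N -> x i.-1 <= y <= x i ->
  (forall y, is_derive y (1:R) P (S0 y - ((Q i)^`()).[y])) ->
  (u y - uh y) - (u (x i.-1) - uh (x i.-1)) = W P y - W P (x i.-1).
Proof.
move=> iN yI dP; have [_ hQ] := lQ iN.
have xI : x i.-1 <= x i.-1 <= x i by rewrite lexx ltW// mesh_pred_lt.
have dSig z : is_derive z (1:R) (primitive S0) (S0 z) by exact: primitive_is_derive.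
rewrite !hQ// (solution_wprim dSig (mesh_sub iN yI)) (solution_wprim dSig (mesh_sub iN xI)).
have dPP z : is_derive z (1:R) (fun z => primitive S0 z - (Q i).[z]) (S0 z - ((Q i)^`()).[z]).
  by apply: is_deriveB; exact: horner_is_derive.
have [c hc] := constant_of_derive0 dP dPP.
have WB z : W (fun y => primitive S0 y - (Q i).[y]) z = W (primitive S0) z - W (horner (Q i)) z.
  by rewrite /wprim; move: (primitive S0 _) (primitive S0 _) (primitive S0 _) => *; ring.
rewrite (wprim_shift _ _ hc) !WB.
by move: (W (primitive S0) _) (W (primitive S0) _) (W (primitive S0) _) => *; ring.
Qed.

Lemma nodal_exactness i : (i <= N)%N -> u (x i) - uh (x i) = 0.
Proof.
have [_ _ uha _] : H10 a b uh by case: huh => -[].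
elim: i => [_|i ih iN]; first by rewrite x0E ua uha subrr.
have xI : x i.+1.-1 <= x i.+1 <= x i.+1 by rewrite lexx ltW// xlt.
have dP y : is_derive y (1:R) (fun y => primitive S0 y - (Q i.+1).[y]) (S0 y - ((Q i.+1)^`()).[y]).
  by apply: is_deriveB; exact: primitive_is_derive.
have := error_wprim (i := i.+1) iN xI dP; rewrite /= ih ?(ltnW iN)// subr0 => ->.
apply/eqP; rewrite subr_eq0; apply/eqP.
(* Orthogonality to the constant 1 says that the weighted integral of the flux error over the
   element, which is the change of [u - uh] between its nodes, is zero. *)
apply: (galerkin_orthogonality (j := i.+1) (s := 1) iN); first by rewrite size_poly1.
by move=> y; rewrite hornerC mulr1; exact: dP.
Qed.

(** * Superconvergence on the two kinds of elements *)

Section Estimates.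
Variables (S : nat -> R -> R) (M : R).
Hypotheses (S0E : S 0%N = S0) (M0 : 0 <= M).
Hypothesis dS : forall j, (j < p)%N -> forall y, is_derive y (1:R) (S j) (S j.+1 y).
Hypothesis lipm : forall y z, y <= z <= alpha -> `|S p z - S p y| <= bm * M * (z - y).
Hypothesis lipp : forall y z, alpha <= y <= z -> `|S p z - S p y| <= bp * M * (z - y).

Let sdQ i : (1 <= i <= N)%N -> (size (Q i)^`() <= p)%N.
Proof.
move=> iN; have [sQ _] := @lQ i iN.
have [->|Q0] := eqVneq (Q i) 0; first by rewrite linear0 size_poly0.
by rewrite -ltnS (leq_trans (lt_size_deriv Q0)).
Qed.

Let dP i y : is_derive y (1:R) (fun y => primitive S0 y - (Q i).[y]) (S0 y - ((Q i)^`()).[y]).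
Proof. by apply: is_deriveB; exact: primitive_is_derive. Qed.

Let errorE i y : (1 <= i <= N)%N -> x i.-1 <= y <= x i ->
  u y - uh y = W (fun y => primitive S0 y - (Q i).[y]) y -
               W (fun y => primitive S0 y - (Q i).[y]) (x i.-1).
Proof.
move=> iN yI; rewrite -(error_wprim iN yI (dP i)) nodal_exactness ?subr0//.
by case/andP: iN => _ iN; rewrite (leq_trans (leq_pred _)).
Qed.

Lemma wprim_same b0 (P : R -> R) y : wprim alpha b0 b0 P y = P y / b0.
Proof.
rewrite /wprim; have [ya|ay] := leP y alpha; last by ring.
by rewrite subrr mul0r addr0.
Qed.

(** The general estimate is applied with both coefficients equal to [b0]: their ratio is 1, and the
    [b0] in the Lipschitz constant cancels when the flux error is divided by [b0]. *)
Lemma one_sided_estimate i (b0 : R) : (1 <= i <= N)%N -> 0 < b0 ->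
  (forall (P : R -> R) y z, x i.-1 <= y <= x i -> x i.-1 <= z <= x i ->
     W P y - W P z = (P y - P z) / b0) ->
  (forall y, x i.-1 < y < x i -> pw alpha bm bp y = b0 /\ y != alpha) ->
  (forall y z, x i.-1 <= y -> y <= z -> z <= x i -> `|S p z - S p y| <= b0 * M * (z - y)) ->
  (forall l, x i.-1 <= l <= x i -> lobatto p.+1 (to_ref x i l) = 0 ->
     `|u l - uh l| <= (1 + stab_const R p) * M * mesh_step x i ^+ (p + 2)) /\
  (forall g, x i.-1 < g < x i -> root (legendre R p) (to_ref x i g) ->
     `|derive1 u g - derive1 uh g| <= (1 + stab_const R p) * M * mesh_step x i ^+ (p + 1)).
Proof.
move=> iN b00 Wb pwb lip; have xi := mesh_pred_lt iN; set c := x i.-1; set d := x i.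
have b0n : b0 != 0 by rewrite gt_eqF.
have bb : b0 <= b0 <= b0 by rewrite lexx.
have cI : x i.-1 <= x i.-1 <= x i by rewrite lexx ltW.
have dI : x i.-1 <= x i <= x i by rewrite lexx ltW.
have W0 (P : R -> R) : wprim alpha b0 b0 P d - wprim alpha b0 b0 P c = W P d - W P c.
  by rewrite !wprim_same -mulrBl -Wb.
have oell s (P : {poly R}) : (size s <= p)%N -> P^`() = (legendre R p \Po to_refp c d) * s ->
    wprim alpha b0 b0 (horner P) d = wprim alpha b0 b0 (horner P) c.
  by move=> ss /(legendre_comp_orthogonal xi ss) e; rewrite !wprim_same e.
have oS s (P : R -> R) : (size s <= p)%N ->
    (forall y, is_derive y (1:R) P ((S 0%N y - ((Q i)^`()).[y]) * s.[y])) ->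
    wprim alpha b0 b0 P d = wprim alpha b0 b0 P c.
  rewrite S0E => ss dPs; apply/eqP; rewrite -subr_eq0 W0 subr_eq0; apply/eqP.
  exact: (galerkin_orthogonality iN ss dPs).
have cS : continuous (S 0%N) by rewrite S0E.
have [] := element_estimate xi b00 bb bb (sdQ iN) (size_legendre_comp xi p) cS dS lip oell oS.
rewrite divff// mulr1 => e1 e2.
have KE X : (1 + stab_const R p) * (b0 * M) * X / b0 = (1 + stab_const R p) * M * X by field.
split=> [l lI hl|g gI hg].
  rewrite (errorE iN lI) Wb// -(KE (mesh_step x i ^+ (p + 2))) addn2.
  have [Lam dLam _] := poly_primitive (legendre R p \Po to_refp c d).
  have := e2 (fun y => primitive S0 y - (Q i).[y]) Lam l.
  rewrite !wprim_same -mulrBl; apply => //.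
  - by move=> y; rewrite S0E.
  - by rewrite (lobatto_comp xi p0 dLam lI hl).
have [pg ga] := pwb g gI; have /andP[h1 h2] := gI.
have gab : a < g < b.
  have /andP[k1 _] := mesh_sub iN cI; have /andP[_ k2] := mesh_sub iN dI.
  by rewrite (le_lt_trans k1)// (lt_le_trans h2).
rewrite (derive1_is_derive (du gab ga)).
have duh : is_derive g (1:R) uh (((Q i)^`()).[g] / pw alpha bm bp g).
  have iN1 : (i.-1 < N)%N by case/andP: iN => k1 k2; rewrite prednK.
  have ii : i.-1.+1 = i by case/andP: iN => k1 k2; rewrite prednK.
  by have := local_wprim_is_derive lQ iN1 (_ : x i.-1 < g < x i.-1.+1) ga; rewrite ii; apply.
rewrite (derive1_is_derive duh) pg -mulrBl normrM normfV (gtr0_norm b00).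
rewrite -(KE (mesh_step x i ^+ (p + 1))) addn1 ler_pM2r ?invr_gt0// -S0E.
apply: e1; first by rewrite !ltW.
by rewrite /root horner_comp to_refpE_cd.
Qed.

Lemma noninterface_estimate i : (1 <= i <= N)%N -> i != k ->
  (forall l, x i.-1 <= l <= x i -> lobatto p.+1 (to_ref x i l) = 0 ->
     `|u l - uh l| <= (1 + stab_const R p) * M * mesh_step x i ^+ (p + 2)) /\
  (forall g, x i.-1 < g < x i -> root (legendre R p) (to_ref x i g) ->
     `|derive1 u g - derive1 uh g| <= (1 + stab_const R p) * M * mesh_step x i ^+ (p + 1)).
Proof.
move=> iN ik; have [xa|ax] := mesh_side iN ik.
  apply: (one_sided_estimate iN bm0).
  - move=> P y z /andP[_ hy] /andP[_ hz].
    by rewrite !wprim_left ?(le_trans hy)// ?(le_trans hz)// mulrBl.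
  - move=> y /andP[_ hy]; have ya := lt_le_trans hy xa.
    by rewrite /pw ya lt_eqF.
  - by move=> y z _ yz zx; apply: lipm; rewrite yz (le_trans zx).
apply: (one_sided_estimate iN bp0).
- move=> P y z /andP[hy _] /andP[hz _].
  by rewrite !wprim_right ?(le_trans ax)//; ring.
- move=> y /andP[hy _]; have ay := le_lt_trans ax hy.
  by rewrite /pw ltNge (ltW ay) gt_eqF.
- by move=> y z hy yz _; apply: lipp; rewrite yz (le_trans ax).
Qed.

(** The limit runs over a punctured neighbourhood: if [g] is [alpha] it is left out, and otherwise
    [alpha] is avoided by shrinking. *)
Lemma has_flux_continuous v (F : R -> R) c d g : c < g < d -> continuous F ->
  (forall y, c < y < d -> y != alpha -> pw alpha bm bp y * derive1 v y = F y) ->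
  has_flux alpha bm bp v g (F g).
Proof.
move=> gI cF h; rewrite /has_flux.
have Fg : F y @[y --> g^'] --> F g by apply: cvg_within_filter; exact: cF.
apply: cvg_trans Fg; apply: near_eq_cvg.
have nI : \forall y \near g, c < y < d by exact: (near_itvoo gI).
have na : \forall y \near g^', y != alpha.
  have [->|ga] := eqVneq g alpha; first exact: nbhs_dnbhs_neq.
  apply: cvg_within; apply: open_nbhs_nbhs; split; last exact: ga.
  exact: open_neq.
near=> y; apply/esym/h; last by near: y.
by near: y; exact: cvg_within nI.
Unshelve. all: by end_near. Qed.

(** The projection costs one factor [bmax / bmin]. For [u - uh], the Lipschitz constant [bmax * M]
    is also divided by [bmin], whence the second [rho]; the flux bound keeps [bmax] instead. *)
Lemma interface_estimate :
  let rho := beta_ratio bm bp in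
  (forall l, x k.-1 <= l <= x k -> phi p.+1 (to_ref x k l) = 0 ->
     `|u l - uh l| <= (1 + stab_const R p * rho) * rho * M * mesh_step x k ^+ (p + 2)) /\
  (forall g, x k.-1 < g < x k -> root (L p) (to_ref x k g) ->
     [/\ has_flux alpha bm bp u g (S0 g), has_flux alpha bm bp uh g ((Q k)^`()).[g] &
     `|S0 g - ((Q k)^`()).[g]| <=
        (1 + stab_const R p * rho) * (Num.max bp bm * M) * mesh_step x k ^+ (p + 1)]).
Proof.
move=> rho; set c := x k.-1; set d := x k.
set bmin := Num.min bp bm; set bmax := Num.max bp bm.
have bmin0 : 0 < bmin by rewrite lt_min bp0.
have hbm : bmin <= bm <= bmax by rewrite ge_min le_max !lexx !orbT.
have hbp : bmin <= bp <= bmax by rewrite ge_min le_max !lexx.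
have /andP[ck kd] := xk; rewrite -/c -/d in ck kd.
have lip y z : c <= y -> y <= z -> z <= d -> `|S p z - S p y| <= bmax * M * (z - y).
  move=> cy yz zd.
  have km t1 t2 : t1 <= t2 -> bm * M * (t2 - t1) <= bmax * M * (t2 - t1).
    move=> t12; rewrite -!mulrA ler_wpM2r ?mulr_ge0 ?subr_ge0//.
    by case/andP: hbm.
  have kp t1 t2 : t1 <= t2 -> bp * M * (t2 - t1) <= bmax * M * (t2 - t1).
    move=> t12; rewrite -!mulrA ler_wpM2r ?mulr_ge0 ?subr_ge0//.
    by case/andP: hbp.
  have [za|az] := leP z alpha; first by rewrite (le_trans (lipm _))// ?yz// km.
  have [ay|ya] := leP alpha y; first by rewrite (le_trans (lipp _))// ?ay// kp.
  rewrite -(subrKA (S p alpha)); apply: (le_trans (ler_normD _ _)).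
  have -> : bmax * M * (z - y) = bmax * M * (z - alpha) + bmax * M * (alpha - y) by ring.
  apply: lerD; first by rewrite (le_trans (lipp _))// ?lexx ?(ltW az)// kp// ltW.
  by rewrite (le_trans (lipm _))// ?lexx ?(ltW ya)// km// ltW.
have cpos : 2 / (d - c) != 0.
  by rewrite mulf_neq0// ?invr_eq0 ?pnatr_eq0// subr_eq0 gt_eqF.
have r1 : to_ref x k d = 1.
  by rewrite /to_ref /mesh_step /d; field; rewrite subr_eq0 gt_eqF.
have rN1 : to_ref x k c = -1.
  by rewrite /to_ref /mesh_step /c; field; rewrite subr_eq0 gt_eqF.
have oell s (P : {poly R}) : (size s <= p)%N -> P^`() = (L p \Po to_refk) * s ->
    W (horner P) d = W (horner P) c.
  move=> ss /(deriv_comp_from_ref xklt) dPr.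
  have ss' : (size (s \Po from_refk) <= p)%N by rewrite size_comp_poly2// size_from_ref.
  have := gen_legendre_orthogonal hL ss' dPr.
  by rewrite !wprimZ => /(mulfI cpos); rewrite !wprim_comp_from_ref r1 rN1.
have sell : size (L p \Po to_refk) = p.+1.
  by rewrite size_comp_poly2 ?size_to_refp//; case: (hL.1 p).
have oS s (P : R -> R) : (size s <= p)%N ->
    (forall y, is_derive y (1:R) P ((S 0%N y - ((Q k)^`()).[y]) * s.[y])) ->
    W P d = W P c.
  by rewrite S0E => ss dPs; exact: (galerkin_orthogonality kN ss dPs).
have cS : continuous (S 0%N) by rewrite S0E.
have [e1 e2] := element_estimate xklt bmin0 hbm hbp (sdQ kN) sell cS dS lip oell oS.
split=> [l lI hl|g gI hg].
  rewrite (errorE kN lI).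
  have [Lam dLam _] := poly_primitive (L p \Po to_refk).
  have -> : (1 + stab_const R p * rho) * rho * M * mesh_step x k ^+ (p + 2) =
     (1 + stab_const R p * (bmax / bmin)) * (bmax * M) * (d - c) ^+ p.+2 / bmin.
    by rewrite addn2 /rho /beta_ratio -/bmax -/bmin /mesh_step -/c -/d; ring.
  apply: (e2 _ Lam l _ dLam lI); first by move=> y; rewrite S0E; exact: dP.
  have dLr : ((2 / (d - c)) *: (Lam \Po from_refk))^`() = L p.+1.-1.
    by rewrite (@deriv_comp_from_ref _ _ _ xklt (L p) 1) ?mulr1// comp_polyC mulr1.
  have lr : -1 <= to_ref x k l <= 1 by exact: to_ref_itv.
  have := gen_lobattoE hphi (_ : (2 <= p.+1)%N) dLr lr; rewrite hl => /(_ p0)/esym/eqP.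
  rewrite subr_eq0 !wprimZ => /eqP/(mulfI cpos).
  by rewrite !wprim_comp_from_ref rN1.
have pw0 y : pw alpha bm bp y != 0 by rewrite /pw; case: ifP.
split.
- apply: (has_flux_continuous gI cS0) => y yI ya.
  have cI : x k.-1 <= x k.-1 <= x k by rewrite lexx ltW.
  have dI : x k.-1 <= x k <= x k by rewrite lexx ltW.
  have /andP[k1 _] := mesh_sub kN cI; have /andP[_ k2] := mesh_sub kN dI.
  have /andP[h1 h2] := yI.
  have yab : a < y < b by rewrite (le_lt_trans k1)// (lt_le_trans h2).
  by rewrite (derive1_is_derive (du yab ya)) mulrCA divff ?mulr1.
- apply: (has_flux_continuous gI (@continuous_horner_fun _ (Q k)^`())) => y yI ya.
  have duh : is_derive y (1:R) uh (((Q k)^`()).[y] / pw alpha bm bp y).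
    have kN1 : (k.-1 < N)%N by case/andP: kN => k1 k2; rewrite prednK.
    have kk : k.-1.+1 = k by case/andP: kN => k1 k2; rewrite prednK.
    by have := local_wprim_is_derive lQ kN1 (_ : x k.-1 < y < x k.-1.+1) ya; rewrite kk; apply.
  by rewrite (derive1_is_derive duh) mulrCA divff ?mulr1.
- rewrite addn1 -S0E; apply: e1.
    by case/andP: gI => h1 h2; rewrite !ltW.
  by rewrite /root horner_comp to_refpE.
Qed.

End Estimates.

End Galerkin.

End Mesh.

(** * From bounds with [M] to bounds with the seminorm *)

Section Conclusion.
Variable R : realType.

Lemma pw_seminorm_ge0 a b alpha m (v : R -> R) : (0 <= pw_seminorm a b alpha m v)%E.
Proof.
rewrite /pw_seminorm le_max; apply/orP; left.
by apply: le_ereal_inf_tmp => _ [g _ <-]; exact: Lnorm_ge0.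
Qed.

(** The family [S] is available only for [M] strictly above the seminorm; letting [M] decrease to it
    gives the stated bounds. *)
Lemma le_mule_of_gt (e c : R) (s : \bar R) : 0 < c -> (0 <= s)%E ->
  (forall M, (s < M%:E)%E -> e <= c * M) -> (e%:E <= c%:E * s)%E.
Proof.
move=> c0; case: s => [s|_ _|//]; last by rewrite gt0_muley ?lte_fin// leey.
move=> _ h; rewrite -EFinM lee_fin; apply/ler_addgt0Pl => t t0.
have := h (s + t / c); rewrite lte_fin ltrDl divr_gt0// mulrDr => /(_ isT).
by rewrite mulrCA divff ?gt_eqF// mulr1 addrC.
Qed.

Lemma mesh_step_le N (x : nat -> R) i : (1 <= i <= N)%N -> mesh_step x i <= mesh_size N x.
Proof.
move=> iN; rewrite /mesh_size; apply: le_bigmax_seq => //.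
by rewrite mem_index_iota ltnS.
Qed.

(** [S], and with it the flux value, is obtained anew for each [M]; uniqueness of limits identifies
    these values, so that one [q] serves all [M]. *)
Lemma has_flux_unique alpha bm bp (v : R -> R) g q q' :
  has_flux alpha bm bp v g q -> has_flux alpha bm bp v g q' -> q = q'.
Proof. by move=> h h'; rewrite -(cvg_lim (@Rhausdorff R) h) (cvg_lim (@Rhausdorff R) h'). Qed.

End Conclusion.

Theorem theorem4p1 (R : realType) (p : nat) (hp : (2 <= p)%N) :
  exists (C : R) (D : R -> R),
  forall (a b alpha bm bp : R) (N k : nat) (x : nat -> R)
    (L : nat -> {poly R}) (phi : nat -> R -> R) (u f uh : R -> R),
  a < alpha < b -> 0 < bm -> 0 < bp ->
  is_mesh a b alpha N k x ->
  gen_legendre (to_ref x k alpha) bm bp L ->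
  gen_lobatto (to_ref x k alpha) bm bp L phi ->
  Wtilde a b alpha bm bp (p + 2) +oo%E u ->
  interface_solution a b alpha bm bp f u ->
  ife_solution a b alpha bm bp N k x p phi f uh ->
  let h := mesh_size N x in
  let rho := beta_ratio bm bp in
  let snorm := pw_seminorm a b alpha (p + 2) u in
  [/\ forall i, (i <= N)%N -> u (x i) - uh (x i) = 0,
      forall i, (1 <= i <= N)%N -> i != k ->
        (forall l, x i.-1 <= l <= x i -> lobatto p.+1 (to_ref x i l) = 0 ->
           (`|u l - uh l|%:E <= (C * h ^+ (p + 2))%:E * snorm)%E) /\
        (forall g, x i.-1 < g < x i -> root (legendre R p) (to_ref x i g) ->
           (`|derive1 u g - derive1 uh g|%:E
              <= (C * h ^+ (p + 1))%:E * snorm)%E) &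
      (forall l, x k.-1 <= l <= x k -> phi p.+1 (to_ref x k l) = 0 ->
         (`|u l - uh l|%:E <= (D rho * h ^+ (p + 2))%:E * snorm)%E) /\
      (forall g, x k.-1 < g < x k -> root (L p) (to_ref x k g) ->
         exists q qh : R,
           [/\ has_flux alpha bm bp u g q, has_flux alpha bm bp uh g qh &
               (`|q - qh|%:E
                  <= (D rho * Num.max bp bm * h ^+ (p + 1))%:E * snorm)%E])].
Proof.
pose K := stab_const R p; have K0 : 0 <= K := stab_const_ge0 R p.
(* One [D] serves both the value and the flux; for the flux its last factor [rho] is slack, as
   [rho >= 1]. *)
exists (1 + K), (fun rho => (1 + K * rho) * rho).
move=> a b alpha bm bp N k x L phi u f uh aab bm0 bp0 hmesh hL hphi hu hsol huh h rho snorm.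
have p0 : (0 < p)%N := ltnW hp.
have snorm0 : (0 <= snorm)%E := pw_seminorm_ge0 _ _ _ _ _.
have [Q lQ] := ife_space_local p0 bm0 bp0 hmesh hL hphi huh.1.
have [cu [sobm sobp] [ua ub] _] := hu.
have reg M := flux_regular p0 aab bm0 bp0 hu hsol (M := M).
(* Here [2 <= p] enters: [S 1] is differentiable, hence continuous. *)
have contS1 (S : nat -> R -> R) : (forall j, (j < p)%N -> forall x, is_derive x (1:R) (S j) (S j.+1 x)) ->
    continuous (S 1%N).
  by move=> dS; apply: derivable_continuous => y; have := dS 1%N hp y => -[].
have M_ge0 M : (snorm < M%:E)%E -> 0 <= M.
  by move=> /(le_lt_trans snorm0); rewrite lte_fin => /ltW.
have [M1 M1s] : exists M, (snorm < M%:E)%E.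
  have : (snorm < +oo)%E.
    by rewrite /snorm /pw_seminorm gt_max !sobolev_seminorm_lty.
  case: snorm snorm0 {M_ge0 reg} => // s _ _; exists (s + 1).
  by rewrite lte_fin ltrDl.
have [_ _ xlt kN _] := hmesh.
have step_gt0 i : (1 <= i <= N)%N -> 0 < mesh_step x i.
  by move=> iN; rewrite /mesh_step subr_gt0; exact: (mesh_pred_lt hmesh iN).
have h0 : 0 < h := lt_le_trans (step_gt0 k kN) (mesh_step_le x kN).
have hn0 n : 0 < h ^+ n by rewrite exprn_gt0.
have hX i n : (1 <= i <= N)%N -> mesh_step x i ^+ n <= h ^+ n.
  by move=> iN; rewrite lerXn2r ?nnegrE ?mesh_step_le// ltW// step_gt0.
have bmin0 : 0 < Num.min bp bm by rewrite lt_min bp0.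
have bmax0 : 0 < Num.max bp bm by rewrite lt_max bp0.
have rho1 : 1 <= rho.
  by rewrite /rho /beta_ratio ler_pdivlMr// mul1r le_max ge_min lexx.
have rho0 : 0 < rho := lt_le_trans ltr01 rho1.
have C0 : 0 < 1 + K by rewrite ltr_wpDr.
have D0' : 0 < 1 + K * rho by rewrite ltr_wpDr// mulr_ge0// ltW.
have D0 : 0 < (1 + K * rho) * rho by rewrite mulr_gt0.
have scale (e c M : R) i n : (1 <= i <= N)%N -> 0 < c -> 0 <= M ->
    e <= c * M * mesh_step x i ^+ n -> e <= c * h ^+ n * M.
  move=> iN c0 M0 /le_trans; apply; rewrite mulrAC ler_wpM2r//.
  by rewrite ler_wpM2l ?(ltW c0)// hX.
split.
- have [S [dS _ _ du fE]] := reg M1 M1s.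
  exact: (nodal_exactness p0 aab bm0 bp0 hmesh hL hphi (contS1 S dS) (dS 0%N p0)
            cu ua ub du fE huh lQ).
- move=> i iN ik; split=> [l lI hl|g gI hg]; apply: (le_mule_of_gt (mulr_gt0 C0 (hn0 _)) snorm0) => M sM; have [S [dS lipm lipp du fE]] := reg M sM;
    have [e e'] := noninterface_estimate p0 aab bm0 bp0 hmesh hL hphi (contS1 S dS) (dS 0%N p0)
            cu ua ub du fE huh lQ erefl dS lipm lipp iN ik.
    exact: (scale _ _ _ _ _ iN C0 (M_ge0 M sM) (e l lI hl)).
  exact: (scale _ _ _ _ _ iN C0 (M_ge0 M sM) (e' g gI hg)).
have est M (sM : (snorm < M%:E)%E) :
    (forall l, x k.-1 <= l <= x k -> phi p.+1 (to_ref x k l) = 0 ->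
       `|u l - uh l| <= (1 + K * rho) * rho * M * mesh_step x k ^+ (p + 2)) /\
    forall g, x k.-1 < g < x k -> root (L p) (to_ref x k g) -> exists q,
     [/\ has_flux alpha bm bp u g q, has_flux alpha bm bp uh g ((Q k)^`()).[g] &
     `|q - ((Q k)^`()).[g]| <= (1 + K * rho) * (Num.max bp bm * M) * mesh_step x k ^+ (p + 1)].
  have [S [dS lipm lipp du fE]] := reg M sM.
  have [e e'] := interface_estimate p0 aab bm0 bp0 hmesh hL hphi (contS1 S dS) (dS 0%N p0)
          cu ua ub du fE huh lQ erefl (M_ge0 M sM) dS lipm lipp.
  by split=> // g gI hg; exists (S 0%N g); exact: e'.
split=> [l lI hl|g gI hg].
  apply: (le_mule_of_gt (mulr_gt0 D0 (hn0 _)) snorm0) => M sM.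
  exact: (scale _ _ _ _ _ kN D0 (M_ge0 M sM) ((est M sM).1 l lI hl)).
have [q [flu fluh _]] := (est M1 M1s).2 g gI hg.
exists q, ((Q k)^`()).[g]; split=> //.
apply: (le_mule_of_gt (mulr_gt0 (mulr_gt0 D0 bmax0) (hn0 _)) snorm0) => M sM.
have [q' [flu' _ e]] := (est M sM).2 g gI hg.
rewrite (has_flux_unique flu flu').
apply: (scale _ _ _ _ _ kN (mulr_gt0 D0 bmax0) (M_ge0 M sM)).
apply: (le_trans e); apply: ler_wpM2r; first by rewrite exprn_ge0// ltW// step_gt0.
rewrite mulrA; apply: ler_wpM2r; first exact: M_ge0.
by apply: ler_wpM2r; rewrite ?ler_peMr// ltW.
Qed.
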